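(* Let $N\ge2$, let $\Omega\subset\mathbb{R}^N$ be a bounded Lipschitz domain, $s\in(0,1)$, and let $p\in C(\mathbb{R}^N\times\mathbb{R}^N)$ be symmetric with $1<\inf p\le\sup p<N/s$. Let $$\Lambda_1=\inf_{v\in X\setminus\{0\}}\frac{K(v)}{k(v)} .$$ Then $\Lambda_1$ is the first (smallest) eigenvalue, i.e. $\Lambda_1$ is an eigenvalue and every eigenvalue $\Lambda$ satisfies $\Lambda\ge\Lambda_1$; moreover, a minimizer $u\in X\setminus\{0\}$ of $\Lambda_1$ is a corresponding (first) eigenfunction.
   Context: $\bar p(x)=p(x,x)$. $W^{s,\bar p,p(\cdot,\cdot)}(\mathbb{R}^N)=\{u\in L^{\bar p(\cdot)}(\mathbb{R}^N):\int_{\mathbb{R}^N}\int_{\mathbb{R}^N}\frac{|u(x)-u(y)|^{p(x,y)}}{|x-y|^{N+sp(x,y)}}dxdy<\infty\}$ and $X=\{u\in W^{s,\bar p,p(\cdot,\cdot)}(\mathbb{R}^N):u=0\text{ on }\mathbb{R}^N\setminus\Omega\}$. With $\nabla_su(x,y)=\frac{u(x)-u(y)}{|x-y|^s}$, $$K(u)=\inf\Big\{\lambda>0:\int_{\mathbb{R}^N}\int_{\mathbb{R}^N}\Big|\frac{\nabla_su}{\lambda}\Big|^{p(x,y)}\frac{dx\,dy}{p(x,y)|x-y|^N}<1\Big\},\qquad k(u)=\inf\Big\{\lambda>0:\int_\Omega\Big|\frac{u(x)}{\lambda}\Big|^{\bar p(x)}\frac{dx}{\bar p(x)}\le1\Big\}.$$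 $K$ is used as norm on $X$. A real $\Lambda$ is an eigenvalue with eigenfunction $u\in X\setminus\{0\}$ (of the homogeneous eigenvalue problem for the fractional $p(\cdot,\cdot)$-Laplacian in $\Omega$) if for all $\varphi\in X$ $$\int_{\mathbb{R}^N}\int_{\mathbb{R}^N}\Big|\frac{\nabla_su}{K(u)}\Big|^{p(x,y)-2}\frac{\nabla_su}{K(u)}\nabla_s\varphi\,\frac{dx\,dy}{|x-y|^N}=\Lambda\,S(u)\int_\Omega\Big|\frac{u}{k(u)}\Big|^{\bar p(x)-2}\frac{u}{k(u)}\varphi\,dx,$$ where $$S(u)=\frac{\displaystyle\int_{\mathbb{R}^N}\int_{\mathbb{R}^N}\Big|\frac{\nabla_su}{K(u)}\Big|^{p(x,y)}\frac{dx\,dy}{|x-y|^N}}{\displaystyle\int_\Omega\Big|\frac{u}{k(u)}\Big|^{\bar p(x)}dx}.$$ *)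

(* Defs.v *)
From HB Require Import structures.
From mathcomp Require Import all_boot all_order all_algebra.
From mathcomp Require Import all_classical all_reals all_analysis.

Set Implicit Arguments.
Unset Strict Implicit.
Unset Printing Implicit Defensive.

Import Order.TTheory GRing.Theory Num.Theory.
Import numFieldNormedType.Exports.

Local Open Scope classical_set_scope.
Local Open Scope ring_scope.

(* R^n is 'rV[R]_n.  Its library topology is the product topology, but its
   library norm is the sup norm, hence the Euclidean norm enorm below. *)

Section euclidean_space.
Context {R : realType} {n : nat}.
Implicit Types x y : 'rV[R]_n.

Definition edot x y : R := \sum_(i < n) x ord0 i * y ord0 i.

Definition enorm x : R := Num.sqrt (edot x x).

End euclidean_space.

Definition measure_rV_display : measure_display -> measure_display.
Proof. exact. Qed.

(* The product sigma-algebra on R^n (as for n.-tuple in the library), that is,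
   the Borel sigma-algebra. *)
Section measurable_rV.
Context {R : realType} {n : nat}.

Let coord : 'I_n -> 'rV[R]_n -> R := fun i x => x ord0 i.

Let rV_set0 : g_sigma_preimage coord set0.
Proof. exact: sigma_algebra0. Qed.

Let rV_setC A : g_sigma_preimage coord A -> g_sigma_preimage coord (~` A).
Proof. exact: sigma_algebraC. Qed.

Let rV_bigcup (F : _^nat) : (forall i, g_sigma_preimage coord (F i)) ->
  g_sigma_preimage coord (\bigcup_i (F i)).
Proof. exact: sigma_algebra_bigcup. Qed.

HB.instance Definition _ :=
  @isMeasurable.Build (measure_rV_display default_measure_display)
    'rV[R]_n (g_sigma_preimage coord) rV_set0 rV_setC rV_bigcup.

End measurable_rV.

Lemma measurable_coord (R : realType) n (i : 'I_n) :
  measurable_fun [set: 'rV[R]_n] (fun x : 'rV[R]_n => x ord0 i : R).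
Proof.
move=> _ Y mY; rewrite setTI; apply: sub_sigma_algebra => /=.
rewrite -bigcup_seq/=; exists i => /=; first by rewrite mem_index_enum.
by exists Y => //; rewrite setTI.
Qed.

Lemma measurable_fun_coordP (R : realType) d (T : measurableType d) n
    (f : T -> 'rV[R]_n) :
  (forall i, measurable_fun [set: T] (fun t => f t ord0 i)) ->
  measurable_fun [set: T] f.
Proof.
move=> mf; apply: measurability; first by [].
move=> _ [B + <-]; rewrite -bigcup_seq => -[i _ [C mC <-]].
by have := mf i measurableT _ mC; rewrite !setTI.
Qed.

Section lebesgue_step.
Context {R : realType} {n : nat}.

Definition rV_cons (z : measurableTypeR R * 'rV[R]_n) : 'rV[R]_n.+1 :=
  \row_(i < n.+1) if unlift ord0 i is Some j then z.2 ord0 j else z.1.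

Lemma measurable_rV_cons : measurable_fun setT rV_cons.
Proof.
apply: measurable_fun_coordP => i.
case: (unliftP ord0 i) => [j ->|->].
- under eq_fun do rewrite mxE liftK.
  exact: (measurableT_comp (measurable_coord j) measurable_snd).
- under eq_fun do rewrite mxE unlift_none.
  exact: measurable_fst.
Qed.

Definition rV_uncons (x : 'rV[R]_n.+1) : measurableTypeR R * 'rV[R]_n :=
  (x ord0 ord0, \row_(j < n) x ord0 (lift ord0 j)).

Lemma rV_consK : cancel rV_cons rV_uncons.
Proof.
move=> [a x]; rewrite /rV_uncons mxE unlift_none; congr pair.
by apply/rowP => j; rewrite !mxE liftK.
Qed.

Lemma measurable_rV_uncons : measurable_fun setT rV_uncons.
Proof.
apply: measurable_fun_pair; first exact: measurable_coord.
apply: measurable_fun_coordP => i; under eq_fun do rewrite mxE.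
exact: measurable_coord.
Qed.

Variable mu : {sigma_finite_measure set 'rV[R]_n -> \bar R}.

(* The product of the Lebesgue measure on the line (first coordinate) and mu. *)
Definition lebesgue_step : set 'rV[R]_n.+1 -> \bar R :=
  pushforward (@lebesgue_measure R \x mu)%E rV_cons.

Let lebesgue_step0 : lebesgue_step set0 = 0%E.
Proof. by rewrite /lebesgue_step /pushforward preimage_set0 measure0. Qed.

Let lebesgue_step_ge0 A : (0 <= lebesgue_step A)%E.
Proof. by rewrite /lebesgue_step /pushforward; exact: measure_ge0. Qed.

Let lebesgue_step_sigma_additive : semi_sigma_additive lebesgue_step.
Proof.
have := @measure_semi_sigma_additive _ _ _
  (measure_function_pushforward__canonical__measure_function_Measure
    (@lebesgue_measure R \x mu)%E measurable_rV_cons).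
exact.
Qed.

HB.instance Definition _ := isMeasure.Build _ _ _ lebesgue_step
  lebesgue_step0 lebesgue_step_ge0 lebesgue_step_sigma_additive.

Let lebesgue_step_sigma_finite : sigma_finite setT lebesgue_step.
Proof.
have /sigma_finiteP[F [TF ndF Foo]] := sigma_finiteT (@lebesgue_measure R).
have /sigma_finiteP[G [TG ndG Goo]] := sigma_finiteT mu.
exists (fun k => rV_uncons @^-1` (F k `*` G k)).
  rewrite -preimage_bigcup -[LHS](preimage_setT rV_uncons); congr (_ @^-1` _).
  apply/seteqP; split => // -[x y] _.
  have [i _ Fix] : (\bigcup_i F i) x by rewrite -TF.
  have [j _ Gjy] : (\bigcup_i G i) y by rewrite -TG.
  exists (maxn i j) => //; split => /=.
  - by move: x Fix; exact/subsetPset/ndF/leq_maxl.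
  - by move: y Gjy; exact/subsetPset/ndG/leq_maxr.
move=> k; have [mFk Fkoo] := Foo k; have [mGk Gkoo] := Goo k; split.
  rewrite -[X in measurable X]setTI; apply: measurable_rV_uncons => //.
  exact: measurableX.
rewrite /lebesgue_step /pushforward -comp_preimage.
rewrite (_ : rV_uncons \o rV_cons = id); last first.
  by apply/funext => z /=; rewrite rV_consK.
by rewrite preimage_id product_measure1E// lte_mul_pinfty// ge0_fin_numE.
Qed.

HB.instance Definition _ := Measure_isSigmaFinite.Build _ _ _ lebesgue_step
  lebesgue_step_sigma_finite.

End lebesgue_step.

(* Lebesgue measure on R^n; R^0 is a single point, of mass 1. *)
Fixpoint lebesgue_rV (R : realType) (n : nat) :
    {sigma_finite_measure set 'rV[R]_n -> \bar R} :=
  match n with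
  | 0 => \d_(0 : 'rV[R]_0)
  | m.+1 => lebesgue_step (lebesgue_rV R m)
  end.

Lemma lebesgue_rV_box (R : realType) n (A : 'I_n -> set R) :
  (forall i, measurable (A i)) ->
  lebesgue_rV R n [set x | forall i, A i (x ord0 i)] =
  (\prod_(i < n) lebesgue_measure (A i))%E.
Proof.
elim: n A => [|n ih] A mA.
  rewrite big_ord0 /= diracE mem_set//.
  by case.
rewrite big_ord_recl -ih// /= /lebesgue_step /pushforward.
rewrite -product_measure1E//.
  congr (_ _); apply/seteqP; split => -[a x] /=.
    move=> h; split; first by have := h ord0; rewrite mxE unlift_none.
    by move=> i; have := h (lift ord0 i); rewrite mxE liftK.
  move=> [h1 h2] i; rewrite mxE; case: unliftP => [j ->|->] //=.
- exact: mA.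
- rewrite (_ : (fun x : 'rV[R]_n => _) =
      \bigcap_(i in [set: 'I_n]) ((fun x => x ord0 i) @^-1` A (lift ord0 i))).
    apply: fin_bigcap_measurable => // i _.
    by rewrite -[X in measurable X]setTI; exact: measurable_coord.
  by apply/seteqP; split => x /= => [h i _|h i]; [exact: h|exact: (h i I)].
Qed.

Section lipschitz_domain.
Context {R : realType} {n : nat}.

(* Near each boundary point, Omega is the strict epigraph, in the direction of
   a unit vector e, of a Lipschitz function g of the component orthogonal to
   e.  Only the values of g on the hyperplane orthogonal to e matter. *)
Definition bounded_lipschitz_domain (Omega : set 'rV[R]_n) : Prop :=
  [/\ Omega !=set0, open Omega, connected Omega, bounded_set Omega &
    forall x0, (closure Omega `\` interior Omega) x0 ->
    exists (r L : R) (e : 'rV[R]_n) (g : 'rV[R]_n -> R),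
    [/\ 0 < r, enorm e = 1,
        forall y z, edot y e = 0 -> edot z e = 0 ->
          `|g y - g z| <= L * enorm (y - z) &
        forall x, enorm (x - x0) < r ->
          (Omega x <-> g (x - edot x e *: e) < edot x e)]].

End lipschitz_domain.

(* Integrals that have to be finite are stated in \bar R.  On the space X below
   all the integrals are finite and all the sets of which an infimum is taken
   are nonempty and bounded below, so that the default value 0 of Rintegral
   and of inf is never met.  Divisions by a power of |x - y| are irrelevant on
   the diagonal, which has measure zero. *)
Section eigenvalue_problem.
Context {R : realType} {n : nat}.
Variables (s : R) (p : 'rV[R]_n -> 'rV[R]_n -> R) (Omega : set 'rV[R]_n).
Implicit Types (u v phi : 'rV[R]_n -> R) (z : 'rV[R]_n * 'rV[R]_n).

Local Notation leb := (lebesgue_rV R n).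
Local Notation leb2 := (lebesgue_rV R n \x lebesgue_rV R n)%E.

Definition pbar (x : 'rV[R]_n) : R := p x x.

Definition nabla_s u z : R := (u z.1 - u z.2) / enorm (z.1 - z.2) `^ s.

(* The exponent pbar being bounded, membership in the variable exponent
   Lebesgue space is finiteness of the modular. *)
Definition lebesgue_space_pbar : set ('rV[R]_n -> R) :=
  [set u : 'rV[R]_n -> R | measurable_fun setT u /\
           (\int[leb]_x (`|u x| `^ pbar x)%:E < +oo)%E].

Definition sobolev_space : set ('rV[R]_n -> R) :=
  [set u : 'rV[R]_n -> R | lebesgue_space_pbar u /\
    (\int[leb2]_z (`|u z.1 - u z.2| `^ p z.1 z.2
       / enorm (z.1 - z.2) `^ (n%:R + s * p z.1 z.2))%:E < +oo)%E].

(* Functions stand for their classes modulo equality almost everywhere. *)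
Definition spaceX : set ('rV[R]_n -> R) :=
  [set u : 'rV[R]_n -> R | sobolev_space u /\
           {ae leb, forall x, (~` Omega) x -> u x = 0}].

Definition spaceX_nonzero : set ('rV[R]_n -> R) :=
  [set u : 'rV[R]_n -> R | spaceX u /\ ~ {ae leb, forall x, u x = 0}].

Definition normK u : R :=
  inf [set l : R | 0 < l /\
    (\int[leb2]_z (`|nabla_s u z / l| `^ p z.1 z.2
       / (p z.1 z.2 * enorm (z.1 - z.2) ^+ n))%:E < 1)%E].

Definition normk u : R :=
  inf [set l : R | 0 < l /\
    (\int[leb]_(x in Omega) (`|u x / l| `^ pbar x / pbar x)%:E <= 1)%E].

Definition ratioS u : R :=
  (\int[leb2]_z (`|nabla_s u z / normK u| `^ p z.1 z.2
     / enorm (z.1 - z.2) ^+ n))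
  / (\int[leb]_(x in Omega) (`|u x / normk u| `^ pbar x)).

(* For t = 0 the product `|t| `^ (q - 2) * t is 0, also when q < 2. *)
Definition eigenpair (Lambda : R) u : Prop :=
  spaceX_nonzero u /\
  forall phi, spaceX phi ->
    \int[leb2]_z (`|nabla_s u z / normK u| `^ (p z.1 z.2 - 2)
        * (nabla_s u z / normK u) * nabla_s phi z / enorm (z.1 - z.2) ^+ n)
    = Lambda * ratioS u *
      \int[leb]_(x in Omega) (`|u x / normk u| `^ (pbar x - 2)
        * (u x / normk u) * phi x).

Definition eigenvalue_frac (Lambda : R) : Prop :=
  exists u, eigenpair Lambda u.

Definition Lambda1 : R :=
  inf [set normK v / normk v | v in spaceX_nonzero].

Definition minimizer u : Prop :=
  spaceX_nonzero u /\ normK u / normk u = Lambda1.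

End eigenvalue_problem.

(* Main.v *)
(* Existence of a minimizer: take u_j in X with k(u_j) = 1 and K(u_j) tending to
   Lambda1.  Replacing u_j by its means over a fine grid of cubes costs little
   in L^1, uniformly in j, so that a subsequence converges almost everywhere to
   some u, and K(u) <= Lambda1 by Fatou's lemma.  That k(u) >= 1 follows from the
   uniform integrability of |u_j|^pbar: comparing u(x) with the values of u on a
   cube of volume proportional to 1 / |u(x)| bounds |u(x)|^(pbar(x) + delta) by a
   multiple of 1 + int |u(x) - u(y)|^p(x,y) / |x - y|^(N + s p(x,y)) dy, since p
   is nearly constant on such a small cube.

   A minimizer u is an eigenfunction: if the equation failed for phi, then for
   a suitable combination psi of phi and u the derivative of K at u along psi
   would be negative and that of k positive, so that K / k would drop below
   Lambda1 at u + t psi.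

   Testing the equation of an eigenpair with phi = u gives
   Lambda = K(u) / k(u) >= Lambda1. *)

Require Import Defs.
From HB Require Import structures.
From mathcomp Require Import all_boot all_order all_algebra.
From mathcomp Require Import all_classical all_reals all_analysis.
From mathcomp Require Import measurable_realfun.
From mathcomp Require Import ring lra.

Set Implicit Arguments.
Unset Strict Implicit.
Unset Printing Implicit Defensive.

Import Order.TTheory GRing.Theory Num.Theory.
Import numFieldNormedType.Exports.

Local Open Scope classical_set_scope.
Local Open Scope ring_scope.

(** * Inequalities for powers *)

(** Both norms are of Luxemburg type with a variable exponent: they have no closed formula, and
    their modulars are not homogeneous. All facts about K and k are therefore drawn from three
    properties of a modular: scaling by c >= 1 multiplies it by a factor between c and c^qM, it
    equals 1 at u divided by its norm, and it lies above its tangents. No norm is differentiated; a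
    negative derivative of the modular at u / K(u) is what lowers K.

    The obstacle to existence is that p is merely continuous, so that the exponent cannot be frozen
    globally. Compactness is sought in L^1 only, where the exponent hardly matters. The constraint
    is kept by a gain of integrability: on a cube of volume of order 1 / |u(x)|, fractional scaling
    gains a power of |u(x)| of order s / N, while the oscillation of p costs only a quarter of s /
    N. The cube must be small for p to vary that little, so the estimate concerns large |u(x)|,
    which is all that uniform integrability asks for.

    X must also be shown to contain a nonzero function, as an infimum over the empty set would be
    the default 0. *)

Section powR_inequalities.
Context {R : realType}.
Implicit Types a b c p q t : R.

Lemma powR_le1D t q p : 0 <= t -> 0 <= q -> q <= p -> t `^ q <= 1 + t `^ p.
Proof.
move=> t0 q0 qp; have [t1|t1] := leP t 1.
  rewrite -[leLHS]addr0 lerD ?powR_ge0//.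
  have : t `^ q <= 1 `^ q by rewrite ge0_ler_powR// nnegrE.
  by rewrite powR1.
by rewrite -[leLHS]add0r lerD// ler_powR// ltW.
Qed.

Lemma powRD_le a b p : 0 <= a -> 0 <= b -> 0 <= p ->
  (a + b) `^ p <= 2 `^ p * (a `^ p + b `^ p).
Proof.
move=> a0 b0 p0; wlog ab : a b a0 b0 / a <= b.
  move=> h; case: (leP a b) => [ab|/ltW ab]; first exact: h.
  by rewrite (addrC a) (addrC (a `^ p)); exact: h.
apply: (@le_trans _ _ ((2 * b) `^ p)).
  by rewrite ge0_ler_powR// ?nnegrE; lra.
by rewrite powRM// ler_wpM2l ?powR_ge0// lerDr powR_ge0.
Qed.

Lemma normr_powRB2M a p : 1 < p -> `|a| `^ (p - 2) * a * a = `|a| `^ p.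
Proof.
move=> p1; rewrite -mulrA -expr2 -real_normK ?num_real// -powR_mulrn//.
have [->|a0] := eqVneq a 0.
  by rewrite normr0 [_ `^ 2]powR0 ?mulr0 ?powR0//; lra.
by rewrite -powRD ?subrK// normr_eq0 a0 implybT.
Qed.

Lemma normr_powRB2 a p : 1 < p -> `| (`|a| `^ (p - 2) * a) | = `|a| `^ (p - 1).
Proof.
move=> p1; rewrite normrM ger0_norm ?powR_ge0//.
have [->|a0] := eqVneq a 0.
  by rewrite normr0 mulr0 powR0//; lra.
rewrite -{2}(@powRr1 _ `|a|)// -powRD ?normr_eq0 ?a0 ?implybT//.
by congr (_ `^ _); lra.
Qed.

(** The larger of a and b bounds both factors. This crude Young inequality, without constants
    depending on p, provides the dominating functions for the mixed integrands of [dmodular]. *)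
Lemma powRB1M_le a b p : 1 <= p -> 0 <= a -> 0 <= b ->
  a `^ (p - 1) * b <= a `^ p + b `^ p.
Proof.
move=> p1 a0 b0.
have key c : 0 <= c -> c `^ (p - 1) * c = c `^ p.
  by move=> c0; rewrite mulrC mulr_powRB1//; lra.
have [ab|/ltW ab] := leP a b.
  apply: (@le_trans _ _ (b `^ (p - 1) * b)).
    by rewrite ler_wpM2r// ge0_ler_powR ?nnegrE//; lra.
  by rewrite key// lerDr powR_ge0.
apply: (@le_trans _ _ (a `^ (p - 1) * a)).
  by rewrite ler_wpM2l// powR_ge0.
by rewrite key// lerDl powR_ge0.
Qed.

Lemma powR_young a b p : 1 < p -> 0 <= a -> 0 <= b ->
  a `^ (p - 1) * b <= (1 - p^-1) * a `^ p + b `^ p / p.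
Proof.
move=> p1 a0 b0.
have p0 : p != 0 by lra.
have p10 : p - 1 != 0 by lra.
have e : (1 - p^-1)^-1 = p / (p - 1) by field; rewrite p10 p0.
have := @conjugate_powR R (a `^ (p - 1)) b (1 - p^-1)^-1 p.
have e2 : (p - 1) * (1 - p^-1)^-1 = p by rewrite e; field.
rewrite -powRrM e2 invrK.
rewrite [X in _ <= X + _]mulrC; apply => //.
- exact: powR_ge0.
- by rewrite e divr_gt0; lra.
- lra.
- lra.
Qed.

(** Convexity of t -> |t|^p / p: the graph lies above the tangent at a. It comes from Young's
    inequality for |a|^(p - 1) and |a + b| rather than from calculus, so that a = 0 needs no
    separate argument when p < 2. *)
Lemma powR_tangent a b p : 1 < p ->
  `|a| `^ p / p + `|a| `^ (p - 2) * a * b <= `|a + b| `^ p / p.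
Proof.
move=> p1.
have -> : `|a| `^ (p - 2) * a * b =
    `|a| `^ (p - 2) * a * (a + b) - `|a| `^ p.
  by rewrite mulrDr normr_powRB2M//; ring.
have h : `|a| `^ (p - 2) * a * (a + b) <= `|a| `^ (p - 1) * `|a + b|.
  by rewrite -normr_powRB2// -normrM ler_norm.
have := @powR_young `|a| `|a + b| p p1 (normr_ge0 _) (normr_ge0 _).
set A := _ `^ p; set B := _ `^ p => h2.
have := le_trans h h2; rewrite mulrBl mul1r (mulrC _ A) => h3; lra.
Qed.

End powR_inequalities.

Lemma measurable_fun_powR2 d (T : measurableType d) (R : realType) (f q : T -> R) :
  measurable_fun setT f -> measurable_fun setT q ->
  measurable_fun setT (fun x => f x `^ q x).
Proof.
move=> mf mq; rewrite /powR; apply: measurable_fun_ifT.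
- by apply: measurable_fun_eqr => //; exact: measurable_cst.
- have mb : measurable_fun setT (fun x => q x == 0).
    by apply: measurable_fun_eqr => //; exact: measurable_cst.
  rewrite (_ : (fun x => _) = (fun x => if q x == 0 then 1 else 0)); last first.
    by apply/funext => x; case: (_ == _).
  by apply: measurable_fun_ifT => //; exact: measurable_cst.
- apply: measurableT_comp => //; apply: measurable_funM => //.
  exact: measurableT_comp.
Qed.

(** * Measurability on R^n *)

Section measurability_rV.
Context {R : realType} {n : nat}.
Local Notation rV := 'rV[R]_n.

Lemma measurable_rV_box (A : 'I_n -> set R) :
  (forall i, measurable (A i)) ->
  measurable [set x : rV | forall i, A i (x ord0 i)].
Proof.
move=> mA; rewrite (_ : [set x | _] =
    \bigcap_(i in [set: 'I_n]) ((fun x : rV => x ord0 i) @^-1` A i)).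
  apply: fin_bigcap_measurable => // i _.
  by rewrite -[X in measurable X]setTI; exact: measurable_coord.
by apply/seteqP; split => x /= h i; [move=> _; exact: h|exact: h].
Qed.

Definition rat_box (c : 'rV[rat]_n * nat) : set rV :=
  [set x | forall i, `]ratr (c.1 ord0 i) - c.2.+1%:R^-1,
                       ratr (c.1 ord0 i) + c.2.+1%:R^-1[%classic (x ord0 i)].

Lemma measurable_rat_box c : measurable (rat_box c).
Proof.
apply: (@measurable_rV_box (fun i => `]ratr (c.1 ord0 i) - c.2.+1%:R^-1,
                       ratr (c.1 ord0 i) + c.2.+1%:R^-1[%classic)) => i.
exact: measurable_itv.
Qed.

Lemma rat_box_sub_ball (x : rV) (e : R) : 0 < e ->
  exists2 c, rat_box c x & rat_box c `<=` ball x e.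
Proof.
move=> e0.
have [k _ /(_ k (leqnn k)) ke] := near_infty_natSinv_lt (PosNum (divr_gt0 e0 (ltr0n _ 2))).
have k0 : 0 < k.+1%:R^-1 :> R by rewrite invr_gt0 ltr0n.
pose f i : rat := xget 0 [set q : rat | `|x ord0 i - ratr q| < k.+1%:R^-1].
have fP i : `|x ord0 i - ratr (f i)| < k.+1%:R^-1.
  rewrite /f; case: xgetP => // nex; exfalso.
  have xk : x ord0 i < x ord0 i + k.+1%:R^-1 by rewrite ltrDl.
  have [q] := rat_in_itvoo xk.
  rewrite in_itv/= => /andP[q1 q2]; apply: (nex q) => /=.
  by rewrite distrC gtr0_norm ?subr_gt0// ltrBlDl.
exists (\row_i f i, k) => [i/=|y /= yc].
  by rewrite in_itv/= mxE -ltr_distl.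
split=> // i j; have := yc j; rewrite /= in_itv/= mxE -ltr_distl => h.
rewrite !ord1 /ball/= (le_lt_trans (ler_distD (ratr (f j)) _ _))//.
rewrite [ltRHS](splitr e) ltrD//; first exact: lt_trans (fP j) _.
by rewrite distrC; exact: lt_trans h _.
Qed.

(** The sigma-algebra is generated by coordinates, not by open sets. An open set is the union of the
    products of boxes with rational centres and radii 1/(k+1) that it contains, and there are
    countably many of these. *)
Lemma open_measurable_rV2 (U : set (rV * rV)) : open U -> measurable U.
Proof.
move=> oU.
pose D := [set c : ('rV[rat]_n * nat) * ('rV[rat]_n * nat) |
  rat_box c.1 `*` rat_box c.2 `<=` U].
rewrite (_ : U = \bigcup_(c in D) (rat_box c.1 `*` rat_box c.2)).
  rewrite bigcup_mkcond; apply: countable_bigcupT_measurable => // c.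
  by case: ifP => // _; apply: measurableX; exact: measurable_rat_box.
apply/seteqP; split => [[x y] Uxy|z [c Dc]]; last exact: Dc.
have /nbhs_ballP[e /= e0 eU] : nbhs (x, y) U by exact: open_nbhs_nbhs.
have [c cx cU] := rat_box_sub_ball x e0.
have [d dy dU] := rat_box_sub_ball y e0.
exists (c, d) => // -[a b] [/= ca db]; apply: eU; split => /=; [exact: cU|exact: dU].
Qed.

Lemma continuous_measurable_rV2 (f : rV * rV -> R) :
  continuous f -> measurable_fun setT f.
Proof.
move=> cf; apply: (measurability _ (RGenOpens.measurableE R)).
move=> _ [_ [a [b ->]] <-]; rewrite setTI; apply: open_measurable_rV2.
by move/continuousP : cf; apply; exact: interval_open.
Qed.

Lemma measurable_diag_rV : measurable_fun setT (fun x : rV => (x, x)).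
Proof. by apply: measurable_fun_pair. Qed.

Lemma open_measurable_rV (U : set rV) : open U -> measurable U.
Proof.
move=> oU; have -> : U = (fun x => (x, x)) @^-1` (fst @^-1` U : set (rV * rV)).
  by [].
rewrite -[X in measurable X]setTI; apply: measurable_diag_rV => //.
apply: open_measurable_rV2.
by apply: open_comp => // x _; exact: cvg_fst.
Qed.

Lemma measurable_enormB :
  measurable_fun setT (fun z : rV * rV => enorm (z.1 - z.2)).
Proof.
have ms : measurable_fun setT (@Num.sqrt R).
  by apply: continuous_measurable_fun; exact: sqrt_continuous.
apply: (measurableT_comp ms).
rewrite /edot; apply: measurable_sum => i.
have mi : measurable_fun setT (fun z : rV * rV => (z.1 - z.2) ord0 i).
  under eq_fun do rewrite !mxE.
  by apply: measurable_funB; apply: (measurableT_comp (measurable_coord i)).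
exact: measurable_funM.
Qed.

End measurability_rV.

(** * Modulars and Luxemburg norms *)

Section powR_continuity.
Context {R : realType}.

Lemma powR_continuous (p a : R) : 0 < a -> {for a, continuous (@powR R ^~ p)}.
Proof.
move=> a0; apply: (differentiable_continuous (V := R) (W := R)).
apply/derivable1_diffP; apply: derivable_powR.
by rewrite in_itv/= a0.
Qed.

(** Away from 0 both factors are continuous. At 0, where [p - 2] may be negative, the modulus |a|^(p
    - 1) tends to 0. *)
Lemma normr_powRB2_continuous (p : R) : 1 < p ->
  continuous (fun a : R => `|a| `^ (p - 2) * a).
Proof.
move=> p1 a; have [->|a0] := eqVneq a 0; last first.
  apply: (@cvgM R); last exact: cvg_id.
  apply: (@cvg_comp _ _ _ (fun x : R => `|x|) (@powR R ^~ (p - 2)) _ (nbhs `|a|)).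
    exact: norm_continuous.
  by apply: powR_continuous; rewrite normr_gt0.
rewrite /continuous_at mulr0; apply/cvgrPdist_lt => e e0.
have p10 : 0 < p - 1 by rewrite subr_gt0.
near=> x; rewrite sub0r normrN normr_powRB2//.
have -> : e = (e `^ (p - 1)^-1) `^ (p - 1).
  by rewrite -powRrM mulVf ?powRr1 ?gt_eqF// ltW.
rewrite gt0_ltr_powR// ?nnegrE ?powR_ge0//.
near: x; apply/nbhs_ballP; exists (e `^ (p - 1)^-1) => /=.
  exact: powR_gt0.
by move=> y; rewrite /ball/= sub0r normrN.
Unshelve. all: by end_near. Qed.

End powR_continuity.

Section modular.
Context d (T : measurableType d) (R : realType).
Variables (mu : {measure set T -> \bar R}) (D : set T) (q w : T -> R).
Variables qm qM : R.
Implicit Types (f g h : T -> R).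

(* The modulars behind normK and normk are taken with density 1 / w, where
   w = |x - y|^n on R^n x R^n and w = 1 on Omega. *)
Definition finite_modular : set (T -> R) := [set f : T -> R | measurable_fun setT f /\
  (\int[mu]_(x in D) (`|f x| `^ q x / w x)%:E < +oo)%E].

Definition modular f : R := \int[mu]_(x in D) (`|f x| `^ q x / (q x * w x)).

(** The derivative of [modular] at f in the direction g; the factor q x produced by differentiation
    cancels the one in the density. *)
Definition dmodular f g : R :=
  \int[mu]_(x in D) (`|f x| `^ (q x - 2) * f x * g x / w x).

(* P is (fun x => x < 1) for normK and (fun x => x <= 1) for normk. *)
Definition luxemburg (P : \bar R -> Prop) f : R := inf [set l | 0 < l /\
  P (\int[mu]_(x in D) (`|f x / l| `^ q x / (q x * w x))%:E)%E].

Hypotheses (mD : measurable D) (mq : measurable_fun setT q).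
Hypotheses (mw : measurable_fun setT w) (w0 : forall x, 0 <= w x).
Hypotheses (qm1 : 1 < qm) (qmq : forall x, qm <= q x) (qqM : forall x, q x <= qM).

Let q1 x : 1 < q x. Proof. exact: lt_le_trans (qmq x). Qed.
Let q0 x : 0 < q x. Proof. by apply: lt_trans (q1 x). Qed.
Let qw0 x : 0 <= (q x * w x)^-1.
Proof. by rewrite invr_ge0 mulr_ge0// ltW. Qed.
Let wV0 x : 0 <= (w x)^-1. Proof. by rewrite invr_ge0. Qed.
Let qM0 : 0 < qM.
Proof. by apply: lt_le_trans (qqM point); exact: q0. Qed.

Lemma measurable_normr_powR f r : measurable_fun setT f -> measurable_fun setT r ->
  measurable_fun setT (fun x => `|f x| `^ r x).
Proof. by move=> mf mr; apply: measurable_fun_powR2 => //; exact: measurableT_comp. Qed.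

Lemma measurable_funV f : measurable_fun setT f -> (forall x, 0 <= f x) ->
  measurable_fun setT (fun x => (f x)^-1).
Proof.
move=> mf f0; under eq_fun do rewrite -powR_inv1//.
by apply: measurable_fun_powR2 => //; exact: measurable_cst.
Qed.

Lemma measurable_modular_integrand f : measurable_fun setT f ->
  measurable_fun setT (fun x => `|f x| `^ q x / w x).
Proof.
move=> mf; apply: measurable_funM; first exact: measurable_normr_powR.
exact: measurable_funV.
Qed.

Lemma measurable_dmodular_integrand f g : measurable_fun setT f -> measurable_fun setT g ->
  measurable_fun setT (fun x => `|f x| `^ (q x - 2) * f x * g x / w x).
Proof.
move=> mf mg; apply: measurable_funM; last exact: measurable_funV.
apply: measurable_funM => //; apply: measurable_funM => //.
by apply: measurable_normr_powR => //; exact: measurable_funB.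
Qed.

Lemma finite_modular_integrable f : finite_modular f ->
  mu.-integrable D (EFin \o (fun x => `|f x| `^ q x / w x)).
Proof.
move=> [mf foo]; apply/integrableP; split.
  by apply/measurable_EFinP; apply: measurable_funTS; exact: measurable_modular_integrand.
rewrite (eq_integral (fun x => (`|f x| `^ q x / w x)%:E))// => x _ /=.
by rewrite ger0_norm// mulr_ge0// powR_ge0.
Qed.

Let dom f g h : finite_modular f -> finite_modular g -> measurable_fun setT h ->
  forall c, (forall x, `|h x| <= c * (`|f x| `^ q x / w x + `|g x| `^ q x / w x)) ->
  mu.-integrable D (EFin \o h).
Proof.
move=> /finite_modular_integrable fi /finite_modular_integrable gi mh c hle.
have := integrableZl mD c (integrableD mD fi gi).
apply: le_integrable => //; first by apply/measurable_EFinP; exact: measurable_funTS.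
by move=> x _ /=; rewrite lee_fin (le_trans (hle x))// ler_norm.
Qed.

Lemma finite_modularZ c f : finite_modular f -> finite_modular (fun x => c * f x).
Proof.
move=> Lf; have [mf _] := Lf.
have mcf : measurable_fun setT (fun x => c * f x) by exact: measurable_funM.
split=> //; apply: (@integrable_lty _ _ _ mu D mD
  (EFin \o (fun x => `|c * f x| `^ q x / w x))).
apply: (@dom f f _ Lf Lf _ (1 + `|c| `^ qM)).
  exact: measurable_modular_integrand.
move=> x; rewrite ger0_norm ?mulr_ge0 ?powR_ge0//.
rewrite normrM powRM// -mulrA; apply: ler_pM; rewrite ?mulr_ge0 ?powR_ge0//.
  by apply: powR_le1D => //; rewrite ltW.
by rewrite lerDl mulr_ge0 ?powR_ge0.
Qed.

Lemma finite_modularD f g : finite_modular f -> finite_modular g ->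
  finite_modular (fun x => f x + g x).
Proof.
move=> Lf Lg; have [[mf _] [mg _]] := (Lf, Lg).
have mfg : measurable_fun setT (fun x => f x + g x) by exact: measurable_funD.
split=> //; apply: (@integrable_lty _ _ _ mu D mD
  (EFin \o (fun x => `|f x + g x| `^ q x / w x))).
apply: (@dom f g _ Lf Lg _ (2 `^ qM)).
  exact: measurable_modular_integrand.
move=> x; rewrite ger0_norm ?mulr_ge0 ?powR_ge0//.
rewrite -mulrDl mulrA ler_wpM2r//.
apply: (@le_trans _ _ ((`|f x| + `|g x|) `^ q x)).
  by rewrite ge0_ler_powR ?nnegrE ?addr_ge0 ?ler_normD// ltW.
rewrite (le_trans (powRD_le _ _ _))//; first exact/ltW.
by rewrite ler_wpM2r ?addr_ge0 ?powR_ge0// ler_powR// ler1n.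
Qed.

Lemma modular_integrable f : finite_modular f ->
  mu.-integrable D (EFin \o (fun x => `|f x| `^ q x / (q x * w x))).
Proof.
move=> Lf; have [mf _] := Lf; apply: (@dom f f _ Lf Lf _ 1).
  apply: measurable_funM; first exact: measurable_normr_powR.
  apply: measurable_funV; first exact: measurable_funM.
  by move=> x; rewrite mulr_ge0// ltW.
move=> x; rewrite mul1r ger0_norm ?mulr_ge0 ?powR_ge0//.
rewrite -[leLHS]addr0 lerD ?mulr_ge0 ?powR_ge0//.
rewrite ler_wpM2l ?powR_ge0// invfM -[leRHS]mul1r ler_wpM2r//.
by rewrite invf_le1// ltW.
Qed.

Lemma EFin_modular f : finite_modular f ->
  (modular f)%:E = (\int[mu]_(x in D) (`|f x| `^ q x / (q x * w x))%:E)%E.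
Proof. by move=> /modular_integrable fi; rewrite fineK//; exact: integrable_fin_num. Qed.

Let dmodular_le f g x :
  `| (`|f x| `^ (q x - 2) * f x * g x / w x) | <= `|f x| `^ q x / w x + `|g x| `^ q x / w x.
Proof.
rewrite !normrM (ger0_norm (wV0 x)) -mulrDl ler_wpM2r//.
rewrite -normrM normr_powRB2//; apply: powRB1M_le => //; exact: ltW.
Qed.

Lemma dmodular_integrable f g : finite_modular f -> finite_modular g ->
  mu.-integrable D (EFin \o (fun x => `|f x| `^ (q x - 2) * f x * g x / w x)).
Proof.
move=> Lf Lg; have [[mf _] [mg _]] := (Lf, Lg); apply: (@dom f g _ Lf Lg _ 1).
  exact: measurable_dmodular_integrand.
by move=> x; rewrite mul1r dmodular_le.
Qed.

Lemma modular_ge0 f : 0 <= modular f.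
Proof. by apply: Rintegral_ge0 => x _; rewrite mulr_ge0 ?powR_ge0. Qed.

Lemma dmodularZD f g h c : finite_modular f -> finite_modular g -> finite_modular h ->
  dmodular f (fun x => g x + c * h x) = dmodular f g + c * dmodular f h.
Proof.
move=> Lf Lg Lh; rewrite /dmodular.
rewrite -RintegralZl//; last exact: dmodular_integrable.
rewrite -RintegralD//; [|exact: dmodular_integrable|]; last first.
  have := dmodular_integrable Lf (finite_modularZ c Lh).
  apply: eq_integrable => // x _ /=; congr EFin; ring.
by apply: eq_Rintegral => x _; ring.
Qed.

Lemma dmodular_diag f :
  dmodular f f = \int[mu]_(x in D) (`|f x| `^ q x / w x).
Proof. by apply: eq_Rintegral => x _; rewrite normr_powRB2M. Qed.

(** The two integrands differ by the factor q x, which lies in [qm, qM]; for a constant exponent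
    this is Euler's identity for homogeneous functions. *)
Lemma modular_le_dmodular f : finite_modular f ->
  qm * modular f <= dmodular f f <= qM * modular f.
Proof.
move=> Lf; have mi := modular_integrable Lf; have di := finite_modular_integrable Lf.
have hi c : mu.-integrable D (EFin \o (fun x => c * (`|f x| `^ q x / (q x * w x)))).
  have : mu.-integrable D (fun x => c%:E * (`|f x| `^ q x / (q x * w x))%:E)%E.
    exact: integrableZl.
  by apply: eq_integrable => // x _.
have key x : `|f x| `^ q x / w x = q x * (`|f x| `^ q x / (q x * w x)).
  by rewrite invfM mulrCA (mulrA (q x)) divff ?mul1r// gt_eqF.
rewrite dmodular_diag /modular; apply/andP; split; rewrite -RintegralZl//;
  apply: le_Rintegral => // x _; rewrite key ler_wpM2r// mulr_ge0 ?powR_ge0//.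
Qed.

Lemma modular_tangent f g : finite_modular f -> finite_modular g ->
  modular f + dmodular f g <= modular (fun x => f x + g x).
Proof.
move=> Lf Lg; have Lfg := finite_modularD Lf Lg.
rewrite -RintegralD//; [|exact: modular_integrable|exact: dmodular_integrable].
apply: le_Rintegral => //; last 1 first.
- move=> x _; rewrite !invfM !mulrA -mulrDl ler_wpM2r//.
  exact: powR_tangent.
- have := integrableD mD (modular_integrable Lf) (dmodular_integrable Lf Lg).
  by apply: eq_integrable => // x _.
- exact: modular_integrable.
Qed.

Lemma dmodular_cvg f g : finite_modular f -> finite_modular g ->
  dmodular (fun x => f x + k.+1%:R^-1 * g x) g @[k --> \oo] --> dmodular f g.
Proof.
move=> Lf Lg; have [[mf _] [mg _]] := (Lf, Lg).
pose F (k : nat) x := `|f x + k.+1%:R^-1 * g x| `^ (q x - 2) *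
  (f x + k.+1%:R^-1 * g x) * g x / w x.
pose G x := `|f x| `^ (q x - 2) * f x * g x / w x.
have LF (k : nat) : finite_modular (fun x => f x + k.+1%:R^-1 * g x).
  exact: (finite_modularD Lf (finite_modularZ _ Lg)).
have Lg' : finite_modular (fun x => `|f x| + `|g x|).
  apply: finite_modularD.
    have [_ foo] := Lf; split; first exact: measurableT_comp.
    by under eq_integral do rewrite normr_id.
  have [_ goo] := Lg; split; first exact: measurableT_comp.
  by under eq_integral do rewrite normr_id.
(* [H] dominates every [F k] because the steps 1/(k+1) are at most 1. *)
pose H x := `| (`|f x| + `|g x|) | `^ q x / w x + `|g x| `^ q x / w x.
have mF k : measurable_fun D (EFin \o F k).
  apply/measurable_EFinP; apply: measurable_funTS.
  by apply: measurable_dmodular_integrand => //; have [] := LF k.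
have mG : measurable_fun D (EFin \o G).
  apply/measurable_EFinP; apply: measurable_funTS.
  exact: measurable_dmodular_integrand.
have FG : {ae mu, forall x, D x -> (EFin \o F k) x @[k --> \oo] --> (EFin \o G) x}.
  apply: aeW => x _ /=; apply: cvg_EFin; first exact: nearW.
  apply: cvgMl; apply: cvgMl.
  have xc : f x + k.+1%:R^-1 * g x @[k --> \oo] --> f x.
    rewrite -[X in _ --> X]addr0; apply: cvgD; first exact: cvg_cst.
    rewrite -[X in _ --> X](mul0r (g x)); apply: cvgMl.
    exact: cvg_harmonic.
  exact: (cvg_comp _ _ xc (@normr_powRB2_continuous R (q x) (q1 x) (f x))).
have iH : mu.-integrable D (EFin \o H).
  exact: (integrableD mD (finite_modular_integrable Lg') (finite_modular_integrable Lg)).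
have FH : {ae mu, forall x (k : nat), D x -> (`|(EFin \o F k) x| <= (EFin \o H) x)%E}.
  apply: aeW => x k _ /=; rewrite lee_fin.
  apply: (le_trans (dmodular_le (fun x => f x + k.+1%:R^-1 * g x) g x)).
  rewrite lerD2r ler_wpM2r// ge0_ler_powR ?nnegrE//; first exact: ltW.
  rewrite [leRHS]ger0_norm ?addr_ge0// (le_trans (ler_normD _ _))// lerD2l.
  rewrite normrM ler_piMl// ger0_norm ?invr_ge0//.
  by rewrite invf_le1// ler1n.
have [_ _ cv] := dominated_convergence mD mF mG FG iH FH.
apply: fine_cvg; apply: cvg_trans cv _.
by rewrite /dmodular fineK//; apply: integrable_fin_num => //; exact: dmodular_integrable.
Qed.

(** By [dmodular_cvg] the derivative along g is still negative at f + t g for some t = 1/(k+1). The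
    tangent inequality at f + t g, read in the direction - t g that leads back to f, then gives the
    strict decrease. *)
Lemma modular_descent f g : finite_modular f -> finite_modular g ->
  dmodular f g < 0 -> exists2 t, 0 < t & modular (fun x => f x + t * g x) < modular f.
Proof.
move=> Lf Lg fg0.
have [k _ /(_ k (leqnn k)) /= hk] : \forall k \near \oo,
    dmodular (fun x => f x + k.+1%:R^-1 * g x) g < 0.
  have /cvgrPdist_lt/(_ _ (_ : 0 < - dmodular f g)) := dmodular_cvg Lf Lg.
  rewrite oppr_gt0 => /(_ fg0); apply: filterS => k.
  by rewrite ltr_distlC => /andP[_]; rewrite subrr.
have k0 : 0 < k.+1%:R^-1 :> R by rewrite invr_gt0 ltr0n.
exists k.+1%:R^-1 => //; set t := k.+1%:R^-1 in hk k0 *.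
have Lft : finite_modular (fun x => f x + t * g x).
  exact: (finite_modularD Lf (finite_modularZ _ Lg)).
have L0 : finite_modular (fun x => 0 * g x) by exact: finite_modularZ.
have := modular_tangent Lft (finite_modularZ (- t) Lg).
have -> : (fun x => f x + t * g x + - t * g x) = f by apply/funext => x; ring.
have -> : (fun x => - t * g x) = (fun x => 0 * g x + - t * g x).
  by apply/funext => x; ring.
rewrite dmodularZD//.
have -> : dmodular (fun x => f x + t * g x) (fun x => 0 * g x) = 0.
  rewrite /dmodular (eq_Rintegral _ (g := fun=> 0)) ?Rintegral_cst ?mul0r// => x _.
  by rewrite mul0r mulr0 mul0r.
by apply: lt_le_trans; rewrite add0r ltrDl mulNr oppr_gt0 pmulr_rlt0.
Qed.

(** For c >= 1 one has c <= c^q <= c^qM. These two bounds replace homogeneity. *)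
Lemma modularZ_le c f : finite_modular f -> 1 <= c ->
  c * modular f <= modular (fun x => c * f x) <= c `^ qM * modular f.
Proof.
move=> Lf c1; have c0 : 0 <= c by exact: le_trans c1.
have mi := modular_integrable Lf; have mci := modular_integrable (finite_modularZ c Lf).
have hi a : mu.-integrable D (EFin \o (fun x => a * (`|f x| `^ q x / (q x * w x)))).
  have : mu.-integrable D (fun x => a%:E * (`|f x| `^ q x / (q x * w x))%:E)%E.
    exact: integrableZl.
  by apply: eq_integrable => // x _.
rewrite /modular; apply/andP; split; rewrite -RintegralZl//;
  apply: le_Rintegral => // x _; rewrite mulrA ler_wpM2r// normrM (ger0_norm c0) powRM//;
  rewrite ler_wpM2r ?powR_ge0//.
- by apply: le1r_powR => //; exact: ltW.
- exact: ler_powR.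
Qed.

Lemma modularZ_le1 c f : finite_modular f -> 0 < c <= 1 ->
  modular (fun x => c * f x) <= c * modular f.
Proof.
move=> Lf /andP[c0 c1].
have cV1 : 1 <= c^-1 by rewrite invf_ge1.
have /andP[+ _] := modularZ_le (finite_modularZ c Lf) cV1.
rewrite (_ : (fun x => c^-1 * (c * f x)) = f); last first.
  by apply/funext => x; rewrite mulrA mulVf ?mul1r// gt_eqF.
by rewrite ler_pdivrMl.
Qed.

Lemma modular_ae0 f : measurable_fun setT f ->
  {ae mu, forall x, D x -> f x = 0} -> modular f = 0.
Proof.
move=> mf f0; rewrite /modular /Rintegral.
rewrite (ae_eq_integral (cst 0%E)) ?integral0//.
  apply/measurable_EFinP; apply: measurable_funTS; apply: measurable_funM.
    exact: measurable_normr_powR.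
  apply: measurable_funV; first exact: measurable_funM.
  by move=> x; rewrite mulr_ge0// ltW.
apply: filterS f0 => x /[apply] ->.
by rewrite normr0 powR0 ?mul0r// gt_eqF.
Qed.

Lemma modular_eq0 f : finite_modular f -> (forall x, D x -> 0 < w x) ->
  modular f = 0 -> {ae mu, forall x, D x -> f x = 0}.
Proof.
move=> Lf wgt0 f0; have [mf _] := Lf.
have /ae_eq_integral_abs : measurable_fun D
    (EFin \o (fun x => `|f x| `^ q x / (q x * w x))).
  exact: (measurable_int mu (modular_integrable Lf)).
move=> /(_ mu mD)[H _].
have {}H : ae_eq mu D (EFin \o (fun x => `|f x| `^ q x / (q x * w x))) (cst 0%E).
  apply: H; transitivity ((modular f)%:E); last by rewrite f0.
  rewrite EFin_modular//; apply: eq_integral => x _ /=.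
  by rewrite ger0_norm// mulr_ge0// powR_ge0.
apply: filterS H => x /[swap] Dx /(_ Dx) /= [] /eqP.
have v0 : q x * w x != 0 by rewrite gt_eqF// mulr_gt0// wgt0.
by rewrite mulf_eq0 invr_eq0 (negbTE v0) orbF powR_eq0 normr_eq0 => /andP[/eqP].
Qed.

Section luxemburg.
Variable P : \bar R -> Prop.
(** Only the position of P between the conditions < 1 and <= 1 enters the arguments, so that they
    cover [normK] and [normk] at once. *)
Hypotheses (Plt : forall x, (x < 1)%E -> P x) (Ple : forall x, P x -> (x <= 1)%E).

Let S f := [set l | 0 < l /\
  P (\int[mu]_(x in D) (`|f x / l| `^ q x / (q x * w x))%:E)%E].

Let SE f l : finite_modular f ->
  S f l <-> 0 < l /\ P (modular (fun x => l^-1 * f x))%:E.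
Proof.
move=> Lf; rewrite (EFin_modular (finite_modularZ l^-1 Lf)).
rewrite /S/=; under eq_integral do rewrite (mulrC (f _)).
exact: iff_refl.
Qed.

Let S_lb f : has_lbound (S f).
Proof. by exists 0 => l [/ltW]. Qed.

Let S_neq0 f : finite_modular f -> S f !=set0.
Proof.
move=> Lf; have m0 := modular_ge0 f; exists (1 + modular f).
have m1 : 0 < 1 + modular f by rewrite ltr_wpDr.
apply/(SE _ Lf); split=> //; apply: Plt; rewrite lte_fin.
apply: (le_lt_trans (modularZ_le1 Lf _)).
  by rewrite invr_gt0 m1 invf_le1//= lerDl.
by rewrite mulrC ltr_pdivrMr// mul1r ltrDr.
Qed.

Lemma luxemburg_ge0 f : finite_modular f -> 0 <= luxemburg P f.
Proof. by move=> /S_neq0 S0; apply: lb_le_inf => // l [/ltW]. Qed.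

(** A modular m < 1 leaves room: enlarging the function by some t > 1 multiplies the modular by at
    most t^qM, which keeps it below 1, and so l / t still belongs to the set. *)
Lemma luxemburg_lt f l : finite_modular f -> 0 < l ->
  modular (fun x => l^-1 * f x) < 1 -> luxemburg P f < l.
Proof.
move=> Lf l0; set m := modular _ => m1.
have m0 : 0 <= m by exact: modular_ge0.
(* This number exceeds 1 while its product with m stays below 1; t is its root of order qM. *)
pose a := 2 / (1 + m).
have a1 : 1 < a by rewrite ltr_pdivlMr; lra.
have am : a * m < 1 by rewrite mulrAC ltr_pdivrMr; lra.
pose t := a `^ qM^-1.
have tq : t `^ qM = a by rewrite -powRrM mulVf ?powRr1 ?gt_eqF//; lra.
have t1 : 1 < t.
  by have := gt0_ltr_powR (_ : 0 < qM^-1) _ _ a1; rewrite powR1; apply;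
    rewrite ?invr_gt0// nnegrE; lra.
have t0 : 0 < t by lra.
apply: (@le_lt_trans _ _ (l / t)); last first.
  by rewrite ltr_pdivrMr// ltr_pMr.
apply: (ge_inf (S_lb f)); apply/(SE _ Lf); split; first exact: divr_gt0.
apply: Plt; rewrite lte_fin.
have /andP[_] := modularZ_le (finite_modularZ l^-1 Lf) (ltW t1).
rewrite (_ : (fun x => t * _) = (fun x => (l / t)^-1 * f x)); last first.
  by apply/funext => x; rewrite invfM invrK; ring.
by move=> /le_lt_trans; apply; rewrite tq.
Qed.

(** A scale l' < l in the set is impossible: passing from l to l' multiplies the modular by at least
    l / l' > 1, so that it exceeds 1 at l'. *)
Lemma luxemburg_ge f l : finite_modular f -> 0 < l ->
  1 <= modular (fun x => l^-1 * f x) -> l <= luxemburg P f.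
Proof.
move=> Lf l0 m1; apply: lb_le_inf; first exact: S_neq0.
move=> l' /(SE _ Lf)[l'0 /Ple]; rewrite lee_fin; apply: contraTT; rewrite -!ltNge => l'l.
have c1 : 1 < l / l' by rewrite ltr_pdivlMr// mul1r.
have /andP[+ _] := modularZ_le (finite_modularZ l^-1 Lf) (ltW c1).
rewrite (_ : (fun x => l / l' * _) = (fun x => l'^-1 * f x)); last first.
  by apply/funext => x; field; rewrite !gt_eqF.
apply: lt_le_trans; rewrite (lt_le_trans c1)// ler_peMr//; lra.
Qed.

Lemma luxemburg_gt0 f : finite_modular f -> 0 < modular f -> 0 < luxemburg P f.
Proof.
move=> Lf; set m := modular f => m0.
(* With this l the lower bound l^-1 m for the modular at scale l is 1 + m. *)
pose l := m / (1 + m).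
have l0 : 0 < l by rewrite divr_gt0//; lra.
apply: (lt_le_trans l0); apply: (luxemburg_ge Lf l0).
have l1 : 1 <= l^-1 by rewrite /l invf_div ler_pdivlMr//; lra.
have /andP[+ _] := modularZ_le Lf l1; apply: le_trans.
by rewrite -/m /l invf_div divfK ?gt_eqF// lerDl ltW.
Qed.

(** If the modular at scale l, the norm, were below 1, [luxemburg_lt] would put the norm strictly
    below itself. If it were m > 1, then with t^qM = m it would still be at least 1 at scale t l,
    and [luxemburg_ge] would give t l <= l. *)
Lemma modular_luxemburg f : finite_modular f -> 0 < luxemburg P f ->
  modular (fun x => (luxemburg P f)^-1 * f x) = 1.
Proof.
move=> Lf l0; set l := luxemburg P f.
apply/eqP; rewrite eq_le; apply/andP; split; rewrite leNgt; apply/negP; last first.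
  by move=> /(luxemburg_lt Lf l0); rewrite ltxx.
set m := modular _ => m1.
pose t := m `^ qM^-1.
have tq : t `^ qM = m by rewrite -powRrM mulVf ?powRr1 ?gt_eqF//; lra.
have t1 : 1 < t.
  by have := gt0_ltr_powR (_ : 0 < qM^-1) _ _ m1; rewrite powR1; apply;
    rewrite ?invr_gt0// nnegrE; lra.
have t0 : 0 < t by lra.
suff : t * l <= l by rewrite leNgt => /negP; apply; rewrite ltr_pMl.
apply: (luxemburg_ge Lf (mulr_gt0 t0 l0)).
have /andP[_] := modularZ_le (finite_modularZ (t * l)^-1 Lf) (ltW t1).
rewrite (_ : (fun x => t * _) = (fun x => l^-1 * f x)); last first.
  by apply/funext => x; rewrite invfM mulrA mulrA mulfV ?mul1r// gt_eqF.
by rewrite tq -/m -{1}[m]mulr1 ler_pM2l//; lra.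
Qed.

Lemma luxemburgZ c f : finite_modular f -> 0 < c ->
  luxemburg P (fun x => c * f x) = c * luxemburg P f.
Proof.
have le a g : finite_modular g -> 0 < a ->
    luxemburg P (fun x => a * g x) <= a * luxemburg P g.
  move=> Lg a0; rewrite -ler_pdivrMl//.
  apply: lb_le_inf; first exact: S_neq0.
  move=> l /(SE _ Lg)[l0 Pl]; rewrite ler_pdivrMl//; apply: (ge_inf (S_lb _)).
  apply/(SE _ (finite_modularZ a Lg)); split; first exact: mulr_gt0.
  rewrite (_ : (fun x => _ * (a * _)) = (fun x => l^-1 * g x))//.
  by apply/funext => x; field; rewrite !gt_eqF.
move=> Lf c0; apply/eqP; rewrite eq_le le//=.
have := le c^-1 _ (finite_modularZ c Lf); rewrite invr_gt0 => /(_ c0).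
rewrite (_ : (fun x => _ * (c * _)) = f) ?ler_pdivlMl//.
by apply/funext => x; rewrite mulKf// gt_eqF.
Qed.

End luxemburg.
End modular.

(** * The space X and its two norms *)

Section euclidean_norm.
Context {R : realType} {n : nat}.
Implicit Types x : 'rV[R]_n.

Lemma enorm_ge0 x : 0 <= enorm x. Proof. exact: sqrtr_ge0. Qed.

Lemma enorm_eq0 x : enorm x = 0 -> x = 0.
Proof.
move=> /eqP; rewrite sqrtr_eq0 => x0.
have i0 i : 0 <= x ord0 i * x ord0 i by rewrite -expr2 sqr_ge0.
have /eqP : edot x x = 0 by apply/eqP; rewrite eq_le x0 sumr_ge0.
rewrite psumr_eq0// => /allP h; apply/rowP => i; rewrite mxE.
by have := h i (mem_index_enum _); rewrite mulf_eq0 orbb => /eqP.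
Qed.

Lemma enorm_le x c : (forall i, `|x ord0 i| <= c) -> enorm x <= n%:R * c.
Proof.
move=> xc; have [n0|n0] := posnP n.
  have -> : (n%:R : R) = 0 by rewrite n0.
  rewrite mul0r /enorm /edot big1 ?sqrtr0// => i _.
  by exfalso; case: i => m; rewrite n0.
have c0 : 0 <= c by apply: le_trans (xc (Ordinal n0)).
have nc0 : 0 <= n%:R * c by rewrite mulr_ge0.
rewrite -(ger0_norm nc0) -sqrtr_sqr ler_sqrt ?sqr_ge0//.
apply: (@le_trans _ _ (\sum_(i < n) c ^+ 2)).
  apply: ler_sum => i _; rewrite -expr2 -real_normK ?num_real//.
  by rewrite ler_sqr ?nnegrE.
rewrite sumr_const card_ord -[leLHS]mulr_natl exprMn ler_wpM2r ?sqr_ge0//.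
by rewrite expr2 ler_peMl// ler1n.
Qed.

End euclidean_norm.

(* L is the half-side of a cube containing Omega. *)
Record admissible (R : realType) (n : nat) (s : R) (p : 'rV[R]_n -> 'rV[R]_n -> R)
    (Omega : set 'rV[R]_n) (qm qM L : R) : Prop := {
  adm_n : (0 < n)%N;
  adm_s : 0 < s < 1;
  adm_cont : continuous (fun z : 'rV[R]_n * 'rV[R]_n => p z.1 z.2);
  adm_qm1 : 1 < qm;
  adm_qmp : forall x y, qm <= p x y;
  adm_pqM : forall x y, p x y <= qM;
  adm_open : open Omega;
  adm_nonempty : Omega !=set0;
  adm_L : 1 <= L;
  adm_box : forall x, Omega x -> forall i, `|x ord0 i| < L }.

Section eigenvalue_setting.
Context {R : realType} {n : nat}.
Variables (s : R) (p : 'rV[R]_n -> 'rV[R]_n -> R) (Omega : set 'rV[R]_n).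
Variables qm qM L : R.
Implicit Types (u v phi : 'rV[R]_n -> R) (z : 'rV[R]_n * 'rV[R]_n).

Local Notation leb := (lebesgue_rV R n).
Local Notation leb2 := (lebesgue_rV R n \x lebesgue_rV R n)%E.
Local Notation p2 := (fun z : 'rV[R]_n * 'rV[R]_n => p z.1 z.2).
Local Notation wK := (fun z : 'rV[R]_n * 'rV[R]_n => enorm (z.1 - z.2) ^+ n).
Local Notation w1 := (fun _ : 'rV[R]_n => 1 : R).

Hypothesis adm : admissible s p Omega qm qM L.

Let n0 := adm_n adm.
Let s0 : 0 < s. Proof. by case/andP: (adm_s adm). Qed.
Let mp : measurable_fun setT p2 := continuous_measurable_rV2 (adm_cont adm).
Let mO : measurable Omega := open_measurable_rV (adm_open adm).
Let qm1 := adm_qm1 adm.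
Let qmp := adm_qmp adm.
Let pqM := adm_pqM adm.

Lemma measurable_pbar : measurable_fun setT (pbar p).
Proof. exact: (measurableT_comp mp measurable_diag_rV). Qed.

Lemma measurable_wK : measurable_fun setT wK.
Proof. by apply: measurable_funX; exact: measurable_enormB. Qed.

Lemma wK_ge0 z : 0 <= wK z.
Proof. by rewrite exprn_ge0// enorm_ge0. Qed.

Let qmp2 z : qm <= p2 z. Proof. exact: qmp. Qed.
Let p2qM z : p2 z <= qM. Proof. exact: pqM. Qed.
Let qmpbar x : qm <= pbar p x. Proof. exact: qmp. Qed.
Let pbarqM x : pbar p x <= qM. Proof. exact: pqM. Qed.
Let mw1 : measurable_fun setT w1. Proof. exact: measurable_cst. Qed.
Let w10 x : 0 <= w1 x. Proof. exact: ler01. Qed.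

Lemma measurable_nabla_s u : measurable_fun setT u -> measurable_fun setT (nabla_s s u).
Proof.
move=> mu; apply: measurable_funM.
  by apply: measurable_funB; exact: (measurableT_comp mu).
apply: measurable_funV => [|z]; last exact: powR_ge0.
by apply: measurable_fun_powR2; [exact: measurable_enormB|exact: measurable_cst].
Qed.

Lemma nabla_sD u v c : nabla_s s (fun x => u x + c * v x) =
  (fun z => nabla_s s u z + c * nabla_s s v z).
Proof. by apply/funext => z; rewrite /nabla_s; ring. Qed.

Lemma nabla_sZ u c : nabla_s s (fun x => c * u x) = (fun z => c * nabla_s s u z).
Proof. by apply/funext => z; rewrite /nabla_s; ring. Qed.

Lemma normr_nabla_s u z : `|nabla_s s u z| = `|u z.1 - u z.2| / enorm (z.1 - z.2) `^ s.
Proof. by rewrite normrM normfV (ger0_norm (powR_ge0 _ _)). Qed.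

Lemma gagliardo_integrandE u z :
  `|u z.1 - u z.2| `^ p z.1 z.2 / enorm (z.1 - z.2) `^ (n%:R + s * p z.1 z.2) =
  `|nabla_s s u z| `^ p2 z / wK z.
Proof.
have p0 : 0 < p2 z by apply: lt_le_trans (qmp2 z); exact: lt_trans qm1.
rewrite normr_nabla_s; set r := enorm _.
(* On the diagonal both sides vanish: division by 0 gives 0, and the exponents of the two
   denominators are positive. *)
have [r0|r0] := eqVneq r 0.
  rewrite r0 powR0 ?invr0 ?mulr0 ?expr0n ?gtn_eqF ?invr0 ?mulr0//.
  by rewrite gt_eqF// ltr_pwDl ?ltr0n// mulr_ge0// ltW.
rewrite powRM ?invr_ge0 ?powR_ge0//.
have -> : (r `^ s)^-1 `^ p2 z = (r `^ (s * p2 z))^-1.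
  by rewrite -[in LHS]powRN -powRrM mulNr powRN.
rewrite powRD ?r0 ?implybT// powR_mulrn ?enorm_ge0//.
by rewrite invfM mulrAC mulrA.
Qed.

(** Reduces X to two instances of [finite_modular] and a support condition, so that vector space
    operations and integrability come from the general theory of modulars. *)
Lemma spaceXP u : spaceX s p Omega u <->
  [/\ finite_modular leb setT (pbar p) w1 u, finite_modular leb2 setT p2 wK (nabla_s s u) &
      {ae leb, forall x, (~` Omega) x -> u x = 0}].
Proof.
have e : (\int[leb]_x (`|u x| `^ pbar p x / w1 x)%:E = \int[leb]_x (`|u x| `^ pbar p x)%:E)%E.
  by under eq_integral do rewrite divr1.
rewrite /spaceX /sobolev_space /lebesgue_space_pbar /finite_modular /= e.
rewrite (eq_integral (fun z => (`|nabla_s s u z| `^ p2 z / wK z)%:E)); last first.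
  by move=> z _; rewrite gagliardo_integrandE.
split=> [[[[mu u1] u2] u3]|[[mu u1] [_ u2] u3]]; last by [].
by split=> //; split=> //; exact: measurable_nabla_s.
Qed.

Lemma spaceXD u v c : spaceX s p Omega u -> spaceX s p Omega v ->
  spaceX s p Omega (fun x => u x + c * v x).
Proof.
move=> /spaceXP[u1 u2 u3] /spaceXP[v1 v2 v3]; apply/spaceXP; split.
- exact: (finite_modularD measurableT measurable_pbar mw1 w10 qm1 qmpbar pbarqM u1
    (finite_modularZ measurableT measurable_pbar mw1 w10 qm1 qmpbar pbarqM c v1)).
- rewrite nabla_sD.
  exact: (finite_modularD measurableT mp measurable_wK wK_ge0 qm1 qmp2 p2qM u2
    (finite_modularZ measurableT mp measurable_wK wK_ge0 qm1 qmp2 p2qM c v2)).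
- by apply: filterS2 u3 v3 => x + + xO => /(_ xO) -> /(_ xO) ->; rewrite mulr0 addr0.
Qed.

Lemma spaceXZ u c : spaceX s p Omega u -> spaceX s p Omega (fun x => c * u x).
Proof.
move=> Xu; have := spaceXD (c - 1) Xu Xu.
by congr (spaceX _ _ _ _); apply/funext => x; ring.
Qed.

Lemma spaceX_finite_modular u : spaceX s p Omega u -> finite_modular leb Omega (pbar p) w1 u.
Proof.
move=> /spaceXP[[mu ufin] _ _]; split; [exact: mu|apply: le_lt_trans ufin].
apply: ge0_subset_integral => //.
apply/measurable_EFinP; apply: measurable_modular_integrand => //; exact: measurable_pbar.
Qed.

Lemma spaceX_finite_modularK u :
  spaceX s p Omega u -> finite_modular leb2 setT p2 wK (nabla_s s u).
Proof. by move=> /spaceXP[]. Qed.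

Definition modK u := modular leb2 setT p2 wK (nabla_s s u).
Definition modk u := modular leb Omega (pbar p) w1 u.

Lemma normKE u : normK s p u = luxemburg leb2 setT p2 wK (fun x => x < 1)%E (nabla_s s u).
Proof. by []. Qed.

Lemma normkE u : normk p Omega u = luxemburg leb Omega (pbar p) w1 (fun x => x <= 1)%E u.
Proof.
rewrite /normk /luxemburg; congr inf; apply/funext => l /=.
congr (_ /\ is_true (_ <= _)%E); apply: eq_integral => x _.
by rewrite mulr1.
Qed.

Section norm_facts.
Variable u : 'rV[R]_n -> R.
Hypothesis Xu : spaceX s p Omega u.

Let P1 (x : \bar R) : (x < 1 -> x < 1)%E. Proof. by []. Qed.
Let P2 (x : \bar R) : (x < 1 -> x <= 1)%E. Proof. exact: ltW. Qed.
Let P3 (x : \bar R) : (x <= 1 -> x <= 1)%E. Proof. by []. Qed.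
Let fu := spaceX_finite_modular Xu.
Let fK := spaceX_finite_modularK Xu.

Lemma normK_lt l : 0 < l -> modK (fun x => l^-1 * u x) < 1 -> normK s p u < l.
Proof.
move=> l0; rewrite /modK nabla_sZ normKE.
exact: (luxemburg_lt measurableT mp measurable_wK wK_ge0 qm1 qmp2 p2qM P1 fK l0).
Qed.

Lemma normK_ge l : 0 < l -> 1 <= modK (fun x => l^-1 * u x) -> l <= normK s p u.
Proof.
move=> l0; rewrite /modK nabla_sZ normKE.
exact: (luxemburg_ge measurableT mp measurable_wK wK_ge0 qm1 qmp2 p2qM P1 P2 fK l0).
Qed.

Lemma normk_ge l : 0 < l -> 1 <= modk (fun x => l^-1 * u x) -> l <= normk p Omega u.
Proof.
move=> l0; rewrite normkE.
exact: (luxemburg_ge mO measurable_pbar mw1 w10 qm1 qmpbar pbarqM P2 P3 fu l0).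
Qed.

Lemma normK_ge0 : 0 <= normK s p u.
Proof.
exact: (luxemburg_ge0 measurableT mp measurable_wK wK_ge0 qm1 qmp2 p2qM P1 fK).
Qed.

Lemma normk_ge0 : 0 <= normk p Omega u.
Proof.
rewrite normkE.
exact: (luxemburg_ge0 mO measurable_pbar mw1 w10 qm1 qmpbar pbarqM P2 fu).
Qed.

Lemma normK_gt0 : 0 < modK u -> 0 < normK s p u.
Proof.
exact: (luxemburg_gt0 measurableT mp measurable_wK wK_ge0 qm1 qmp2 p2qM P1 P2 fK).
Qed.

Lemma normk_gt0 : 0 < modk u -> 0 < normk p Omega u.
Proof.
rewrite normkE.
exact: (luxemburg_gt0 mO measurable_pbar mw1 w10 qm1 qmpbar pbarqM P2 P3 fu).
Qed.

Lemma modK_normK : 0 < normK s p u -> modK (fun x => (normK s p u)^-1 * u x) = 1.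
Proof.
rewrite /modK nabla_sZ normKE.
exact: (modular_luxemburg measurableT mp measurable_wK wK_ge0 qm1 qmp2 p2qM P1 P2 fK).
Qed.

Lemma modk_normk : 0 < normk p Omega u -> modk (fun x => (normk p Omega u)^-1 * u x) = 1.
Proof.
rewrite normkE.
exact: (modular_luxemburg mO measurable_pbar mw1 w10 qm1 qmpbar pbarqM P2 P3 fu).
Qed.

Lemma normKZ c : 0 < c -> normK s p (fun x => c * u x) = c * normK s p u.
Proof.
move=> c0; rewrite !normKE nabla_sZ.
exact: (luxemburgZ measurableT mp measurable_wK wK_ge0 qm1 qmp2 p2qM P1 fK c0).
Qed.

Lemma modk_eq0 : modk u = 0 <-> {ae leb, forall x, u x = 0}.
Proof.
have [_ _ u0] := (spaceXP u).1 Xu; split => [h|h].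
  have := modular_eq0 mO measurable_pbar mw1 w10 qm1 qmpbar fu (fun _ _ => ltr01) h.
  apply: filterS2 u0 => x uO uOC; have [|] := pselect (Omega x); [exact: uOC|exact: uO].
apply: (modular_ae0 mO measurable_pbar mw1 w10 qm1 qmpbar); first by have [] := fu.
by apply: filterS h => x.
Qed.

End norm_facts.

End eigenvalue_setting.

(** * Minimizers are eigenfunctions *)

Section eigenpairs.
Context {R : realType} {n : nat}.
Variables (s : R) (p : 'rV[R]_n -> 'rV[R]_n -> R) (Omega : set 'rV[R]_n).
Variables qm qM L : R.
Implicit Types (u v phi : 'rV[R]_n -> R) (z : 'rV[R]_n * 'rV[R]_n).

Local Notation leb := (lebesgue_rV R n).
Local Notation leb2 := (lebesgue_rV R n \x lebesgue_rV R n)%E.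
Local Notation p2 := (fun z : 'rV[R]_n * 'rV[R]_n => p z.1 z.2).
Local Notation wK := (fun z : 'rV[R]_n * 'rV[R]_n => enorm (z.1 - z.2) ^+ n).
Local Notation w1 := (fun _ : 'rV[R]_n => 1 : R).

Hypothesis adm : admissible s p Omega qm qM L.
(** This positivity rests on the energy estimates and is proved with them; assumed here, it leaves
    this part purely variational. *)
Hypothesis modK_gt0 : forall u, spaceX_nonzero s p Omega u -> 0 < modK s p u.

Let mp : measurable_fun setT p2 := continuous_measurable_rV2 (adm_cont adm).
Let mO : measurable Omega := open_measurable_rV (adm_open adm).
Let qm1 := adm_qm1 adm.
Let qmp2 z : qm <= p2 z. Proof. exact: (adm_qmp adm). Qed.
Let p2qM z : p2 z <= qM. Proof. exact: (adm_pqM adm). Qed.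
Let qmpbar x : qm <= pbar p x. Proof. exact: (adm_qmp adm). Qed.
Let pbarqM x : pbar p x <= qM. Proof. exact: (adm_pqM adm). Qed.
Let mpbar := measurable_pbar adm.
Let mw1 : measurable_fun setT w1. Proof. exact: measurable_cst. Qed.
Let w10 x : 0 <= w1 x. Proof. exact: ler01. Qed.

Definition dmodK u phi := dmodular leb2 setT p2 wK (nabla_s s u) (nabla_s s phi).
Definition dmodk u phi := dmodular leb Omega (pbar p) w1 u phi.

Lemma modk_gt0 u : spaceX_nonzero s p Omega u -> 0 < modk p Omega u.
Proof.
move=> [Xu u0]; rewrite lt_neqAle; apply/andP; split.
  by apply/negP => /eqP/esym/(modk_eq0 adm Xu).
exact: (modular_ge0 _ _ w10 qm1 qmpbar).
Qed.

Lemma normK_nonzero u : spaceX_nonzero s p Omega u -> 0 < normK s p u.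
Proof. by move=> Xu; have [Xu' _] := Xu; exact: (normK_gt0 adm Xu' (modK_gt0 Xu)). Qed.

Lemma normk_nonzero u : spaceX_nonzero s p Omega u -> 0 < normk p Omega u.
Proof. by move=> Xu; have [Xu' _] := Xu; exact: (normk_gt0 adm Xu' (modk_gt0 Xu)). Qed.

Lemma Lambda1_le u : spaceX_nonzero s p Omega u ->
  Lambda1 s p Omega <= normK s p u / normk p Omega u.
Proof.
move=> Xu; apply: ge_inf; last by exists u.
exists 0 => _ [v [Xv _] <-].
by rewrite divr_ge0 ?(normK_ge0 adm Xv) ?(normk_ge0 adm Xv).
Qed.

Lemma dmodKE u phi l : dmodK (fun x => l^-1 * u x) phi =
  \int[leb2]_z (`|nabla_s s u z / l| `^ (p z.1 z.2 - 2)
        * (nabla_s s u z / l) * nabla_s s phi z / enorm (z.1 - z.2) ^+ n).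
Proof. by rewrite /dmodK nabla_sZ; apply: eq_Rintegral => z _; rewrite !(mulrC l^-1). Qed.

Lemma dmodkE u phi l : dmodk (fun x => l^-1 * u x) phi =
  \int[leb]_(x in Omega) (`|u x / l| `^ (pbar p x - 2) * (u x / l) * phi x).
Proof. by apply: eq_Rintegral => x _; rewrite divr1 !(mulrC l^-1). Qed.

Lemma ratioSE u : ratioS s p Omega u =
  dmodK (fun x => (normK s p u)^-1 * u x) (fun x => (normK s p u)^-1 * u x) /
  dmodk (fun x => (normk p Omega u)^-1 * u x) (fun x => (normk p Omega u)^-1 * u x).
Proof.
rewrite /ratioS.
have := dmodular_diag leb2 setT wK qm1 qmp2 (nabla_s s (fun x => (normK s p u)^-1 * u x)).
have := dmodular_diag leb Omega w1 qm1 qmpbar (fun x => (normk p Omega u)^-1 * u x).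
rewrite -/(dmodK _ _) -/(dmodk _ _) => -> ->.
apply: (f_equal2 (fun a b => a / b)).
  by rewrite nabla_sZ; apply: eq_Rintegral => z _; rewrite (mulrC _^-1).
by apply: eq_Rintegral => z _; rewrite divr1 (mulrC _^-1).
Qed.

Lemma dmodKD u v phi c : spaceX s p Omega u -> spaceX s p Omega v -> spaceX s p Omega phi ->
  dmodK u (fun x => v x + c * phi x) = dmodK u v + c * dmodK u phi.
Proof.
move=> Xu Xv Xphi; rewrite /dmodK nabla_sD.
exact: (dmodularZD measurableT mp (measurable_wK) (@wK_ge0 _ _) qm1 qmp2 p2qM c
  (spaceX_finite_modularK adm Xu) (spaceX_finite_modularK adm Xv)
  (spaceX_finite_modularK adm Xphi)).
Qed.

Lemma dmodkD u v phi c : spaceX s p Omega u -> spaceX s p Omega v -> spaceX s p Omega phi ->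
  dmodk u (fun x => v x + c * phi x) = dmodk u v + c * dmodk u phi.
Proof.
move=> Xu Xv Xphi.
exact: (dmodularZD mO mpbar mw1 w10 qm1 qmpbar pbarqM c
  (spaceX_finite_modular adm Xu) (spaceX_finite_modular adm Xv)
  (spaceX_finite_modular adm Xphi)).
Qed.

Lemma dmodKZ u phi c : spaceX s p Omega u -> spaceX s p Omega phi ->
  dmodK u (fun x => c * phi x) = c * dmodK u phi.
Proof.
move=> Xu Xphi; have := dmodKD (c - 1) Xu Xphi Xphi.
rewrite (_ : (fun x => _ + _) = (fun x => c * phi x)); last by apply/funext => x; ring.
by move=> ->; ring.
Qed.

Lemma dmodkZ u phi c : spaceX s p Omega u -> spaceX s p Omega phi ->
  dmodk u (fun x => c * phi x) = c * dmodk u phi.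
Proof.
move=> Xu Xphi; have := dmodkD (c - 1) Xu Xphi Xphi.
rewrite (_ : (fun x => _ + _) = (fun x => c * phi x)); last by apply/funext => x; ring.
by move=> ->; ring.
Qed.

Section normalized.
Variable u : 'rV[R]_n -> R.
Hypothesis Xnu : spaceX_nonzero s p Omega u.

Local Notation K := (normK s p u).
Local Notation k := (normk p Omega u).
Local Notation uK := (fun x => (normK s p u)^-1 * u x).
Local Notation uk := (fun x => (normk p Omega u)^-1 * u x).

Let Xu := proj1 Xnu.
Let XuK : spaceX s p Omega uK. Proof. exact: (spaceXZ adm). Qed.
Let Xuk : spaceX s p Omega uk. Proof. exact: (spaceXZ adm). Qed.
Let K0 : 0 < K. Proof. exact: normK_nonzero. Qed.
Let k0 : 0 < k. Proof. exact: normk_nonzero. Qed.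

Lemma dmodK_normalized_gt0 : 0 < dmodK uK uK.
Proof.
have /andP[+ _] := modular_le_dmodular measurableT mp measurable_wK (@wK_ge0 _ _)
  qm1 qmp2 p2qM (spaceX_finite_modularK adm XuK).
apply: lt_le_trans; rewrite mulr_gt0//; first exact: lt_trans qm1.
by have := modK_normK adm Xu K0; rewrite /modK => ->.
Qed.

Lemma dmodk_normalized_gt0 : 0 < dmodk uk uk.
Proof.
have /andP[+ _] := modular_le_dmodular mO mpbar mw1 w10 qm1 qmpbar pbarqM
  (spaceX_finite_modular adm Xuk).
apply: lt_le_trans; rewrite mulr_gt0//; first exact: lt_trans qm1.
by have := modk_normk adm Xu k0; rewrite /modk => ->.
Qed.

Lemma dmodK_normalized : dmodK uK u = K * dmodK uK uK.
Proof.
rewrite -dmodKZ//; congr dmodK; apply/funext => x.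
by rewrite mulrA divff ?mul1r// gt_eqF.
Qed.

Lemma dmodk_normalized : dmodk uk u = k * dmodk uk uk.
Proof.
rewrite -dmodkZ//; congr dmodk; apply/funext => x.
by rewrite mulrA divff ?mul1r// gt_eqF.
Qed.

(* Along a direction psi with dmodK < 0 < dmodk, the quotient K / k of
   u + t psi drops below its value at u: dmodK < 0 makes K decrease for small
   t, and by convexity dmodk > 0 makes k nondecreasing for every t > 0. *)
Lemma quotient_descent psi : spaceX s p Omega psi -> dmodK uK psi < 0 -> 0 < dmodk uk psi ->
  exists2 v, spaceX_nonzero s p Omega v & normK s p v / normk p Omega v < K / k.
Proof.
move=> Xpsi dK dk.
have [t t0 tK] := modular_descent measurableT mp measurable_wK (@wK_ge0 _ _)
  qm1 qmp2 p2qM (spaceX_finite_modularK adm XuK) (spaceX_finite_modularK adm Xpsi) dK.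
(* t was found for u / K; the factor K makes v / K equal to u / K + t psi. *)
pose v x := u x + (t * K) * psi x.
have Xv : spaceX s p Omega v by exact: (spaceXD adm).
have vK : normK s p v < K.
  apply: (normK_lt adm Xv K0).
  rewrite -(modK_normK adm Xu K0) /modK; apply: le_lt_trans tK.
  rewrite -nabla_sD (_ : (fun x => _ + _) = (fun x => K^-1 * v x))//.
  by apply/funext => x; rewrite /v; field; rewrite gt_eqF.
have modk_v : 1 < modk p Omega (fun x => k^-1 * v x).
  have := modular_tangent mO mpbar mw1 w10 qm1 qmpbar pbarqM (spaceX_finite_modular adm Xuk)
    (spaceX_finite_modular adm (spaceXZ adm (t * K / k) Xpsi)).
  rewrite (_ : (fun x => _ + _) = (fun x => k^-1 * v x)); last first.
    by apply/funext => x; rewrite /v; field; rewrite gt_eqF.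
  apply: lt_le_trans; have := modk_normk adm Xu k0; rewrite /modk => ->.
  rewrite ltrDl -/(dmodk _ _) dmodkZ// mulr_gt0// divr_gt0// mulr_gt0//.
have kv : k <= normk p Omega v by apply: (normk_ge adm Xv k0); exact: ltW.
exists v.
  split=> // v0; move: modk_v.
  rewrite (modk_eq0 adm (spaceXZ adm _ Xv)).2 ?ltr10//.
  by apply: filterS v0 => x ->; rewrite mulr0.
have vk0 : 0 < normk p Omega v by exact: lt_le_trans kv.
have aux (a b c : R) : 0 < a -> 0 < b -> b <= c -> a <= a / b * c.
  by move=> a0 b0 bc; rewrite mulrAC ler_pdivlMr// ler_pM2l.
by rewrite ltr_pdivrMr//; apply: (lt_le_trans vK); exact: aux.
Qed.

End normalized.

(** Let a and b be the derivatives of the two modulars along phi, divided by those along u. If a <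
    b, their midpoint c makes psi = phi - c u a direction with [dmodK] < 0 < [dmodk], which
    [quotient_descent] forbids at a minimizer; if b < a, the same argument applies to - phi. Hence a
    = b, which is the equation. *)
Lemma minimizer_eigenpair u : minimizer s p Omega u -> eigenpair s p Omega (Lambda1 s p Omega) u.
Proof.
move=> [Xnu uL]; split=> // phi Xphi; have Xu := proj1 Xnu.
have K0 := normK_nonzero Xnu; have k0 := normk_nonzero Xnu.
have NK0 := dmodK_normalized_gt0 Xnu; have Nk0 := dmodk_normalized_gt0 Xnu.
have NKE := dmodK_normalized Xnu; have NkE := dmodk_normalized Xnu.
rewrite -dmodKE -dmodkE ratioSE -uL.
set K := normK s p u in K0 NK0 NKE *; set k := normk p Omega u in k0 Nk0 NkE *.
set uK := (fun x => K^-1 * u x) in NK0 NKE *.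
set uk := (fun x => k^-1 * u x) in Nk0 NkE *.
set NK := dmodK uK uK in NK0 NKE *; set Nk := dmodk uk uk in Nk0 NkE *.
have XuK : spaceX s p Omega uK by exact: (spaceXZ adm).
have Xuk : spaceX s p Omega uk by exact: (spaceXZ adm).
have key psi c : spaceX s p Omega psi ->
    ~ (dmodK uK psi < c * (K * NK) /\ c * (k * Nk) < dmodk uk psi).
  move=> Xpsi [h1 h2].
  have [||v Xv] := quotient_descent Xnu (spaceXD adm (- c) Xpsi Xu).
  - by rewrite dmodKD// NKE mulNr subr_lt0.
  - by rewrite dmodkD// NkE mulNr subr_gt0.
  - by move=> /(le_lt_trans (Lambda1_le Xv)); rewrite -uL ltxx.
pose a := dmodK uK phi / (K * NK); pose b := dmodk uk phi / (k * Nk).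
have aE : dmodK uK phi = a * (K * NK) by rewrite divfK// mulf_neq0 ?gt_eqF.
have bE : dmodk uk phi = b * (k * Nk) by rewrite divfK// mulf_neq0 ?gt_eqF.
have KNK : 0 < K * NK by rewrite mulr_gt0.
have kNk : 0 < k * Nk by rewrite mulr_gt0.
have ab : a = b.
  apply/eqP; rewrite eq_le; apply/andP; split; rewrite leNgt; apply/negP => h.
    apply: (key _ (- ((a + b) / 2)) (spaceXZ adm (-1) Xphi)).
    by rewrite dmodKZ// dmodkZ// aE bE (mulrA (-1) a) (mulrA (-1) b) !ltr_pM2r//; split; lra.
  apply: (key _ ((a + b) / 2) Xphi).
  by rewrite aE bE !ltr_pM2r//; split; lra.
by rewrite aE bE ab; field; rewrite !gt_eqF.
Qed.

Lemma eigenvalue_ge Lambda : eigenvalue_frac s p Omega Lambda -> Lambda1 s p Omega <= Lambda.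
Proof.
move=> [u [Xnu /(_ u (proj1 Xnu))]].
have K0 := normK_nonzero Xnu; have k0 := normk_nonzero Xnu.
rewrite -dmodKE -dmodkE ratioSE dmodK_normalized// dmodk_normalized//.
have NK0 := dmodK_normalized_gt0 Xnu; have Nk0 := dmodk_normalized_gt0 Xnu.
set NK := dmodK _ _ in NK0 *; set Nk := dmodk _ _ in Nk0 * => h.
rewrite (_ : Lambda = normK s p u / normk p Omega u) ?Lambda1_le//.
rewrite -[LHS]mulr1 -(divff (lt0r_neq0 (mulr_gt0 k0 NK0))) mulrA.
rewrite (_ : Lambda * _ = normK s p u * NK); first by field; rewrite !gt_eqF.
by rewrite h; field; rewrite !gt_eqF.
Qed.

End eigenpairs.

(** * Integrals over cubes and rectangles *)

Section fubini_rectangle.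
Context d1 d2 (T1 : measurableType d1) (T2 : measurableType d2) (R : realType).
Variables (m1 : {sigma_finite_measure set T1 -> \bar R}).
Variables (m2 : {sigma_finite_measure set T2 -> \bar R}).
Local Open Scope ereal_scope.

Lemma measurable_fun_section_integral (B : set T2) (f : T1 * T2 -> \bar R) :
  measurable B -> measurable_fun setT f -> (forall z, 0 <= f z) ->
  measurable_fun setT (fun x => \int[m2]_(y in B) f (x, y)).
Proof.
move=> mB mf f0.
have mTB : measurable ([set: T1] `*` B) by exact: measurableX.
have -> : (fun x => \int[m2]_(y in B) f (x, y)) =
    fubini_F m2 (f \_ ([set: T1] `*` B)).
  apply/funext => x; rewrite /fubini_F [LHS]integral_mkcond; apply: eq_integral => y _.
  by rewrite !patchE in_setX in_setT.
apply: measurable_fun_fubini_tonelli_F.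
  by apply/(measurable_restrict _ mTB measurableT); exact: measurable_funTS.
by move=> z; rewrite patchE; case: ifP.
Qed.

Lemma fubini_tonelli_rectangle (A : set T1) (B : set T2) (f : T1 * T2 -> \bar R) :
  measurable A -> measurable B -> measurable_fun setT f -> (forall z, 0 <= f z) ->
  \int[m1 \x m2]_(z in A `*` B) f z = \int[m1]_(x in A) \int[m2]_(y in B) f (x, y).
Proof.
move=> mA mB mf f0; have mAB : measurable (A `*` B) by exact: measurableX.
rewrite integral_mkcond fubini_tonelli1.
- rewrite [RHS]integral_mkcond; apply: eq_integral => x _.
  rewrite /fubini_F !patchE; case: ifPn => xA.
    rewrite [RHS]integral_mkcond; apply: eq_integral => y _.
    by rewrite !patchE in_setX /= xA.
  by apply: integral0_eq => y _; rewrite patchE in_setX/= (negbTE xA).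
- by apply/(measurable_restrict _ mAB measurableT); exact: measurable_funTS.
- by move=> z; rewrite patchE; case: ifP.
Qed.

End fubini_rectangle.

Section mean_oscillation.
Context d (T : measurableType d) (R : realType).
Variable mu : {sigma_finite_measure set T -> \bar R}.

Lemma integrable_cst_fin (Q : set T) (c : R) : measurable Q -> (mu Q < +oo)%E ->
  mu.-integrable Q (EFin \o cst c).
Proof.
move=> mQ Qoo; apply: measurable_bounded_integrable => //.
by exists `|c|; split; [exact: num_real|move=> M cM x _ /=; exact: ltW].
Qed.

(** A Poincaré inequality on Q: m h(x) is the integral of h plus the integral of h(x) - h(y) over y
    in Q; take absolute values and integrate in x. Keeping the factor m, the measure of Q, avoids a
    division in [\bar R]. *)
Lemma mean_oscillation (Q : set T) (m : R) (h : T -> R) : measurable Q -> mu Q = m%:E ->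
  measurable_fun setT h -> mu.-integrable Q (EFin \o h) ->
  (m%:E * \int[mu]_(x in Q) `|h x|%:E <= m%:E * `|\int[mu]_(x in Q) h x|%:E +
    \int[mu \x mu]_(z in Q `*` Q) `|h z.1 - h z.2|%:E)%E.
Proof.
move=> mQ mQE mh hi.
have m0 : 0 <= m by rewrite -lee_fin -mQE.
have Qoo : (mu Q < +oo)%E by rewrite mQE ltry.
have mh2 : measurable_fun setT (fun z : T * T => `|h z.1 - h z.2|%:E).
  apply/measurable_EFinP; apply: measurableT_comp => //.
  by apply: measurable_funB; exact: (measurableT_comp mh).
rewrite fubini_tonelli_rectangle//.
have key x : Q x -> (m%:E * `|h x|%:E <= `|\int[mu]_(x in Q) h x|%:E +
    \int[mu]_(y in Q) `|h x - h y|%:E)%E.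
  move=> Qx; have ci := integrable_cst_fin (h x) mQ Qoo.
  have di : mu.-integrable Q (EFin \o (fun y => h x - h y)).
    by have := integrableB mQ ci hi; apply: eq_integrable => // y _.
  rewrite (_ : \int[mu]_(y in Q) _ = `|\int[mu]_(y in Q) `|h x - h y| |%:E)%E; last first.
    rewrite ger0_norm ?Rintegral_ge0// fineK//.
    have := integrable_norm di; exact: integrable_fin_num.
  rewrite -EFinM -EFinD lee_fin.
  have -> : m * `|h x| = `|\int[mu]_(y in Q) h y + \int[mu]_(y in Q) (h x - h y)|.
    rewrite -RintegralD//; under eq_Rintegral do rewrite addrC subrK.
    rewrite Rintegral_cst// (_ : fine _ = m); last exact: (congr1 fine mQE).
    by rewrite normrM (ger0_norm m0) mulrC.
  rewrite (le_trans (ler_normD _ _))// lerD2l [leRHS]ger0_norm ?Rintegral_ge0//.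
  exact: le_normr_Rintegral.
have mabs : measurable_fun Q (fun x => `|h x|%:E).
  by apply/measurable_EFinP; apply: measurable_funTS; exact: measurableT_comp.
have mosc : measurable_fun Q (fun x => \int[mu]_(y in Q) `|h x - h y|%:E)%E.
  apply: measurable_funTS.
  exact: (measurable_fun_section_integral mu mQ mh2).
rewrite -ge0_integralZl//=.
apply: (@le_trans _ _ (\int[mu]_(x in Q) (`|\int[mu]_(x in Q) h x|%:E +
    \int[mu]_(y in Q) `|h x - h y|%:E))%E).
  apply: ge0_le_integral => //.
  - by move=> x _; rewrite mule_ge0.
  - exact: measurable_funeM.
  - by apply: emeasurable_funD => //; exact: measurable_cst.
rewrite ge0_integralD//; last by move=> x _; exact: integral_ge0.
rewrite leeD2r// integral_cst// muleC; apply: lee_pmul => //.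
by rewrite -mQE.
Qed.

End mean_oscillation.

Section cubes.
Context {R : realType} {n : nat}.
Local Notation leb := (lebesgue_rV R n).

(** Half-open, so that the cells of a grid are disjoint; a is the lower corner. *)
Definition cube (a : 'rV[R]_n) (l : R) : set 'rV[R]_n :=
  [set y | forall i, `[a ord0 i, a ord0 i + l[%classic (y ord0 i)].

Lemma cubeP a l y : cube a l y <-> forall i, a ord0 i <= y ord0 i < a ord0 i + l.
Proof. by split=> h i; have := h i; rewrite /= in_itv. Qed.

Lemma measurable_cube a l : measurable (cube a l).
Proof.
apply: (@measurable_rV_box _ _ (fun i => `[a ord0 i, a ord0 i + l[%classic)) => i.
exact: measurable_itv.
Qed.

Lemma lebesgue_cube a l : 0 <= l -> leb (cube a l) = (l ^+ n)%:E.
Proof.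
move=> l0; rewrite (lebesgue_rV_box (A := fun i => `[a ord0 i, a ord0 i + l[%classic)); last first.
  by move=> i; exact: measurable_itv.
rewrite (eq_bigr (fun=> l%:E)) => [|i _].
  by rewrite prodEFin prodr_const card_ord.
rewrite lebesgue_measure_itv/= lte_fin ltrDl.
rewrite -EFinB addrAC subrr add0r.
by case: ltP => // h; congr EFin; apply/eqP; rewrite eq_le l0.
Qed.

Lemma cube_enormB a l x y : cube a l x -> cube a l y -> enorm (x - y) <= n%:R * l.
Proof.
move=> /cubeP xa /cubeP ya; apply: enorm_le => i; rewrite !mxE ler_norml.
by have /andP[? ?] := xa i; have /andP[? ?] := ya i; apply/andP; split; lra.
Qed.

End cubes.

(** * Energy estimates *)

Section energy_estimates.
Context {R : realType} {n : nat}.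
Variables (s : R) (p : 'rV[R]_n -> 'rV[R]_n -> R) (Omega : set 'rV[R]_n).
Variables qm qM L : R.
Implicit Types (u v : 'rV[R]_n -> R) (z : 'rV[R]_n * 'rV[R]_n).

Local Notation leb := (lebesgue_rV R n).
Local Notation leb2 := (lebesgue_rV R n \x lebesgue_rV R n)%E.
Local Notation p2 := (fun z : 'rV[R]_n * 'rV[R]_n => p z.1 z.2).
Local Notation wK := (fun z : 'rV[R]_n * 'rV[R]_n => enorm (z.1 - z.2) ^+ n).

Hypothesis adm : admissible s p Omega qm qM L.

Let mp : measurable_fun setT p2 := continuous_measurable_rV2 (adm_cont adm).
Let qm1 := adm_qm1 adm.
Let qmp2 z : qm <= p2 z. Proof. exact: (adm_qmp adm). Qed.
Let p2qM z : p2 z <= qM. Proof. exact: (adm_pqM adm). Qed.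
Let p21 z : 1 < p2 z. Proof. exact: lt_le_trans (qmp2 z). Qed.
Let s0 : 0 < s. Proof. by case/andP: (adm_s adm). Qed.
Let n0 := adm_n adm.
Let L0 : 0 < L. Proof. by apply: lt_le_trans (adm_L adm). Qed.

Definition gag u z : R := `|nabla_s s u z| `^ p2 z / wK z.
Definition energy u : \bar R := (\int[leb2]_z (gag u z)%:E)%E.

Lemma gag_ge0 u z : 0 <= gag u z.
Proof. by rewrite mulr_ge0 ?powR_ge0// invr_ge0 wK_ge0. Qed.

Lemma measurable_gag u : measurable_fun setT u -> measurable_fun setT (gag u).
Proof.
move=> mu; apply: measurable_modular_integrand => //.
- exact: measurable_wK.
- exact: wK_ge0.
- exact: measurable_nabla_s.
Qed.

Lemma energy_ge0 u : (0 <= energy u)%E.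
Proof. by apply: integral_ge0 => z _; rewrite lee_fin gag_ge0. Qed.

Lemma spaceX_measurable u : spaceX s p Omega u -> measurable_fun setT u.
Proof. by move=> /(spaceXP adm)[[]]. Qed.

Lemma spaceX_ae0 u : spaceX s p Omega u -> {ae leb, forall x, (~` Omega) x -> u x = 0}.
Proof. by move=> /(spaceXP adm)[]. Qed.

Lemma energyE u : spaceX s p Omega u -> energy u = (dmodK s p u u)%:E.
Proof.
move=> Xu; rewrite /dmodK.
rewrite (dmodular_diag leb2 setT wK qm1 qmp2).
have fi := finite_modular_integrable mp measurable_wK (@wK_ge0 _ _)
  (spaceX_finite_modularK adm Xu).
by rewrite fineK//; exact: integrable_fin_num fi.
Qed.

Lemma energy_le_modK u : spaceX s p Omega u -> (energy u <= (qM * modK s p u)%:E)%E.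
Proof.
move=> Xu; rewrite (energyE Xu) lee_fin.
by have /andP[_] := modular_le_dmodular measurableT mp measurable_wK (@wK_ge0 _ _)
  qm1 qmp2 p2qM (spaceX_finite_modularK adm Xu).
Qed.

(** The difference is r^s times the quotient [nabla_s], with r = |x - y| <= d. Lowering the exponent
    from p to q costs the summand 1, and r^n removes the weight in [gag]. The case q = 1 serves the
    L^1 estimates, q close to pbar(x) the higher integrability. *)
Lemma osc_pointwise u x y d q : enorm (x - y) <= d -> 0 < q -> q <= p x y ->
  `|u x - u y| `^ q <= d `^ (s * q) * (1 + d ^+ n * gag u (x, y)).
Proof.
move=> xyd q0 qp; have r0 := enorm_ge0 (x - y); have d0 : 0 <= d by exact: le_trans xyd.
have [e0|e0] := eqVneq (enorm (x - y)) 0.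
  move/enorm_eq0/eqP : e0; rewrite subr_eq0 => /eqP ->.
  rewrite subrr normr0 powR0 ?gt_eqF// mulr_ge0 ?powR_ge0// addr_ge0// mulr_ge0 ?exprn_ge0//.
  exact: gag_ge0.
have {e0}r0' : 0 < enorm (x - y) by rewrite lt_neqAle eq_sym e0.
have -> : `|u x - u y| = enorm (x - y) `^ s * `|nabla_s s u (x, y)|.
  by rewrite normr_nabla_s/= mulrC divfK// gt_eqF// powR_gt0.
rewrite powRM ?powR_ge0// -powRrM ler_pM ?powR_ge0//.
  by rewrite ge0_ler_powR ?nnegrE ?mulr_ge0// ltW.
apply: (le_trans (powR_le1D (normr_ge0 _) (ltW q0) qp)).
rewrite lerD2l [leLHS](_ : _ = enorm (x - y) ^+ n * gag u (x, y)); last first.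
  by rewrite /gag/= mulrC divfK// gt_eqF// exprn_gt0.
by rewrite ler_wpM2r ?gag_ge0// lerXn2r ?nnegrE.
Qed.

Lemma osc_rectangle u A B d a b : measurable_fun setT u -> measurable A -> measurable B ->
  leb A = a%:E -> leb B = b%:E -> 0 <= d -> (forall x y, A x -> B y -> enorm (x - y) <= d) ->
  (\int[leb2]_(z in A `*` B) `|u z.1 - u z.2|%:E <=
   (d `^ s)%:E * ((a * b)%:E + (d ^+ n)%:E * \int[leb2]_(z in A `*` B) (gag u z)%:E))%E.
Proof.
move=> mu mA mB Aa Bb d0 ABd.
have mAB : measurable (A `*` B) by exact: measurableX.
have mg : measurable_fun (A `*` B) (fun z => (gag u z)%:E).
  by apply/measurable_EFinP; apply: measurable_funTS; exact: measurable_gag.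
have g0 z : (A `*` B) z -> (0 <= (gag u z)%:E)%E by rewrite lee_fin gag_ge0.
have ABE : leb2 (A `*` B) = (a * b)%:E by rewrite product_measure1E// [X in (X * _)%E]Aa [X in (_ * X)%E]Bb.
apply: (@le_trans _ _ (\int[leb2]_(z in A `*` B) ((d `^ s)%:E *
    (1%:E + (d ^+ n)%:E * (gag u z)%:E)))%E).
  apply: ge0_le_integral => //.
  - apply/measurable_EFinP; apply: measurable_funTS; apply: measurableT_comp => //.
    by apply: measurable_funB; exact: (measurableT_comp mu).
  - apply: measurable_funeM; apply: emeasurable_funD; first exact: measurable_cst.
    exact: measurable_funeM.
  - move=> [x y] [/= Ax By].
    have := @osc_pointwise u x y d 1 (ABd _ _ Ax By) ltr01 (ltW (p21 (x, y))).
    by rewrite powRr1// mulr1 -lee_fin EFinM EFinD EFinM.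
rewrite ge0_integralZl//; last 3 first.
- apply: emeasurable_funD; first exact: measurable_cst.
  exact: measurable_funeM.
- by move=> z ABz; rewrite adde_ge0// mule_ge0 ?lee_fin ?exprn_ge0 ?gag_ge0.
- by rewrite lee_fin powR_ge0.
rewrite ge0_integralD//; last 2 first.
- by move=> z ABz; rewrite mule_ge0 ?lee_fin ?exprn_ge0 ?gag_ge0.
- exact: measurable_funeM.
rewrite ge0_integralZl//; last by rewrite lee_fin exprn_ge0.
rewrite integral_cst// mul1e; apply: lee_wpmul2l; first by rewrite lee_fin powR_ge0.
by apply: leeD2r; rewrite -ABE.
Qed.

Lemma energy_rectangle u (D : set ('rV[R]_n * 'rV[R]_n)) : measurable_fun setT u -> measurable D ->
  (\int[leb2]_(z in D) (gag u z)%:E <= energy u)%E.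
Proof.
move=> mu mD; apply: ge0_subset_integral => //.
by apply/measurable_EFinP; exact: measurable_gag.
by move=> z _; rewrite lee_fin gag_ge0.
Qed.

Definition bigcube : set 'rV[R]_n := cube (const_mx (- L)) (2 * L).

Lemma Omega_bigcube : Omega `<=` bigcube.
Proof.
move=> x Ox; apply/cubeP => i; rewrite mxE.
by have := adm_box adm Ox i; rewrite ltr_norml => /andP[? ?]; apply/andP; split; lra.
Qed.

Lemma integral_bigcube u : spaceX s p Omega u ->
  (\int[leb]_x `|u x|%:E = \int[leb]_(x in bigcube) `|u x|%:E)%E.
Proof.
move=> Xu; have mu := spaceX_measurable Xu.
have mb : measurable bigcube by exact: measurable_cube.
have mau : measurable_fun setT (fun x => `|u x|%:E).
  by apply/measurable_EFinP; exact: measurableT_comp.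
rewrite [RHS]integral_mkcond; apply: ge0_ae_eq_integral => //.
- by apply/(measurable_restrict _ mb measurableT); exact: measurable_funTS.
- by move=> x _; rewrite patchE; case: ifP.
- apply: filterS (spaceX_ae0 Xu) => x ux _; rewrite patchE; case: ifPn => // xb.
  rewrite ux ?normr0//= => Ox; move/negP: xb; apply; rewrite inE.
  exact: Omega_bigcube.
Qed.

(* u vanishes on a cube F lying at a bounded distance from Omega, so that
   |u(x)| is the mean over y in F of |u(x) - u(y)|. *)
Lemma L1_energy_bound : exists2 C, 0 <= C & forall u, spaceX s p Omega u ->
  (\int[leb]_x `|u x|%:E <= C%:E * (1 + energy u))%E.
Proof.
(* 4 L is the side of a cube containing both [-L, L)^n and the cube F = [2L, 3L)^n below, and n
   times the side bounds its diameter. *)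
pose d := n%:R * (4 * L); pose a := (2 * L) ^+ n; pose b := L ^+ n.
have d0 : 0 <= d by rewrite !mulr_ge0// ltW.
have b0 : 0 < b by rewrite exprn_gt0.
have a0 : 0 <= a by rewrite exprn_ge0// mulr_ge0// ltW.
pose C := d `^ s * (a * b + d ^+ n) / b.
have C0 : 0 <= C.
  by rewrite divr_ge0// ?(ltW b0)// mulr_ge0 ?powR_ge0// addr_ge0 ?exprn_ge0// mulr_ge0// ltW.
exists C => // u Xu; have mu := spaceX_measurable Xu.
pose F : set 'rV[R]_n := cube (const_mx (2 * L)) L.
have mF : measurable F by exact: measurable_cube.
have mB : measurable bigcube by exact: measurable_cube.
have FE : leb F = b%:E by rewrite lebesgue_cube// ltW.
have BE : leb bigcube = a%:E by rewrite lebesgue_cube// mulr_ge0// ltW.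
have BFd x y : bigcube x -> F y -> enorm (x - y) <= d.
  move=> /cubeP Bx /cubeP Fy; apply: (@cube_enormB _ _ (const_mx (- L))).
    apply/cubeP => i; have := Bx i; rewrite !mxE => /andP[? ?]; apply/andP; split; lra.
  apply/cubeP => i; have := Fy i; rewrite !mxE => /andP[? ?]; apply/andP; split; lra.
have FO y : F y -> ~ Omega y.
  move=> /cubeP/(_ (Ordinal n0)) + /Omega_bigcube/cubeP/(_ (Ordinal n0)); rewrite !mxE.
  by move=> /andP[? ?] /andP[? ?]; lra.
have h := osc_rectangle mu mB mF BE FE d0 BFd.
have mo : measurable_fun setT (fun z : 'rV[R]_n * 'rV[R]_n => `|u z.1 - u z.2|%:E).
  apply/measurable_EFinP; apply: measurableT_comp => //.
  by apply: measurable_funB; exact: (measurableT_comp mu).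
have E : (\int[leb2]_(z in bigcube `*` F) `|u z.1 - u z.2|%:E =
    b%:E * \int[leb]_(x in bigcube) `|u x|%:E)%E.
  rewrite fubini_tonelli_rectangle// -ge0_integralZl//; last 2 first.
    by apply/measurable_EFinP; apply: measurable_funTS; exact: measurableT_comp.
    by rewrite lee_fin ltW.
  apply: eq_integral => x _ /=.
  rewrite muleC -FE -integral_cst//.
  apply: ge0_ae_eq_integral => //.
    apply: measurable_funTS; apply/measurable_EFinP; apply: measurableT_comp => //.
    exact: measurable_funB.
    by move=> y _; rewrite lee_fin.
  by apply: filterS (spaceX_ae0 Xu) => y uy Fy /=; rewrite uy ?subr0//; exact: FO.
rewrite (integral_bigcube Xu).
have IE : (\int[leb2]_(z in bigcube `*` F) (gag u z)%:E <= energy u)%E.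
  by apply: energy_rectangle => //; exact: measurableX.
have e0 := energy_ge0 u; rewrite (energyE Xu) in IE e0 *.
set e := dmodK _ _ _ _ in IE e0 *; rewrite lee_fin in e0.
suff bU : (b%:E * \int[leb]_(x in bigcube) `|u x|%:E <= b%:E * (C%:E * (1 + e%:E)))%E.
  by move: bU; rewrite lee_pmul2l// lte_fin.
have ab0 : 0 <= a * b by rewrite mulr_ge0// ltW.
have dn0 : 0 <= d ^+ n by rewrite exprn_ge0.
have abe : 0 <= a * b * e by rewrite mulr_ge0.
have rineq : d `^ s * (a * b + d ^+ n * e) <= b * (C * (1 + e)).
  rewrite mulrA (_ : b * C = d `^ s * (a * b + d ^+ n)); last first.
    by rewrite /C mulrC divfK// gt_eqF.
  rewrite -mulrA ler_wpM2l ?powR_ge0//.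
  rewrite mulrDr mulr1 mulrDl; lra.
rewrite -E; apply: (le_trans h).
apply: (@le_trans _ _ ((d `^ s)%:E * ((a * b)%:E + (d ^+ n)%:E * e%:E))%E).
  apply: lee_wpmul2l; first by rewrite lee_fin powR_ge0.
  by apply: leeD2l; apply: lee_wpmul2l => //; rewrite lee_fin exprn_ge0.
by rewrite -lee_fin in rineq; exact: rineq.
Qed.

(* A function u with zero energy satisfies the L1 bound together with all its
   multiples, whence u = 0. *)
Lemma modK_gt0 u : spaceX_nonzero s p Omega u -> 0 < modK s p u.
Proof.
move=> [Xu u0].
have Ku0 : 0 <= modK s p u by exact: (modular_ge0 _ _ (@wK_ge0 _ _) qm1 qmp2).
rewrite lt_neqAle Ku0 andbT; apply/negP => /eqP Ku; apply: u0.
have [C C0 L1] := L1_energy_bound; have mu := spaceX_measurable Xu.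
have mau : measurable_fun setT (fun x => `|u x|%:E).
  by apply/measurable_EFinP; exact: measurableT_comp.
have bd c : 1 <= c -> (c%:E * \int[leb]_x `|u x|%:E <= C%:E)%E.
  move=> c1; have c0 : 0 <= c := le_trans ler01 c1; have Xcu := spaceXZ adm c Xu.
  have Kcu : modK s p (fun x => c * u x) = 0.
    have /andP[_] := modularZ_le measurableT mp measurable_wK (@wK_ge0 _ _)
      qm1 qmp2 p2qM (spaceX_finite_modularK adm Xu) c1.
    rewrite -/(modK s p u) -Ku mulr0 /modK nabla_sZ => le0.
    by apply/eqP; rewrite eq_le le0 (modular_ge0 _ _ (@wK_ge0 _ _) qm1 qmp2).
  have := L1 _ Xcu; have := energy_le_modK Xcu; rewrite Kcu mulr0.
  have := energy_ge0 (fun x => c * u x).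
  case: (energy _) => // e; rewrite !lee_fin => e0 e0'.
  have {e0 e0'}-> : e = 0 by apply/eqP; rewrite eq_le e0 e0'.
  rewrite adde0 mule1; apply: le_trans.
  rewrite -ge0_integralZl//.
  apply: ge0_le_integral => //.
  - by move=> x _; rewrite -EFinM lee_fin mulr_ge0.
  - exact: measurable_funeM.
  - by apply/measurable_EFinP; apply: measurableT_comp => //; exact: measurable_funM.
  - by move=> x _; rewrite -EFinM lee_fin normrM ler_wpM2r// ler_norm.
have I0 : (\int[leb]_x `|u x|%:E = 0)%E.
  apply/eqP; rewrite eq_le integral_ge0 ?andbT//.
  have I0 : (0 <= \int[leb]_x `|u x|%:E)%E by apply: integral_ge0.
  have := bd 1 (lexx _); rewrite mul1e.
  move: I0 bd; case: (\int[leb]_x _)%E => // r; rewrite !lee_fin => r0 bd _.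
  rewrite leNgt; apply/negP => rgt0.
  have h0 : 0 <= (C + 1) / r by rewrite divr_ge0 ?addr_ge0// ltW.
  (* This factor times r equals C + 1 + r, which exceeds the bound C. *)
  have := bd (1 + (C + 1) / r); rewrite lerDl => /(_ h0).
  rewrite -EFinM lee_fin (_ : _ * r = C + (1 + r)); last by field; rewrite gt_eqF.
  by rewrite leNgt ltrDl addr_gt0.
have := ae_eq_integral_abs leb measurableT (f := EFin \o u).
move=> [|+ _]; first exact/measurable_EFinP.
by move=> /(_ I0); apply: filterS => x /(_ I) [].
Qed.

End energy_estimates.

(** * Compactness of the embedding of X *)

Section subsequence_extraction.
Context {R : realType}.

(** A cluster point c exists by compactness of [-B, B]. An ultrafilter contains each set or its
    complement, and the complement of the preimage of a ball around c is excluded because c is a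
    cluster point. *)
Lemma ultra_bounded_cvg (T : Type) (G : set_system T) (a : T -> R) (B : R) : UltraFilter G ->
  (forall j, `|a j| <= B) -> exists c, forall e, 0 < e -> G [set j | `|c - a j| < e].
Proof.
move=> GU aB.
have cB := @segment_compact R (- B) B.
have GP : ProperFilter G by exact: ultra_proper.
have aB' : G (a @^-1` [set` `[- B, B]]).
  apply: (@filterS _ G _ setT) filterT => j _ /=.
  by rewrite in_itv/= -ler_norml.
have [c [_ clc]] := cB (a @ G) _ aB'.
exists c => e e0.
have [//|hC] := @in_ultra_setVsetC _ G [set j | `|c - a j| < e] GU.
have aC : G (a @^-1` (a @` [set j | ~ `|c - a j| < e])).
  by apply: (@filterS _ G _ _ _ _ hC) => j jC; exists j.
by have [_ [[j jC <-] je]] := clc _ (ball c e) aC (nbhsx_ballx c e e0).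
Qed.

Context d (T : measurableType d) (mu : {measure set T -> \bar R}).

(** The sum of the increments has integral at most 1, hence is finite almost everywhere, and there
    the telescoping series converges absolutely. *)
Lemma ae_cvg_of_summable_increments (D : set T) (f : (T -> R)^nat) : measurable D ->
  (forall m, measurable_fun setT (f m)) ->
  (forall m, \int[mu]_(x in D) `|f m x - f m.+1 x|%:E <= ((1 : R) / (2 ^ m.+1)%:R)%:E)%E ->
  {ae mu, forall x, D x -> cvgn (f ^~ x)}.
Proof.
move=> mD mf fle.
pose g m x := `|f m x - f m.+1 x|%:E.
have mg m : measurable_fun D (g m).
  apply/measurable_EFinP; apply: measurable_funTS; apply: measurableT_comp => //.
  exact: measurable_funB.
have ig : mu.-integrable D (fun x => \sum_(m <oo) g m x)%E.
  apply/integrableP; split.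
    by apply: ge0_emeasurable_sum => // k x _ _; rewrite lee_fin.
  rewrite (eq_integral (fun x => \sum_(m <oo) g m x)%E); last first.
    by move=> x _; rewrite gee0_abs//; apply: nneseries_ge0 => m _ _; rewrite lee_fin.
  rewrite integral_nneseries//; last by move=> m x _; rewrite lee_fin.
  apply: (@le_lt_trans _ _ (\sum_(m <oo) ((1 : R) / (2 ^ m.+1)%:R)%:E)%E).
    apply: lee_nneseries => [m *|m *]; last exact: fle.
    by apply: integral_ge0 => x _; rewrite lee_fin.
  by apply: (le_lt_trans (@epsilon_trick0 R 1 xpredT ler01)); rewrite ltry.
apply: filterS (integrable_ae mD ig) => x xfin Dx; have {xfin} := xfin Dx.
move=> gfin.
have cs : cvgn (series (fun m => `|f m x - f m.+1 x|)).
  apply: nondecreasing_is_cvgn.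
    by apply: nondecreasing_series => k _ _.
  exists (fine (\sum_(m <oo) g m x)%E) => _ [k _ <-].
  rewrite -lee_fin fineK// /series/= -sumEFin.
  by apply: nneseries_lim_ge => m _ _; rewrite lee_fin.
have {}cs : cvgn (series (telescope (f ^~ x))).
  apply: normed_cvg; rewrite (_ : [normed series _] = series (fun m => `|f m x - f m.+1 x|))//.
  by congr series; apply/funext => m; rewrite /telescope/= distrC.
move: cs; rewrite telescopeK => cs.
rewrite (_ : f ^~ x = (fun m => (f m x - f 0%N x) + f 0%N x)); last first.
  by apply/funext => m; rewrite subrK.
by apply: is_cvgD => //; exact: is_cvg_cst.
Qed.

End subsequence_extraction.

(** * Grids of half-open cubes and comparison of two functions in L^1 on a grid *)

Section grid.
Context {R : realType} {n : nat}.
Variables (a l : R) (M : nat).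
Hypotheses (l0 : 0 < l).

Definition grid_cube (k : {ffun 'I_n -> 'I_M}) : set 'rV[R]_n :=
  cube (\row_i (a + l * (k i)%:R)) l.

Lemma grid_cubeP k y : grid_cube k y <->
  forall i, a + l * (k i)%:R <= y ord0 i < a + l * (k i).+1%:R.
Proof.
rewrite /grid_cube; split=> [/cubeP h i|h].
  by have := h i; rewrite mxE -addrA -[X in l * _ + X]mulr1 -mulrDr natr1.
by apply/cubeP => i; rewrite mxE -addrA -[X in l * _ + X]mulr1 -mulrDr natr1.
Qed.

Lemma measurable_grid_cube k : measurable (grid_cube k).
Proof. exact: measurable_cube. Qed.

Lemma grid_cube_inj k k' y : grid_cube k y -> grid_cube k' y -> k = k'.
Proof.
move=> /grid_cubeP h /grid_cubeP h'; apply/ffunP => i; apply/val_inj/eqP.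
have /andP[h1 h2] := h i; have /andP[h3 h4] := h' i.
rewrite eqn_leq; apply/andP; split.
  by have := le_lt_trans h1 h4; rewrite ltrD2l ltr_pM2l// ltr_nat ltnS.
by have := le_lt_trans h3 h2; rewrite ltrD2l ltr_pM2l// ltr_nat ltnS.
Qed.

Lemma cube_grid (y : 'rV[R]_n) : cube (const_mx a) (l * M%:R) y -> exists k, grid_cube k y.
Proof.
move=> /cubeP yc.
have h i : exists k : 'I_M, a + l * k%:R <= y ord0 i < a + l * k.+1%:R.
  have := yc i; rewrite mxE => /andP[y1 y2].
  pose t := (y ord0 i - a) / l.
  have t0 : 0 <= t by rewrite divr_ge0 ?subr_ge0// ltW.
  have ye : y ord0 i = a + l * t by rewrite /t mulrC divfK ?gt_eqF// addrC subrK.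
  have /andP[t1 t2] := truncn_itv t0.
  have tM : (Num.truncn t < M)%N.
    rewrite -(ltr_nat R); apply: (le_lt_trans t1).
    by rewrite ltr_pdivrMr// mulrC ltrBlDl.
  by exists (Ordinal tM); rewrite ye/= lerD2l ltrD2l ler_pM2l// ltr_pM2l// t1.
have [k kP] := choice h.
by exists [ffun i => k i]; apply/grid_cubeP => i; rewrite ffunE.
Qed.

End grid.

Section compactness.
Context {R : realType} {n : nat}.
Variables (s : R) (p : 'rV[R]_n -> 'rV[R]_n -> R) (Omega : set 'rV[R]_n).
Variables qm qM L : R.
Implicit Types (u v : 'rV[R]_n -> R) (z : 'rV[R]_n * 'rV[R]_n).

Local Notation leb := (lebesgue_rV R n).
Local Notation leb2 := (lebesgue_rV R n \x lebesgue_rV R n)%E.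
Local Notation bigcube := (@bigcube R n L).

Hypothesis adm : admissible s p Omega qm qM L.

Let L0 : 0 < L. Proof. by apply: lt_le_trans (adm_L adm). Qed.

Lemma spaceX_integrable u : spaceX s p Omega u -> leb.-integrable setT (EFin \o u).
Proof.
move=> Xu; apply/integrableP; split.
  by apply/measurable_EFinP; exact: (spaceX_measurable adm Xu).
have [C C0 L1] := L1_energy_bound adm; apply: (le_lt_trans (L1 _ Xu)).
by rewrite (energyE adm Xu) -EFinD -EFinM ltry.
Qed.

Lemma energy_rectangle_fin u (D : set ('rV[R]_n * 'rV[R]_n)) : spaceX s p Omega u ->
  measurable D -> (\int[leb2]_(z in D) (gag s p u z)%:E)%E \is a fin_num.
Proof.
move=> Xu mD; rewrite ge0_fin_numE; last first.
  by apply: integral_ge0 => z _; rewrite lee_fin gag_ge0.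
apply: (le_lt_trans (energy_rectangle adm (spaceX_measurable adm Xu) mD)).
by rewrite (energyE adm Xu) ltry.
Qed.

Lemma measurable_normrB2 u : measurable_fun setT u ->
  measurable_fun setT (fun z : 'rV[R]_n * 'rV[R]_n => `|u z.1 - u z.2|%:E).
Proof.
move=> mu; apply/measurable_EFinP; apply: measurableT_comp => //.
by apply: measurable_funB; exact: (measurableT_comp mu).
Qed.

(** The mean oscillation inequality is applied to u - v. Its left side carries the factor m = l^n,
    and so do both oscillation bounds because d^n = n^n m; the factor cancels. *)
Lemma cube_difference u v a l : spaceX s p Omega u -> spaceX s p Omega v -> 0 < l ->
  let Q := cube a l in
  (\int[leb]_(x in Q) `|u x - v x|%:E <= (`|\int[leb]_(x in Q) (u x - v x)| +
    (n%:R * l) `^ s * (2 * l ^+ n + n%:R ^+ n *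
      (\int[leb2]_(z in Q `*` Q) gag s p u z + \int[leb2]_(z in Q `*` Q) gag s p v z)))%:E)%E.
Proof.
move=> Xu Xv l0 /=; set Q := cube a l; set d := n%:R * l; set m := l ^+ n.
have mu := spaceX_measurable adm Xu; have mv := spaceX_measurable adm Xv.
have mQ : measurable Q by exact: measurable_cube.
have mQQ : measurable (Q `*` Q) by exact: measurableX.
have QE : leb Q = m%:E by rewrite lebesgue_cube// ltW.
have m0 : 0 < m by rewrite exprn_gt0.
have d0 : 0 <= d by rewrite mulr_ge0// ltW.
have Qd x y : Q x -> Q y -> enorm (x - y) <= d by exact: cube_enormB.
have fu := energy_rectangle_fin Xu mQQ; have fv := energy_rectangle_fin Xv mQQ.
have ou := osc_rectangle adm mu mQ mQ QE QE d0 Qd.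
have ov := osc_rectangle adm mv mQ mQ QE QE d0 Qd.
pose iu := \int[leb2]_(z in Q `*` Q) gag s p u z.
pose iv := \int[leb2]_(z in Q `*` Q) gag s p v z.
have {}ou : (\int[leb2]_(z in Q `*` Q) `|u z.1 - u z.2|%:E <=
    (d `^ s * (m * m + d ^+ n * iu))%:E)%E by move: ou; rewrite -(fineK fu).
have {}ov : (\int[leb2]_(z in Q `*` Q) `|v z.1 - v z.2|%:E <=
    (d `^ s * (m * m + d ^+ n * iv))%:E)%E by move: ov; rewrite -(fineK fv).
have iuv : leb.-integrable Q (EFin \o (fun x => u x - v x)).
  have := integrableB measurableT (spaceX_integrable Xu) (spaceX_integrable Xv).
  by move=> /(integrableS measurableT mQ (@subsetT _ _)).
have := mean_oscillation mQ QE (measurable_funB mu mv) iuv.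
set J := (X in (_ <= _ + X)%E) => mo.
have {mo}mo : (m%:E * \int[leb]_(x in Q) `|u x - v x|%:E <=
    m%:E * `|\int[leb]_(x in Q) (u x - v x)|%:E + J)%E by exact: mo.
rewrite -/iu -/iv.
have JE : (J <= (d `^ s * (m * m + d ^+ n * iu) + d `^ s * (m * m + d ^+ n * iv))%:E)%E.
  rewrite EFinD; apply: (le_trans _ (leeD ou ov)).
  rewrite -ge0_integralD//; last 2 first.
  - exact: measurable_funTS (measurable_normrB2 mu).
  - exact: measurable_funTS (measurable_normrB2 mv).
  apply: ge0_le_integral => //.
  - exact: measurable_funTS (measurable_normrB2 (measurable_funB mu mv)).
  - by apply: emeasurable_funD; apply: measurable_funTS; exact: measurable_normrB2.
  - move=> z _; rewrite -EFinD lee_fin.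
    have -> : u z.1 - v z.1 - (u z.2 - v z.2) = (u z.1 - u z.2) - (v z.1 - v z.2) by ring.
    exact: ler_normB.
have JE' : (J <= m%:E * (d `^ s * (2 * m + n%:R ^+ n * (iu + iv)))%:E)%E.
  apply: (le_trans JE); rewrite -EFinM lee_fin.
  rewrite (_ : d ^+ n = n%:R ^+ n * m) ?exprMn//.
  by rewrite le_eqVlt; apply/orP; left; apply/eqP; ring.
suff : (m%:E * \int[leb]_(x in Q) `|u x - v x|%:E <= m%:E * (`|\int[leb]_(x in Q) (u x - v x)| +
    d `^ s * (2 * m + n%:R ^+ n * (iu + iv)))%:E)%E by rewrite lee_pmul2l// lte_fin.
apply: (le_trans mo); rewrite [in leRHS]EFinD muleDr//.
exact: leeD2l.
Qed.

Definition gridL M : {ffun 'I_n -> 'I_M} -> set 'rV[R]_n := @grid_cube R n (- L) (2 * L / M%:R) M.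

Lemma bigcube_grid M : (0 < M)%N -> bigcube `<=` \big[setU/set0]_k @gridL M k.
Proof.
move=> M0 y yB; have M0' : 0 < M%:R :> R by rewrite ltr0n.
have l0 : 0 < 2 * L / M%:R by rewrite divr_gt0// mulr_gt0.
have [|k yk] := @cube_grid _ _ (- L) (2 * L / M%:R) M l0 y.
  by rewrite divfK// gt_eqF.
by rewrite -bigcup_seq; exists k => //=; rewrite mem_index_enum.
Qed.

(** The products of the cells with themselves are pairwise disjoint, so that their energies add up
    to at most the total one. *)
Lemma sum_grid_energy M u : spaceX s p Omega u -> (0 < M)%N ->
  \sum_k \int[leb2]_(z in @gridL M k `*` gridL k) gag s p u z <= dmodK s p u u.
Proof.
move=> Xu M0; have mu := spaceX_measurable adm Xu.
have l0 : 0 < 2 * L / M%:R by rewrite divr_gt0 ?mulr_gt0// ltr0n.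
have mG k : measurable (@gridL M k `*` gridL k) by apply: measurableX; exact: measurable_grid_cube.
have mgag : measurable_fun setT (fun z => (gag s p u z)%:E).
  by apply/measurable_EFinP; exact: (measurable_gag adm).
rewrite -lee_fin -(energyE adm Xu) -sumEFin.
under eq_bigr => k _ do rewrite fineK ?(energy_rectangle_fin Xu)//.
rewrite -(ge0_integral_bigsetU _ mG); first last.
- by move=> z _; rewrite lee_fin gag_ge0.
- exact: measurable_funTS.
- move=> k k' _ _ [z [[/= z1 _] [z2 _]]].
  exact: (grid_cube_inj l0 z1 z2).
- exact: index_enum_uniq.
- apply: (energy_rectangle adm mu).
  by apply: bigsetU_measurable => k _; exact: mG.
Qed.

(** [cube_difference] is summed over the M^n cells, of total volume (2L)^n. At a given energy bound
    the last term tends to 0 as M grows; what remains of the L^1 distance is a finite number of cell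
    integrals. *)
Lemma grid_difference M u v : spaceX s p Omega u -> spaceX s p Omega v -> (0 < M)%N ->
  (\int[leb]_(x in bigcube) `|u x - v x|%:E <=
   (\sum_k `|\int[leb]_(x in @gridL M k) (u x - v x)| +
    (n%:R * (2 * L / M%:R)) `^ s * (2 * (2 * L) ^+ n +
      n%:R ^+ n * (dmodK s p u u + dmodK s p v v)))%:E)%E.
Proof.
move=> Xu Xv M0; have M0' : 0 < M%:R :> R by rewrite ltr0n.
set l := 2 * L / M%:R; have l0 : 0 < l by rewrite divr_gt0// mulr_gt0.
have mu := spaceX_measurable adm Xu; have mv := spaceX_measurable adm Xv.
have mG k : measurable (@gridL M k) by exact: measurable_grid_cube.
have muv : measurable_fun setT (fun x => `|u x - v x|%:E).
  by apply/measurable_EFinP; apply: measurableT_comp => //; exact: measurable_funB.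
have mU : measurable (\big[setU/set0]_k @gridL M k).
  by apply: bigsetU_measurable => k _; exact: mG.
apply: (@le_trans _ _ (\int[leb]_(x in \big[setU/set0]_k @gridL M k) `|u x - v x|%:E)%E).
  apply: ge0_subset_integral => //; first exact: measurable_cube.
    exact: measurable_funTS.
  exact: bigcube_grid.
rewrite (ge0_integral_bigsetU _ mG); first last.
- by move=> z _; rewrite lee_fin.
- exact: measurable_funTS.
- move=> k k' _ _ [z [z1 z2]]; exact: (grid_cube_inj l0 z1 z2).
- exact: index_enum_uniq.
apply: (@le_trans _ _ (\sum_k (`|\int[leb]_(x in @gridL M k) (u x - v x)| +
    (n%:R * l) `^ s * (2 * l ^+ n + n%:R ^+ n *
      (\int[leb2]_(z in @gridL M k `*` gridL k) gag s p u z +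
       \int[leb2]_(z in @gridL M k `*` gridL k) gag s p v z)))%:E)%E).
  by apply: lee_sum => k _; exact: cube_difference.
rewrite sumEFin lee_fin big_split/= lerD2l -mulr_sumr ler_wpM2l ?powR_ge0//.
rewrite big_split/=; apply: lerD.
  rewrite sumr_const card_ffun !card_ord -[leLHS]mulr_natr -mulrA ler_wpM2l// natrX -exprMn.
  by rewrite /l divfK// gt_eqF.
rewrite -mulr_sumr big_split/= ler_wpM2l ?exprn_ge0//.
by apply: lerD; exact: sum_grid_energy.
Qed.

End compactness.

(** * Extraction of an almost everywhere convergent sequence *)

Section sequential_compactness.
Context {R : realType} {n : nat}.
Variables (s : R) (p : 'rV[R]_n -> 'rV[R]_n -> R) (Omega : set 'rV[R]_n).
Variables qm qM L : R.

Local Notation leb := (lebesgue_rV R n).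
Local Notation bigcube := (@bigcube R n L).

Hypothesis adm : admissible s p Omega qm qM L.

Let s0 : 0 < s. Proof. by case/andP: (adm_s adm). Qed.
Let L0 : 0 < L. Proof. by apply: lt_le_trans (adm_L adm). Qed.

Lemma grid_fine (K e : R) : 0 < K -> 0 < e ->
  exists2 M, (0 < M)%N & (n%:R * (2 * L / M%:R)) `^ s * K <= e.
Proof.
move=> K0 e0; pose r := (e / K) `^ s^-1.
have r0 : 0 < r by rewrite powR_gt0// divr_gt0.
pose t := n%:R * (2 * L) / r.
have t0 : 0 <= t by rewrite divr_ge0 ?(ltW r0)// mulr_ge0// mulr_ge0// ltW.
exists (Num.truncn t).+1 => //.
have /andP[_ tM] := truncn_itv t0; set M := (Num.truncn t).+1 in tM *.
have M0 : 0 < M%:R :> R by rewrite ltr0n.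
rewrite -ler_pdivlMr//.
have -> : e / K = r `^ s by rewrite -powRrM mulVf ?powRr1 ?gt_eqF// divr_ge0 ?ltW.
rewrite ge0_ler_powR ?nnegrE ?(ltW s0) ?(ltW r0)//.
  by rewrite mulr_ge0// divr_ge0 ?mulr_ge0 ?(ltW L0)// ltW.
rewrite mulrA ler_pdivrMr// [leRHS]mulrC -ler_pdivrMr//.
by rewrite ltW.
Qed.

Variables (u_ : nat -> 'rV[R]_n -> R) (C : R).
Hypotheses (Xu : forall j, spaceX s p Omega (u_ j)) (uC : forall j, dmodK s p (u_ j) (u_ j) <= C).

(** A fine grid makes the energy term at most e / 2 for all members of the sequence at once. The
    finitely many cell integrals converge along G, so that on a set of G they are close to each
    other. *)
Lemma ultra_cauchy (G : set_system nat) (e : R) : UltraFilter G -> 0 < e ->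
  exists2 A : set nat, G A & forall i j, A i -> A j ->
    (\int[leb]_(x in bigcube) `|u_ i x - u_ j x|%:E <= e%:E)%E.
Proof.
move=> GU e0.
have GP : ProperFilter G by exact: ultra_proper.
have C0 : 0 <= C.
  by apply: le_trans (uC 0); rewrite -lee_fin -(energyE adm (Xu 0)); exact: energy_ge0.
pose K := 2 * (2 * L) ^+ n + n%:R ^+ n * (C + C).
have K0 : 0 < K.
  rewrite ltr_pwDl// ?mulr_ge0 ?addr_ge0 ?exprn_ge0// mulr_gt0// exprn_gt0// mulr_gt0//.
have e20 : 0 < e / 2 by rewrite divr_gt0.
have [M M0 MK] := grid_fine K0 e20.
pose N := #|{ffun 'I_n -> 'I_M}|.
have N0 : 0 < N%:R :> R.
  by rewrite ltr0n; apply/card_gt0P; exists [ffun=> Ordinal M0].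
have [C1 C10 L1] := L1_energy_bound adm.
have mG (k : {ffun 'I_n -> 'I_M}) : measurable (@gridL _ _ L M k) by exact: measurable_grid_cube.
have iG j (k : {ffun 'I_n -> 'I_M}) : leb.-integrable (@gridL _ _ L M k) (EFin \o u_ j).
  exact: (integrableS measurableT (mG k) (@subsetT _ _) (spaceX_integrable adm (Xu j))).
pose a (k : {ffun 'I_n -> 'I_M}) j := \int[leb]_(x in @gridL _ _ L M k) u_ j x.
have aB k j : `|a k j| <= C1 * (1 + C).
  rewrite -lee_fin; apply: (le_trans (_ : _ <= \int[leb]_x `|u_ j x|%:E)%E).
    rewrite EFin_normr_Rintegral//.
    apply: (le_trans (le_abse_integral _ _ _)) => //.
      exact: (measurable_int _ (iG j k)).
    apply: ge0_subset_integral => //.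
    apply/measurable_EFinP; apply: measurableT_comp => //.
    exact: (spaceX_measurable adm (Xu j)).
  apply: (le_trans (L1 _ (Xu j))); rewrite (energyE adm (Xu j)) -EFinD -EFinM lee_fin.
  by rewrite ler_wpM2l// lerD2l.
have [c cP] := choice (fun k => ultra_bounded_cvg GU (aB k)).
(* Two deviations of e / (4 N) on each of the N cells add up to e / 2. *)
have d0 : 0 < e / (4 * N%:R) by rewrite divr_gt0// mulr_gt0.
exists [set j | forall k, `|c k - a k j| < e / (4 * N%:R)].
  by apply: filter_forall => k; exact: cP.
move=> i j Ai Aj; apply: (le_trans (grid_difference adm (Xu i) (Xu j) M0)).
rewrite lee_fin [leRHS](splitr e); apply: lerD; last first.
  apply: (le_trans _ MK); rewrite ler_wpM2l ?powR_ge0// lerD2l.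
  by rewrite ler_wpM2l ?exprn_ge0// lerD.
rewrite (_ : e / 2 = \sum_(k : {ffun 'I_n -> 'I_M}) (e / (4 * N%:R) + e / (4 * N%:R))); last first.
  by rewrite sumr_const -/N -[RHS]mulr_natr; field; rewrite gt_eqF.
apply: ler_sum => k _.
rewrite RintegralB// -/(a k i) -/(a k j).
have -> : a k i - a k j = (c k - a k j) - (c k - a k i) by ring.
by rewrite (le_trans (ler_normB _ _))// lerD// ltW.
Qed.

(** A single ultrafilter finer than the eventual filter makes the cell integrals of all grids
    converge at once, which replaces a diagonal extraction. The index phi m is picked in a set where
    the tolerances 2^-1, ..., 2^-(m+1) all hold, so that phi m and phi (m+1) share the m-th one; phi
    is not asked to be monotone, only to satisfy m <= phi m. *)
Lemma compact_sequence : exists2 phi : nat -> nat, (forall m, m <= phi m)%N &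
  {ae leb, forall x, cvgn (fun m => u_ (phi m) x)}.
Proof.
have [G [GU FG]] := ultraFilterLemma (@eventually_filter).
have GP : ProperFilter G by exact: ultra_proper.
have h m : exists A : set nat, G A /\ forall i j, A i -> A j ->
    (\int[leb]_(x in bigcube) `|u_ i x - u_ j x|%:E <= ((1 : R) / (2 ^ m.+1)%:R)%:E)%E.
  have m0 : 0 < (1 : R) / (2 ^ m.+1)%:R by rewrite divr_gt0// ltr0n expn_gt0.
  by have [A GA AP] := ultra_cauchy GU m0; exists A.
have [A AP] := choice h.
have GB m : G (fun j => (forall i, (i <= m)%N -> A i j) /\ (m <= j)%N).
  apply: filterI; last by apply: FG; exists m.
  elim: m => [|m ih].
    by apply: filterS (AP 0%N).1 => j Aj i; rewrite leqn0 => /eqP ->.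
  apply: filterS2 ih (AP m.+1).1 => j h1 h2 i; rewrite leq_eqVlt => /predU1P[->//|].
  by rewrite ltnS; exact: h1.
have [phi phiP] := choice (fun m => filter_ex (GB m)).
exists phi; first by move=> m; have [] := phiP m.
have mB : measurable bigcube by exact: measurable_cube.
have H1 : {ae leb, forall x, bigcube x -> cvgn (fun m => u_ (phi m) x)}.
  apply: (@ae_cvg_of_summable_increments R _ _ leb bigcube (fun m => u_ (phi m)) mB).
    by move=> m; exact: (spaceX_measurable adm (Xu _)).
  move=> m; apply: (AP m).2; first exact: ((phiP m).1 m (leqnn m)).
  exact: ((phiP m.+1).1 m (leqnSn m)).
have H2 : {ae leb, forall x, forall m, (~` Omega) x -> u_ (phi m) x = 0}.
  apply/ae_foralln => m.
  by have := spaceX_ae0 adm (Xu (phi m)).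
apply: filterS2 H1 H2 => x h1 h2.
have [xB|xB] := pselect (bigcube x); first exact: h1.
rewrite (_ : (fun m => u_ (phi m) x) = fun=> 0); first exact: is_cvg_cst.
apply/funext => m; apply: h2 => Ox; apply: xB.
exact: (Omega_bigcube adm Ox).
Qed.

End sequential_compactness.

(** * Higher integrability *)

Section higher_integrability.
Context {R : realType} {n : nat}.
Variables (s : R) (p : 'rV[R]_n -> 'rV[R]_n -> R) (Omega : set 'rV[R]_n).
Variables qm qM L : R.
Implicit Types (u v : 'rV[R]_n -> R).

Local Notation leb := (lebesgue_rV R n).

Hypothesis adm : admissible s p Omega qm qM L.

Let s0 : 0 < s. Proof. by case/andP: (adm_s adm). Qed.
Let s1 : s < 1. Proof. by case/andP: (adm_s adm). Qed.
Let n0 : (0 < n)%N := adm_n adm.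
Let n0' : 0 < n%:R :> R. Proof. by rewrite ltr0n. Qed.
Let n1' : 1 <= n%:R :> R. Proof. by rewrite ler1n. Qed.

(** Compactness of [-L, L]^n makes the radius uniform: for x' near x and y near x', both p x' y and
    p x' x' are within e / 2 of p x x. *)
Lemma exponent_uniformly_close (e : R) : 0 < e ->
  exists2 r, 0 < r & forall x y, Omega x -> cube x r y -> `|p x y - p x x| <= e.
Proof.
move=> e0; pose K := [set x : 'rV[R]_n | forall i, `[- L, L]%classic (x ord0 i)].
have cK : compact K by apply: (rV_compact (A := fun=> `[- L, L]%classic)) => i; exact: segment_compact.
pose P (r : R) (x : 'rV[R]_n) := forall y, cube x r y -> `|p x y - p x x| <= e.
have := (@compact_near_coveringP _ K).1 cK R (0^'+) P _.
have hP x : K x -> \forall x' \near x & r \near 0^'+, P r x'.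
  move=> _; have e20 : 0 < e / 2 by rewrite divr_gt0.
  have /cvgrPdist_lt/(_ _ e20)/nbhs_ballP[r /= r0 rP] := @adm_cont _ _ _ _ _ _ _ _ adm (x, x).
  have r20 : 0 < r / 2 by rewrite divr_gt0.
  exists (ball x (r / 2), [set r' | r' < r / 2]) => /=.
    by split; [exact: nbhsx_ballx|exact: nbhs_right_lt].
  move=> [x' r'] [/= xx' r'r] y /cubeP yc.
  have xx : ball x r x' by apply: le_ball xx'; lra.
  have xy : ball x r y.
    rewrite (_ : r = r / 2 + r / 2); last by field.
    apply: (ball_triangle xx'); split=> // i j; rewrite ord1 /ball/=.
    by have /andP[? ?] := yc j; rewrite ltr_distl; apply/andP; split; lra.
  have h1 := rP (x', y) (conj xx xy); have h2 := rP (x', x') (conj xx xx).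
  rewrite /= in h1 h2.
  have -> : p x' y - p x' x' = (p x x - p x' x') - (p x x - p x' y) by ring.
  by rewrite (le_trans (ler_normB _ _))// [leRHS](splitr e) lerD// ltW.
move=> /(_ _ hP) H.
have [r [r0 rP]] : exists r : R, 0 < r /\ K `<=` P r.
  have : \forall r \near 0^'+, 0 < r /\ K `<=` P r by near=> r; split; near: r => //; exact: nbhs_right_gt.
  by move=> /filter_ex.
exists r => // x y Ox; apply: rP => i /=; rewrite in_itv/= -ler_norml.
by rewrite ltW// (adm_box adm).
Unshelve. all: by end_near. Qed.

(* Compare u(x) with its values on a cube whose volume is 4 B / |u(x)|: since
   |u| has integral at most B, u is small compared to u(x) on half of it, and
   the oscillation of u over that small cube controls a power of |u(x)|
   larger than pbar(x). *)
Lemma pointwise_higher_power (B : R) : 0 < B ->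
  exists M0 C : R, [/\ 1 <= M0, 0 <= C & forall u, spaceX s p Omega u ->
    (\int[leb]_x `|u x|%:E <= B%:E)%E -> forall x, Omega x -> M0 <= `|u x| ->
    ((`|u x| `^ (pbar p x + s / (2 * n%:R)))%:E <=
      C%:E * (1 + \int[leb]_y (gag s p u (x, y))%:E))%E].
Proof.
(* With a = s / n, lowering the exponent to q = pbar x - a / 4 loses a / 4, while the small cube
   gains q a >= a - a^2 / 4; since a <= 1, the balance is at least a / 2. *)
move=> B0; pose e := s / (4 * n%:R).
have n40 : 0 < 4 * n%:R :> R by rewrite mulr_gt0.
have e0 : 0 < e by rewrite divr_gt0.
have [r0 r00 close] := exponent_uniformly_close e0.
have rn0 : 0 < r0 ^+ n by rewrite exprn_gt0.
(* The bounds below with q replaced by qM, so that C does not depend on x; the bases 2, n and 1 + 4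
   B are all at least 1. *)
pose C := 2 * (2 `^ qM * (n%:R `^ (s * qM) * (1 + 4 * B) `^ (s * qM / n%:R)) * n%:R ^+ n).
(* |u x| >= M0 makes the volume v = 4 B / |u x| at most r0^n, so that the cube of volume v at x lies
   where p is nearly constant. *)
exists (1 + 4 * B / r0 ^+ n), C; split.
- by rewrite lerDl divr_ge0 ?mulr_ge0// ltW.
- by rewrite !mulr_ge0 ?powR_ge0.
move=> u Xu uB x Ox; set t := `|u x| => Mt.
have mu := spaceX_measurable adm Xu.
have t1 : 1 <= t by apply: le_trans Mt; rewrite lerDl divr_ge0 ?mulr_ge0// ltW.
have t0 : 0 < t by exact: lt_le_trans t1.
pose v := 4 * B / t.
have v0 : 0 < v by rewrite divr_gt0// mulr_gt0.
have vr : v <= r0 ^+ n.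
  rewrite ler_pdivrMr// [leRHS]mulrC -ler_pdivrMr//; apply: le_trans Mt.
  by rewrite lerDr.
pose l := v `^ n%:R^-1.
have l0 : 0 < l by rewrite powR_gt0.
have ln : l ^+ n = v.
  by rewrite -powR_mulrn ?(ltW l0)// -powRrM mulVf ?powRr1 ?gt_eqF// ltW.
have lr : l <= r0.
  by rewrite -(@ler_pXn2r _ n)// ?nnegrE ?(ltW l0) ?(ltW r00)// ln.
pose q := pbar p x - e.
have pb1 : 1 < pbar p x by apply: lt_le_trans (adm_qm1 adm) (adm_qmp adm x x).
have sn0 : 0 < s / n%:R by rewrite divr_gt0.
have sn1 : s / n%:R <= 1 by rewrite ler_pdivrMr// mul1r (le_trans (ltW s1) n1').
have eE : e = s / n%:R / 4 by rewrite /e; field; rewrite gt_eqF.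
have q0 : 0 < q by rewrite /q; lra.
have qp y : cube x l y -> q <= p x y.
  move=> /cubeP xy; have : cube x r0 y.
    by apply/cubeP => i; have /andP[-> /=] := xy i => /lt_le_trans; apply; rewrite lerD2l.
  by move=> /(close _ _ Ox); rewrite ler_distl /q => /andP[].
pose d := n%:R * l.
have d0 : 0 < d by rewrite mulr_gt0.
have mC : measurable (cube x l) by exact: measurable_cube.
have CE : leb (cube x l) = v%:E by rewrite lebesgue_cube ?ln// ltW.
have xC : cube x l x by apply/cubeP => i; rewrite lexx ltrDl.
have mg : measurable_fun setT (fun y => (gag s p u (x, y))%:E).
  by apply/measurable_EFinP; apply: measurable_fun_pair2; exact: (measurable_gag adm).
set G := (\int[leb]_y (gag s p u (x, y))%:E)%E.
have G0 : (0 <= G)%E by apply: integral_ge0 => y _; rewrite lee_fin gag_ge0.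
pose T := (t / 2) `^ q.
have T0 : 0 < T by rewrite powR_gt0// divr_gt0.
have main : ((T * v)%:E <= (d `^ (s * q))%:E * (v%:E + (d ^+ n)%:E * G) +
    (T * (2 / t))%:E * B%:E)%E.
  pose F1 y := ((d `^ (s * q))%:E * (1%:E + (d ^+ n)%:E * (gag s p u (x, y))%:E))%E.
  pose F2 y := ((T * (2 / t))%:E * `|u y|%:E)%E.
  have dg0 y : (0 <= (d ^+ n)%:E * (gag s p u (x, y))%:E)%E.
    by apply: mule_ge0; rewrite lee_fin ?gag_ge0// exprn_ge0// ltW.
  have F10' y : (0 <= 1%:E + (d ^+ n)%:E * (gag s p u (x, y))%:E)%E.
    by apply: adde_ge0 => //; exact: dg0.
  have F10 y : (0 <= F1 y)%E.
    by apply: mule_ge0; [rewrite lee_fin powR_ge0|exact: F10'].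
  have Tt0 : 0 <= T * (2 / t) by rewrite mulr_ge0 ?divr_ge0// ltW.
  have F20 y : (0 <= F2 y)%E by apply: mule_ge0; rewrite lee_fin.
  have mF1 : measurable_fun setT F1.
    apply: measurable_funeM; apply: emeasurable_funD; first exact: measurable_cst.
    exact: measurable_funeM.
  have mau : measurable_fun setT (fun y => `|u y|%:E).
    by apply/measurable_EFinP; exact: measurableT_comp.
  have mF2 : measurable_fun setT F2 by exact: measurable_funeM.
  have e1 : (\int[leb]_(y in cube x l) F1 y <=
      (d `^ (s * q))%:E * (v%:E + (d ^+ n)%:E * G))%E.
    rewrite ge0_integralZl//; last 2 first.
    - apply: emeasurable_funD; first exact: measurable_cst.
      by apply: measurable_funTS; exact: measurable_funeM.
    - by rewrite lee_fin powR_ge0.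
    apply: lee_wpmul2l; first by rewrite lee_fin powR_ge0.
    rewrite ge0_integralD//; last by apply: measurable_funTS; exact: measurable_funeM.
    apply: leeD; first by rewrite integral_cst// mul1e -CE.
    rewrite ge0_integralZl//; last 3 first.
    - exact: measurable_funTS.
    - by move=> y _; rewrite lee_fin gag_ge0.
    - by rewrite lee_fin exprn_ge0// ltW.
    apply: lee_wpmul2l; first by rewrite lee_fin exprn_ge0// ltW.
    by apply: ge0_subset_integral => // y _; rewrite lee_fin gag_ge0.
  have e2 : (\int[leb]_(y in cube x l) F2 y <= (T * (2 / t))%:E * B%:E)%E.
    rewrite ge0_integralZl//; last exact: measurable_funTS.
    apply: lee_wpmul2l; first by rewrite lee_fin.
    apply: (le_trans _ uB); apply: ge0_subset_integral => //.
  apply: (le_trans _ (leeD e1 e2)).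
  rewrite -ge0_integralD//; [|exact: measurable_funTS|exact: measurable_funTS].
  rewrite EFinM -CE -integral_cst//.
  apply: ge0_le_integral => //.
  - by move=> y _; rewrite lee_fin ltW.
  - by apply: emeasurable_funD; exact: measurable_funTS.
  move=> y Cy; have xyd : enorm (x - y) <= d by exact: (cube_enormB xC Cy).
  have := osc_pointwise adm u xyd q0 (qp y Cy) => osc.
  suff : T <= d `^ (s * q) * (1 + d ^+ n * gag s p u (x, y)) + T * (2 / t) * `|u y|.
    by rewrite -lee_fin.
  (* Either |u y| is at most t / 2, and the oscillation is at least t / 2, or the Chebyshev factor 2
     |u y| / t exceeds 1. *)
  have [yt|yt] := leP `|u y| (t / 2).
    rewrite -[leLHS]addr0; apply: lerD; last by rewrite mulr_ge0.
    apply: (le_trans _ osc); rewrite ge0_ler_powR ?nnegrE ?(ltW q0)//.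
      by rewrite divr_ge0// ltW.
    have : t - `|u y| <= `|u x - u y| by rewrite lerB_dist.
    by lra.
  rewrite -[leLHS]add0r; apply: lerD.
    by rewrite mulr_ge0 ?powR_ge0// addr_ge0// mulr_ge0 ?gag_ge0// exprn_ge0// ltW.
  rewrite -mulrA ler_peMr// ?(ltW T0)// mulrAC ler_pdivlMr// mul1r; lra.
have C0 : 0 < C by rewrite !mulr_gt0 ?powR_gt0 ?addr_gt0 ?mulr_gt0 ?exprn_gt0.
move: main G0; case: G => [g| |] // main; last first.
  by move=> _; rewrite addey// gt0_muley ?lte_fin// leey.
rewrite lee_fin => g0; rewrite -EFinD -EFinM lee_fin.
have {}main : T * v <= d `^ (s * q) * (v + d ^+ n * g) + T * (2 / t) * B.
  by rewrite -lee_fin.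
(* The 4 in v is chosen for this: the Chebyshev term is half of the left side and is absorbed. *)
have TB : T * (2 / t) * B = T * v / 2 by rewrite /v; field; rewrite gt_eqF.
have dn : d ^+ n = n%:R ^+ n * v by rewrite exprMn ln.
rewrite TB dn in main.
have {main}main : T <= 2 * (d `^ (s * q) * (1 + n%:R ^+ n * g)).
  have := main; rewrite (_ : d `^ (s * q) * _ = v * (d `^ (s * q) * (1 + n%:R ^+ n * g))); last by ring.
  move=> h; rewrite -(ler_pM2l v0); move: h; set X := d `^ _ * _ => h; lra.
have qle : q <= qM by rewrite /q lerBlDr (le_trans (adm_pqM adm x x))// lerDl ltW.
have nn1 : 1 <= (n%:R : R) ^+ n by rewrite exprn_ege1.
have tq : t `^ (pbar p x + s / (2 * n%:R)) <= t `^ q * t `^ (s * q / n%:R).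
  rewrite -powRD ?(gt_eqF t0) ?implybT//; apply: ler_powR => //.
  have -> : s / (2 * n%:R) = s / n%:R / 2 by field; rewrite gt_eqF.
  have -> : s * q / n%:R = q * (s / n%:R) by field; rewrite gt_eqF.
  have hpb : (pbar p x - 1) * (s / n%:R) >= 0 by rewrite mulr_ge0// ?subr_ge0 ltW.
  have hs2 : (s / n%:R) * (s / n%:R) <= s / n%:R by rewrite ler_piMr// ltW.
  rewrite /q eE; set a := s / n%:R in hpb hs2 *; lra.
apply: (le_trans tq).
have tT : t `^ q = 2 `^ q * T.
  by rewrite /T -powRM// ?divr_ge0// ?(ltW t0)// mulrC divfK.
have lE : d `^ (s * q) = n%:R `^ (s * q) * v `^ (s * q / n%:R).
  by rewrite powRM// ?(ltW l0)// /l -powRrM (mulrC n%:R^-1).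
have vt : v `^ (s * q / n%:R) * t `^ (s * q / n%:R) = (4 * B) `^ (s * q / n%:R).
  by rewrite -powRM ?(ltW v0) ?(ltW t0)// /v divfK// gt_eqF.
have sq0 : 0 <= s * q by rewrite mulr_ge0// ltW.
apply: (@le_trans _ _ (2 * (2 `^ q * (n%:R `^ (s * q) * (4 * B) `^ (s * q / n%:R)) *
    (1 + n%:R ^+ n * g)))).
  rewrite tT -vt -[leLHS]mulrA [leLHS]mulrCA.
  have := ler_wpM2r (powR_ge0 t (s * q / n%:R)) main => h.
  have := ler_wpM2l (powR_ge0 2 q) h; rewrite lE.
  rewrite mulrCA => h'; apply: (le_trans _ (le_trans h' _)); rewrite le_eqVlt; apply/orP; left; apply/eqP; ring.
have A1 : 2 `^ q <= 2 `^ qM :> R by apply: ler_powR => //; rewrite ler1n.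
have A2 : n%:R `^ (s * q) <= n%:R `^ (s * qM) :> R.
  by apply: ler_powR => //; rewrite ler_wpM2l// ltW.
have A3 : (4 * B) `^ (s * q / n%:R) <= (1 + 4 * B) `^ (s * qM / n%:R).
  apply: (@le_trans _ _ ((1 + 4 * B) `^ (s * q / n%:R))).
    have B40 : 0 <= 4 * B by rewrite mulr_ge0// ltW.
    by apply: ge0_ler_powR; rewrite ?nnegrE ?lerDr// ?addr_ge0// mulr_ge0// invr_ge0.
  apply: ler_powR; first by rewrite lerDl mulr_ge0// ltW.
  by rewrite ler_wpM2r ?invr_ge0// ler_wpM2l// ltW.
have A4 : 1 + n%:R ^+ n * g <= n%:R ^+ n * (1 + g) by rewrite mulrDr mulr1 lerD2r.
rewrite /C -[leRHS]mulrA ler_wpM2l//.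
rewrite -[leRHS]mulrA; apply: ler_pM => //.
- by rewrite !mulr_ge0// powR_ge0.
- by rewrite addr_ge0// mulr_ge0// exprn_ge0.
- by do 2! [apply: ler_pM; rewrite ?mulr_ge0 ?powR_ge0//].
Qed.

End higher_integrability.

(** * A nonzero element of X *)

Section sup_norm.
Context {R : realType} {n : nat}.
Implicit Types x y : 'rV[R]_n.

Lemma normr_coord_le x i : `|x ord0 i| <= `|x|.
Proof.
rewrite [leRHS]mx_normrE; exact: (le_bigmax _ (fun ij : 'I_1 * 'I_n => `|x ij.1 ij.2|) (ord0, i)).
Qed.

Lemma normr_le_enorm x : `|x| <= enorm x.
Proof.
rewrite [leLHS]mx_normrE; apply: bigmax_le => [|[i j] _ /=]; first exact: enorm_ge0.
rewrite ord1 /enorm -sqrtr_sqr; apply: ler_wsqrtr.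
rewrite /edot (bigD1 j)//= -expr2 lerDl sumr_ge0// => k _.
by rewrite -expr2 sqr_ge0.
Qed.

(** Side 4 r rather than 2 r, because the cube is half-open and must contain the points at distance
    exactly r. *)
Lemma cube_normr (r : R) x y : 0 < r -> `|y - x| <= r -> cube (x - const_mx r) (4 * r) y.
Proof.
move=> r0 yx; apply/cubeP => i; have := le_trans (normr_coord_le (y - x) i) yx.
by rewrite !mxE ler_norml => /andP[? ?]; apply/andP; split; lra.
Qed.

End sup_norm.

Lemma nneseries_geometric_le (R : realType) (a z : R) : 0 <= a -> 0 < z -> z < 1 ->
  (\sum_(j <oo) (a * z ^+ j)%:E <= (a / (1 - z))%:E)%E.
Proof.
move=> a0 z0 z1; apply: lime_le.
  by apply: is_cvg_nneseries => j _ _; rewrite lee_fin mulr_ge0// exprn_ge0// ltW.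
apply: nearW => k; rewrite sumEFin lee_fin.
by apply: (@geometric_le_lim R k a z) => //; rewrite gtr0_norm.
Qed.

Lemma powR_exprn (R : realType) (a r : R) j : 0 <= a -> (a ^+ j) `^ r = (a `^ r) ^+ j.
Proof.
move=> a0; rewrite -(powR_mulrn j a0) -[RHS](powR_mulrn j (powR_ge0 a r)).
exact: powRAC.
Qed.

Lemma dyadic_shell (R : realType) (t : R) : 1 <= t -> exists j, 2 ^+ j <= t < 2 ^+ j.+1.
Proof.
move=> t1; have t0 : 0 <= t by exact: le_trans t1.
have /andP[h1 h2] := truncn_itv t0; set k := Num.truncn t in h1 h2.
have k0 : (0 < k)%N by rewrite -ltnS -(ltr_nat R); exact: le_lt_trans h2.
have /andP[k1 k2] := trunc_log_bounds (ltnSn 1) k0.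
exists (trunc_log 2 k); rewrite -!natrX; apply/andP; split.
  by apply: le_trans h1; rewrite ler_nat.
by apply: (lt_le_trans h2); rewrite ler_nat.
Qed.

Section radial_integral.
Context {R : realType} {n : nat}.
Variables (s K : R).
Hypotheses (s0 : 0 < s) (s1 : s < 1) (K0 : 0 <= K).
Local Notation leb := (lebesgue_rV R n).

(* The shells {2^-(j+1) < |y - x| <= 2^-j} and {2^j <= |y - x| < 2^(j+1)}
   contribute the terms of two geometric series. *)
Lemma radial_integral_bound : exists2 A, 0 <= A & forall (x : 'rV[R]_n) (g : 'rV[R]_n -> R),
  measurable_fun setT g -> (forall y, 0 <= g y) -> g x = 0 ->
  (forall y, 0 < `|y - x| < 1 -> g y <= K * (`|y - x| `^ (1 - s) / `|y - x| ^+ n)) ->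
  (forall y, 1 <= `|y - x| -> g y <= K * (`|y - x| `^ (- s) / `|y - x| ^+ n)) ->
  (\int[leb]_y (g y)%:E <= A%:E)%E.
Proof.
pose z1 : R := 2^-1 `^ (1 - s); pose z2 : R := 2 `^ (- s).
have z10 : 0 < z1 by rewrite powR_gt0// invr_gt0.
have z20 : 0 < z2 by rewrite powR_gt0.
have z11 : z1 < 1.
  have h : (0 : R) < 1 - s by rewrite subr_gt0.
  have := gt0_ltr_powR h (_ : 2^-1 \in Num.nneg) (_ : 1 \in Num.nneg).
  by rewrite powR1; apply; rewrite ?nnegrE//; lra.
have z21 : z2 < 1.
  rewrite /z2 powRN invf_lt1 ?powR_gt0//.
  have := gt0_ltr_powR s0 (_ : 1 \in Num.nneg) (_ : 2 \in Num.nneg).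
  by rewrite powR1; apply; rewrite ?nnegrE//; lra.
exists (K * 8 ^+ n / (1 - z1) + K * 8 ^+ n / (1 - z2)).
  by rewrite addr_ge0// divr_ge0 ?subr_ge0 ?(ltW z11) ?(ltW z21)// mulr_ge0// exprn_ge0.
move=> x g mg g0 gx near far.
pose a j : R := 2^-1 ^+ j; pose b j : R := 2 ^+ j.
have a0 j : 0 < a j by rewrite exprn_gt0// invr_gt0.
have b0 j : 0 < b j by rewrite exprn_gt0.
(* Bounds for g on the j-th shell inside and outside the unit ball, where the distance to x is
   within a factor 2 of a j, respectively b j. Multiplied by the volumes (4 a j)^n and (8 b j)^n of
   the cubes below, they give K 8^n z1^j and K 8^n z2^j. *)
pose c1 j := K * z1 ^+ j * (2 / a j) ^+ n; pose c2 j := K * z2 ^+ j / b j ^+ n.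
have c10 j : 0 <= c1 j.
  by rewrite !mulr_ge0// exprn_ge0// ?(ltW z10)// divr_ge0// ltW.
have c20 j : 0 <= c2 j.
  by rewrite divr_ge0 ?exprn_ge0 ?(ltW (b0 _))// mulr_ge0// exprn_ge0// ltW.
pose Q1 j : set 'rV[R]_n := cube (x - const_mx (a j)) (4 * a j).
pose Q2 j : set 'rV[R]_n := cube (x - const_mx (2 * b j)) (4 * (2 * b j)).
have mQ1 j : measurable (Q1 j) by exact: measurable_cube.
have mQ2 j : measurable (Q2 j) by exact: measurable_cube.
pose f j y : R := c1 j * \1_(Q1 j) y + c2 j * \1_(Q2 j) y.
have f0 j y : 0 <= f j y by rewrite addr_ge0// mulr_ge0.
have mf j : measurable_fun setT (f j).
  by apply: measurable_funD; apply: measurable_funM => //; exact: measurable_indic.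
have key y : exists j, g y <= f j y.
  have [yx|yx] := eqVneq `|y - x| 0.
    exists 0%N; move/eqP : yx; rewrite normr_eq0 subr_eq0 => /eqP ->.
    by rewrite gx.
  have m0 : 0 < `|y - x| by rewrite lt_neqAle eq_sym yx normr_ge0.
  set m := `|y - x| in yx m0 *.
  have [m1|m1] := ltP m 1.
    have t1 : 1 <= m^-1 by rewrite invf_ge1// ltW.
    have [j /andP[j1 j2]] := dyadic_shell t1; exists j.
    have ma : m <= a j by rewrite /a exprVn -[m]invrK lef_pV2 ?posrE ?invr_gt0 ?exprn_gt0.
    have am : a j / 2 <= m.
      rewrite /a exprVn -invfM -exprSr -[m]invrK lef_pV2 ?posrE ?invr_gt0 ?exprn_gt0//.
      exact: ltW.
    have Qy : Q1 j y by exact: cube_normr.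
    rewrite /f indicE mem_set// mulr1.
    apply: (@le_trans _ _ (c1 j)); last by rewrite lerDl mulr_ge0.
    apply: (le_trans (near y _)); first by rewrite -/m m0 m1.
    rewrite -/m /c1 -mulrA ler_wpM2l//; apply: ler_pM.
    - exact: powR_ge0.
    - by rewrite invr_ge0 exprn_ge0// ltW.
    - have -> : z1 ^+ j = a j `^ (1 - s).
        by rewrite powR_exprn// invr_ge0.
      by apply: ge0_ler_powR; rewrite ?nnegrE ?subr_ge0// ltW.
    - rewrite -exprVn; apply: lerXn2r; rewrite ?nnegrE ?invr_ge0 ?divr_ge0 ?(ltW m0) ?(ltW (a0 j))//.
      by rewrite -[leRHS]invrK invf_div lef_pV2 ?posrE ?divr_gt0.
  have [j /andP[j1 j2]] := dyadic_shell m1; exists j.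
  have Qy : Q2 j y.
    by apply: cube_normr; [rewrite mulr_gt0|rewrite /b -exprS ltW].
  rewrite /f [X in c2 j * X]indicE mem_set// mulr1.
  apply: (@le_trans _ _ (c2 j)); last by rewrite lerDr mulr_ge0.
  apply: (le_trans (far y m1)); rewrite -/m /c2 -mulrA ler_wpM2l//; apply: ler_pM.
  - exact: powR_ge0.
  - by rewrite invr_ge0 exprn_ge0// ltW.
  - have -> : z2 ^+ j = b j `^ (- s).
      by rewrite powR_exprn.
    rewrite !powRN lef_pV2 ?posrE ?powR_gt0//.
    by apply: ge0_ler_powR; rewrite ?nnegrE// ltW.
  - by rewrite lef_pV2 ?posrE ?exprn_gt0// lerXn2r ?nnegrE// ltW.
apply: (@le_trans _ _ (\int[leb]_y (\sum_(j <oo) (f j y)%:E))%E).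
  apply: ge0_le_integral => //.
  - by move=> y _; rewrite lee_fin.
  - exact/measurable_EFinP.
  - apply: ge0_emeasurable_sum => [k y _ _|k _]; first by rewrite lee_fin.
    by apply/measurable_EFinP; exact: mf.
  - move=> y _; have [j gj] := key y.
    apply: (@le_trans _ _ (\sum_(0 <= i < j.+1) (f i y)%:E)%E).
      rewrite big_nat_recr//= sumEFin -EFinD lee_fin.
      by apply: (le_trans gj); rewrite lerDr sumr_ge0.
    by apply: nneseries_lim_ge => i _ _; rewrite lee_fin.
rewrite integral_nneseries//; last 2 first.
- by move=> j; apply/measurable_EFinP; exact: mf.
- by move=> j y _; rewrite lee_fin.
have fI j : (\int[leb]_y (f j y)%:E =
    (K * 8 ^+ n * z1 ^+ j)%:E + (K * 8 ^+ n * z2 ^+ j)%:E)%E.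
  under eq_integral do rewrite EFinD (EFinM (c1 j)) (EFinM (c2 j)).
  have mi (Q : set 'rV[R]_n) : measurable Q ->
      measurable_fun setT (fun y => (\1_Q y : R)%:E).
    by move=> mQ; apply/measurable_EFinP; exact: measurable_indic.
  rewrite ge0_integralD//=; last 4 first.
  - by move=> y _; apply: mule_ge0; rewrite lee_fin.
  - by apply: measurable_funeM; exact: mi.
  - by move=> y _; apply: mule_ge0; rewrite lee_fin.
  - by apply: measurable_funeM; exact: mi.
  rewrite !ge0_integralZl ?lee_fin ?c10 ?c20//; try exact: mi.
  have cubeI z r : 0 <= r ->
      (\int[leb]_y (\1_(cube z r) y)%:E = (r ^+ n)%:E)%E.
    move=> r0; have mzr : measurable (cube z r) by exact: measurable_cube.
    by rewrite integral_indic// setIT; exact: lebesgue_cube.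
  rewrite !cubeI ?mulr_ge0 ?(ltW (a0 j)) ?(ltW (b0 j))// -!EFinM.
  congr (_%:E + _%:E)%E.
    rewrite /c1 (_ : 8 = 2 / a j * (4 * a j)); last by field; rewrite gt_eqF.
    by rewrite [in RHS]exprMn; ring.
  rewrite /c2 (_ : 8 = (b j)^-1 * (4 * (2 * b j))); last by field; rewrite gt_eqF.
  by rewrite [in RHS]exprMn exprVn; ring.
have Kn0 : 0 <= K * 8 ^+ n by rewrite mulr_ge0// exprn_ge0.
rewrite (eq_eseriesr (fun j _ => fI j)) nneseriesD; last 2 first.
- by move=> j _ _; rewrite lee_fin mulr_ge0// exprn_ge0// ltW.
- by move=> j _ _; rewrite lee_fin mulr_ge0// exprn_ge0// ltW.
by rewrite EFinD; apply: leeD; exact: nneseries_geometric_le.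
Qed.

End radial_integral.

Lemma fubini_tonelli_strip d1 d2 (T1 : measurableType d1) (T2 : measurableType d2) (R : realType)
    (m1 : {sigma_finite_measure set T1 -> \bar R}) (m2 : {sigma_finite_measure set T2 -> \bar R})
    (B : set T2) (f : T1 * T2 -> \bar R) :
  measurable B -> measurable_fun setT f -> (forall z, 0 <= f z)%E ->
  (\int[m1 \x m2]_(z in [set: T1] `*` B) f z = \int[m2]_(y in B) \int[m1]_x f (x, y))%E.
Proof.
move=> mB mf f0; have mTB : measurable ([set: T1] `*` B) by exact: measurableX.
rewrite integral_mkcond fubini_tonelli2.
- rewrite [RHS]integral_mkcond; apply: eq_integral => y _.
  rewrite /fubini_G !patchE; case: ifPn => yB.
    by apply: eq_integral => x _; rewrite patchE in_setX/= in_setT yB.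
  by apply: integral0_eq => x _; rewrite patchE in_setX/= (negbTE yB) andbF.
- by apply/(measurable_restrict _ mTB measurableT); exact: measurable_funTS.
- by move=> z; rewrite patchE; case: ifP.
Qed.

(** * A Lipschitz bump with finite energy *)

Section tent.
Context {R : realType} {n : nat}.
Variables (x0 : 'rV[R]_n) (rho : R).
Hypothesis rho0 : 0 < rho.

Definition tent (x : 'rV[R]_n) : R := Num.max 0 (rho - `|x - x0|).

Lemma tent_ge0 x : 0 <= tent x. Proof. by rewrite le_max lexx. Qed.

Lemma tent_le x : tent x <= rho.
Proof. by rewrite ge_max (ltW rho0) lerBlDr lerDl normr_ge0. Qed.

Lemma tent_eq0 x : rho <= `|x - x0| -> tent x = 0.
Proof. by move=> h; rewrite /tent; apply/max_idPl; rewrite subr_le0. Qed.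

Lemma tent_gt0 x : `|x - x0| < rho -> 0 < tent x.
Proof. by move=> h; rewrite lt_max subr_gt0 h orbT. Qed.

Lemma tent_dist_le x y : `|tent x - tent y| <= rho.
Proof.
have := tent_ge0 x; have := tent_ge0 y; have := tent_le x; have := tent_le y.
by move=> ? ? ? ?; rewrite ler_distl; apply/andP; split; lra.
Qed.

Lemma tent_lipschitz x y : `|tent x - tent y| <= `|x - y|.
Proof.
have : `| `|x - x0| - `|y - x0| | <= `|x - y|.
  by apply: (le_trans (ler_dist_dist _ _)); rewrite opprB addrA subrK.
have := normr_ge0 (x - y).
rewrite /tent; set a := `|x - x0|; set b := `|y - x0|; set m := `|x - y| => m0.
rewrite !ler_distl => /andP[? ?].
rewrite /Num.max; case: ltP => ?; case: ltP => ?; apply/andP; split; lra.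
Qed.

Lemma measurable_tent : measurable_fun setT tent.
Proof.
have mn : measurable_fun setT (fun x : 'rV[R]_n => `|x - x0|).
  have c2 : continuous (fun z : 'rV[R]_n * 'rV[R]_n => `|z.1 - x0|).
    by move=> z; apply: cvg_norm; apply: cvgB; [exact: cvg_fst|exact: cvg_cst].
  exact: (measurableT_comp (continuous_measurable_rV2 c2) measurable_diag_rV).
apply: measurable_maxr; first exact: measurable_cst.
by apply: measurable_funB => //; exact: measurable_cst.
Qed.

End tent.

Section nonzero_element.
Context {R : realType} {n : nat}.
Variables (s : R) (p : 'rV[R]_n -> 'rV[R]_n -> R) (Omega : set 'rV[R]_n).
Variables qm qM L : R.

Local Notation leb := (lebesgue_rV R n).
Local Notation leb2 := (lebesgue_rV R n \x lebesgue_rV R n)%E.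

Hypothesis adm : admissible s p Omega qm qM L.

Let s0 : 0 < s. Proof. by case/andP: (adm_s adm). Qed.
Let s1 : s < 1. Proof. by case/andP: (adm_s adm). Qed.
Let p1 x y : 1 < p x y. Proof. exact: lt_le_trans (adm_qm1 adm) (adm_qmp adm x y). Qed.
Let p0 x y : 0 < p x y. Proof. by apply: lt_trans (p1 x y). Qed.

(** For m = |x - y| < 1 the Lipschitz bound gives at most m^((1 - s) p - n), and p > 1 allows p to
    be replaced by 1. The factor (1 + rho)^qM >= 1 lets the bounds for m < 1 and m >= 1 share one
    constant. *)
Lemma tent_gag_near x0 rho x y : 0 < rho -> 0 < `|x - y| < 1 ->
  gag s p (tent x0 rho) (x, y) <= (1 + rho) `^ qM * (`|x - y| `^ (1 - s) / `|x - y| ^+ n).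
Proof.
move=> rho0 /andP[m0 m1]; rewrite /gag -(gagliardo_integrandE adm)/=.
set m := `|x - y| in m0 m1 *.
have K1 : 1 <= (1 + rho) `^ qM.
  rewrite -{1}(powRr0 (1 + rho)); apply: ler_powR; first by rewrite lerDl ltW.
  exact: le_trans (ltW (p0 x y)) (adm_pqM adm x y).
have mn : m <= enorm (x - y) by exact: normr_le_enorm.
apply: (@le_trans _ _ (m `^ (1 - s) / m ^+ n)); last first.
  by rewrite ler_peMl// divr_ge0 ?powR_ge0// exprn_ge0// ltW.
apply: (@le_trans _ _ (m `^ p x y / m `^ (n%:R + s * p x y))).
  apply: ler_pM; rewrite ?powR_ge0 ?invr_ge0 ?powR_ge0//.
    by apply: ge0_ler_powR; rewrite ?nnegrE ?(ltW (p0 _ _)) ?(ltW m0)// tent_lipschitz.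
  rewrite lef_pV2 ?posrE ?powR_gt0 ?(lt_le_trans m0)//.
  by apply: ge0_ler_powR; rewrite ?nnegrE ?enorm_ge0 ?(ltW m0)// addr_ge0// mulr_ge0 ?ltW.
rewrite -powR_mulrn ?(ltW m0)// -!powRN -!powRD ?(gt_eqF m0) ?implybT//.
apply: ger_powR; first by rewrite m0 ltW.
have : 0 <= (1 - s) * (p x y - 1) by rewrite mulr_ge0 ?subr_ge0// ltW.
lra.
Qed.

Lemma tent_gag_far x0 rho x y : 0 < rho -> 1 <= `|x - y| ->
  gag s p (tent x0 rho) (x, y) <= (1 + rho) `^ qM * (`|x - y| `^ (- s) / `|x - y| ^+ n).
Proof.
move=> rho0 m1; rewrite /gag -(gagliardo_integrandE adm)/=.
set m := `|x - y| in m1 *.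
have m0 : 0 < m by exact: lt_le_trans m1.
have mn : m <= enorm (x - y) by exact: normr_le_enorm.
have rho1 : 1 <= 1 + rho by rewrite lerDl ltW.
apply: ler_pM; rewrite ?powR_ge0 ?invr_ge0 ?powR_ge0//.
  apply: (@le_trans _ _ ((1 + rho) `^ p x y)); last by apply: ler_powR => //; exact: (adm_pqM adm).
  have rho10 : 0 <= 1 + rho := le_trans ler01 rho1.
  apply: ge0_ler_powR; rewrite ?nnegrE ?(ltW (p0 _ _))//.
  by rewrite (le_trans (tent_dist_le x0 rho0 x y))// lerDr.
apply: (@le_trans _ _ (m `^ (n%:R + s * p x y))^-1).
  rewrite lef_pV2 ?posrE ?powR_gt0 ?(lt_le_trans m0)//.
  by apply: ge0_ler_powR; rewrite ?nnegrE ?enorm_ge0 ?(ltW m0)// addr_ge0// mulr_ge0 ?ltW.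
rewrite -powR_mulrn ?(ltW m0)// -!powRN -!powRD ?(gt_eqF m0) ?implybT//.
apply: ler_powR => //.
have : 0 <= s * (p x y - 1) by rewrite mulr_ge0 ?subr_ge0// ltW.
lra.
Qed.

Lemma gag_diag u x : gag s p u (x, x) = 0.
Proof. by rewrite /gag /nabla_s/= subrr mul0r normr0 powR0 ?mul0r// gt_eqF. Qed.

(** The integrand vanishes unless x or y lies in the cube S carrying the tent, so the energy is at
    most the sum over two strips. In each of them the integral over the free variable is at most the
    constant A of the radial estimate, and S has finite measure. *)
Lemma tent_energy x0 rho : 0 < rho -> (energy s p (tent x0 rho) < +oo)%E.
Proof.
move=> rho0; set u := tent x0 rho.
have mu : measurable_fun setT u by exact: measurable_tent.
have mg := measurable_gag adm mu.
have [A A0 AP] := @radial_integral_bound R n s ((1 + rho) `^ qM) s0 s1 (powR_ge0 _ _).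
have Gx x : (\int[leb]_y (gag s p u (x, y))%:E <= A%:E)%E.
  apply: (AP x (fun y => gag s p u (x, y))).
  - exact: measurable_fun_pair2.
  - by move=> y; exact: gag_ge0.
  - exact: gag_diag.
  - by move=> y; rewrite distrC; exact: tent_gag_near.
  - by move=> y; rewrite distrC; exact: tent_gag_far.
have Gy y : (\int[leb]_x (gag s p u (x, y))%:E <= A%:E)%E.
  apply: (AP y (fun x => gag s p u (x, y))).
  - exact: measurable_fun_pair1.
  - by move=> x; exact: gag_ge0.
  - exact: gag_diag.
  - by move=> x; exact: tent_gag_near.
  - by move=> x; exact: tent_gag_far.
pose S : set 'rV[R]_n := cube (x0 - const_mx rho) (4 * rho).
have mS : measurable S by exact: measurable_cube.
have SE : leb S = ((4 * rho) ^+ n)%:E by apply: lebesgue_cube; rewrite mulr_ge0// ltW.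
have uS x : ~ S x -> u x = 0.
  move=> nS; apply: tent_eq0; rewrite leNgt; apply/negP => h; apply: nS.
  by apply: cube_normr => //; exact: ltW.
have mEg : measurable_fun setT (fun z => (gag s p u z)%:E) by exact/measurable_EFinP.
have Eg0 z : (0 <= (gag s p u z)%:E)%E by rewrite lee_fin gag_ge0.
have mST : measurable (S `*` [set: 'rV[R]_n]) by exact: measurableX.
have mTS : measurable ([set: 'rV[R]_n] `*` S) by exact: measurableX.
have bd (f : 'rV[R]_n -> \bar R) : measurable_fun setT f -> (forall x, 0 <= f x)%E ->
    (forall x, f x <= A%:E)%E -> (\int[leb]_(x in S) f x <= (A * (4 * rho) ^+ n)%:E)%E.
  move=> mf f0 fA; rewrite EFinM -SE -integral_cst//.
  apply: ge0_le_integral => //; exact: measurable_funTS.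
have h1 : (\int[leb2]_(z in S `*` [set: 'rV[R]_n]) (gag s p u z)%:E <= (A * (4 * rho) ^+ n)%:E)%E.
  rewrite (fubini_tonelli_rectangle leb leb mS measurableT mEg Eg0).
  apply: (bd _ (measurable_fun_section_integral leb measurableT mEg Eg0) _ Gx).
  by move=> x; apply: integral_ge0 => y _; exact: Eg0.
have h2 : (\int[leb2]_(z in [set: 'rV[R]_n] `*` S) (gag s p u z)%:E <= (A * (4 * rho) ^+ n)%:E)%E.
  rewrite (fubini_tonelli_strip leb leb mS mEg Eg0).
  apply: (bd _ (measurable_fun_fubini_tonelli_G _ mEg Eg0) _ Gy).
  by move=> x; apply: integral_ge0 => y _; exact: Eg0.
apply: (le_lt_trans _ (_ : (A * (4 * rho) ^+ n + A * (4 * rho) ^+ n)%:E < +oo)%E); last exact: ltry.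
rewrite EFinD; apply: (le_trans _ (leeD h1 h2)).
rewrite (integral_mkcond (S `*` _)) (integral_mkcond (_ `*` S)) -ge0_integralD//; last 4 first.
- by move=> z _; rewrite patchE; case: ifP.
- by apply/(measurable_restrict _ mST measurableT); exact: measurable_funTS.
- by move=> z _; rewrite patchE; case: ifP.
- by apply/(measurable_restrict _ mTS measurableT); exact: measurable_funTS.
apply: ge0_le_integral => //.
- apply: emeasurable_funD.
    by apply/(measurable_restrict _ mST measurableT); exact: measurable_funTS.
  by apply/(measurable_restrict _ mTS measurableT); exact: measurable_funTS.
- move=> [x y] _; rewrite !patchE !in_setX/= !in_setT/= andbT.
  case: ifPn => [xS|xS]; case: ifPn => [yS|yS]; rewrite ?adde0 ?add0e//.
    by rewrite -[leLHS]adde0 leeD2l.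
  rewrite /gag /nabla_s/= uS; last by move/mem_set; apply/negP.
  rewrite uS; last by move/mem_set; apply/negP.
  by rewrite subrr mul0r normr0 powR0 ?mul0r// gt_eqF.
Qed.

Lemma exists_spaceX_nonzero : exists u, spaceX_nonzero s p Omega u.
Proof.
have [x0 Ox0] := adm_nonempty adm.
have /nbhs_ballP[rho /= rho0 rhoO] : nbhs x0 Omega by apply: open_nbhs_nbhs; split => //; exact: (adm_open adm).
pose u := tent x0 rho; exists u.
have mu : measurable_fun setT u by exact: measurable_tent.
have uO x : ~ Omega x -> u x = 0.
  move=> nO; apply: tent_eq0; rewrite leNgt; apply/negP => h; apply: nO; apply: rhoO.
  split=> // i j; rewrite /ball/= ord1 distrC; apply: le_lt_trans h.
  by have := normr_coord_le (x - x0) j; rewrite !mxE.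
have OC x : Omega x -> @bigcube R n L x by move=> Ox; exact: (Omega_bigcube adm Ox).
have mC : measurable (@bigcube R n L) by exact: measurable_cube.
have L20 : 0 <= 2 * L by rewrite mulr_ge0// (le_trans _ (adm_L adm)).
have CE : leb (@bigcube R n L) = ((2 * L) ^+ n)%:E by exact: lebesgue_cube.
have mup : measurable_fun setT (fun x => `|u x| `^ pbar p x).
  by apply: measurable_normr_powR => //; exact: (measurable_pbar adm).
split; last first.
  move=> [Z [mZ Z0 uZ]].
  have : leb (cube x0 (rho / 2)) = ((rho / 2) ^+ n)%:E by apply: lebesgue_cube; rewrite divr_ge0// ltW.
  have : (leb (cube x0 (rho / 2)) <= leb Z)%E.
    apply: le_measure; rewrite ?inE//; first exact: measurable_cube.
    move=> x /cubeP xc; apply: uZ => /= ux.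
    have : 0 < u x.
      apply: tent_gt0; rewrite [ltLHS]mx_normrE; apply: bigmax_lt => // -[i j] _ /=.
      rewrite !ord1 !mxE; have /andP[? ?] := xc j.
      by rewrite ltr_distl; apply/andP; split; lra.
    by rewrite ux ltxx.
  move=> h CE'.
  have : (((rho / 2) ^+ n)%:E <= (0 : R)%:E)%E.
    rewrite -CE'; apply: (le_trans h); rewrite le_eqVlt; apply/orP; left.
    by apply/eqP; exact: Z0.
  by rewrite lee_fin leNgt exprn_gt0 ?divr_gt0.
apply/(spaceXP adm); split.
- split=> //; under eq_integral do rewrite divr1.
  pose c := (1 + rho) `^ qM.
  suff le : (\int[leb]_x (`|u x| `^ pbar p x)%:E <=
      \int[leb]_(x in @bigcube R n L) c%:E)%E.
    apply: (le_lt_trans le); rewrite (_ : integral _ _ _ = (c * (2 * L) ^+ n)%:E) ?ltry//.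
    by rewrite integral_cst// EFinM; congr (_ * _)%E; exact: CE.
  rewrite [leRHS]integral_mkcond; apply: ge0_le_integral => //.
  + exact/measurable_EFinP.
  + by apply/(measurable_restrict _ mC measurableT); exact: measurable_cst.
  + move=> x _; rewrite patchE; case: ifPn => xC.
      rewrite lee_fin; apply: (@le_trans _ _ ((1 + rho) `^ pbar p x)); last first.
        by apply: ler_powR; [rewrite lerDl ltW|exact: (adm_pqM adm)].
      rewrite ge0_ler_powR ?nnegrE ?addr_ge0 ?(ltW rho0) ?(ltW (p0 _ _))//.
      rewrite ger0_norm ?tent_ge0// (le_trans (tent_le x0 rho0 x))//.
      by rewrite lerDr.
    rewrite uO ?normr0 ?powR0 ?gt_eqF ?p0// => Ox; move/negP: xC; apply; rewrite inE; exact: OC.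
- split; first exact: measurable_nabla_s.
  exact: tent_energy.
- by apply: aeW => x; exact: uO.
Qed.

End nonzero_element.

(** * Existence of a minimizer *)

Section fatou.
Context d (T : measurableType d) (R : realType).
Variables (mu : {measure set T -> \bar R}) (D : set T) (q v : T -> R).
Hypotheses (mD : measurable D) (mq : measurable_fun setT q) (q0 : forall x, 0 < q x).
Hypotheses (mv : measurable_fun setT v) (v0 : forall x, 0 <= v x).

Lemma normr_powR_continuous (r : R) : 0 < r -> continuous (fun a : R => `|a| `^ r).
Proof.
move=> r0 a; have [->|a0] := eqVneq a 0; last first.
  apply: (@cvg_comp _ _ _ (fun x : R => `|x|) (@powR R ^~ r) _ (nbhs `|a|)).
    exact: norm_continuous.
  by apply: powR_continuous; rewrite normr_gt0.
rewrite /continuous_at normr0 powR0 ?gt_eqF//; apply/cvgrPdist_lt => e e0.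
near=> x; rewrite sub0r normrN ger0_norm ?powR_ge0//.
have -> : e = (e `^ r^-1) `^ r by rewrite -powRrM mulVf ?powRr1 ?gt_eqF// ltW.
rewrite gt0_ltr_powR// ?nnegrE ?powR_ge0//.
near: x; apply/nbhs_ballP; exists (e `^ r^-1) => /=; first exact: powR_gt0.
by move=> y; rewrite /ball/= sub0r normrN.
Unshelve. all: by end_near. Qed.

(** The weight v is kept general: it is 1 or |x - y|^n when the limit is shown to lie in X, and p |x
    - y|^n for the norm K. *)
Lemma modular_fatou (f_ : (T -> R)^nat) (f : T -> R) (c : R) :
  (forall m, measurable_fun setT (f_ m)) -> measurable_fun setT f ->
  {ae mu, forall x, D x -> f_ m x @[m --> \oo] --> f x} ->
  (forall m, \int[mu]_(x in D) (`|f_ m x| `^ q x / v x)%:E <= c%:E)%E ->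
  (\int[mu]_(x in D) (`|f x| `^ q x / v x)%:E <= c%:E)%E.
Proof.
move=> mf_ mf f_f f_c.
have mF (g : T -> R) : measurable_fun setT g -> measurable_fun D (fun x => (`|g x| `^ q x / v x)%:E).
  move=> mg; apply/measurable_EFinP; apply: measurable_funTS; apply: measurable_funM.
    exact: measurable_normr_powR.
  exact: measurable_funV.
have F0 (g : T -> R) x : (0 <= (`|g x| `^ q x / v x)%:E)%E.
  by rewrite lee_fin mulr_ge0 ?powR_ge0// invr_ge0.
have fatou_le := fatou mu mD (fun m => mF _ (mf_ m)) (fun m x _ => F0 (f_ m) x).
have limE : {ae mu, forall x, D x -> (`|f x| `^ q x / v x)%:E =
    limn_einf (fun m => (`|f_ m x| `^ q x / v x)%:E)}.
  apply: filterS f_f => x /[apply] fx.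
  have cv : (`|f_ m x| `^ q x / v x)%:E @[m --> \oo] --> (`|f x| `^ q x / v x)%:E.
    apply: cvg_EFin; first exact: nearW.
    apply: cvgMl; exact: (cvg_comp _ _ fx (@normr_powR_continuous (q x) (q0 x) (f x))).
  by rewrite is_cvg_limn_einfE; [exact/esym/cvg_lim|exact: cvgP cv].
have -> : (\int[mu]_(x in D) (`|f x| `^ q x / v x)%:E =
    \int[mu]_(x in D) limn_einf (fun m => (`|f_ m x| `^ q x / v x)%:E))%E.
  apply: ae_eq_integral => //; first exact: mF.
  rewrite /limn_einf; apply: measurableT_comp => //.
  apply: measurable_fun_limn_esup => m; apply: measurableT_comp => //.
  exact: mF.
apply: (le_trans fatou_le); rewrite limn_einf_lim.
apply: lime_le; first exact: is_cvg_einfs.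
apply: nearW => m; apply: (le_trans _ (f_c m)).
by apply: ereal_inf_lbound; exists m => /=.
Qed.

End fatou.

Lemma ae_prod_coordinates d (T : measurableType d) (R : realType)
    (mu : {sigma_finite_measure set T -> \bar R}) (P : T -> Prop) :
  {ae mu, forall x, P x} -> {ae (mu \x mu)%E, forall z, P z.1 /\ P z.2}.
Proof.
move=> [N [mN N0 PN]].
have mNT : measurable (N `*` [set: T]) by exact: measurableX.
have mTN : measurable ([set: T] `*` N) by exact: measurableX.
have e1 : (mu \x mu)%E (N `*` [set: T]) = 0%E.
  by rewrite product_measure1E// [X in (X * _)%E](_ : _ = 0%E) ?mul0e.
have e2 : (mu \x mu)%E ([set: T] `*` N) = 0%E.
  by rewrite product_measure1E// [X in (_ * X)%E](_ : _ = 0%E) ?mule0.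
exists (N `*` [set: T] `|` [set: T] `*` N); split.
- exact: measurableU.
- exact: (null_set_setU mNT mTN e1 e2).
- move=> [x y] /= /not_andP[h|h]; [left|right]; split => //; exact: PN.
Qed.

Section existence.
Context {R : realType} {n : nat}.
Variables (s : R) (p : 'rV[R]_n -> 'rV[R]_n -> R) (Omega : set 'rV[R]_n).
Variables qm qM L : R.
Implicit Types (u v : 'rV[R]_n -> R) (z : 'rV[R]_n * 'rV[R]_n).

Local Notation leb := (lebesgue_rV R n).
Local Notation leb2 := (lebesgue_rV R n \x lebesgue_rV R n)%E.
Local Notation p2 := (fun z : 'rV[R]_n * 'rV[R]_n => p z.1 z.2).
Local Notation wK := (fun z : 'rV[R]_n * 'rV[R]_n => enorm (z.1 - z.2) ^+ n).
Local Notation w1 := (fun _ : 'rV[R]_n => 1 : R).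
Local Notation Lambda1 := (Lambda1 s p Omega).

Hypothesis adm : admissible s p Omega qm qM L.

Let mp : measurable_fun setT p2 := continuous_measurable_rV2 (adm_cont adm).
Let mO : measurable Omega := open_measurable_rV (adm_open adm).
Let qm1 := adm_qm1 adm.
Let qmp2 z : qm <= p2 z. Proof. exact: (adm_qmp adm). Qed.
Let p2qM z : p2 z <= qM. Proof. exact: (adm_pqM adm). Qed.
Let p20 z : 0 < p2 z. Proof. by apply: lt_le_trans (qmp2 z); exact: lt_trans qm1. Qed.
Let qmpbar x : qm <= pbar p x. Proof. exact: (adm_qmp adm). Qed.
Let pbarqM x : pbar p x <= qM. Proof. exact: (adm_pqM adm). Qed.
Let pb1 x : 1 < pbar p x. Proof. exact: lt_le_trans (qmpbar x). Qed.
Let pb0 x : 0 < pbar p x. Proof. exact: lt_trans (pb1 x). Qed.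
Let mpbar := measurable_pbar adm.
Let mw1 : measurable_fun setT w1. Proof. exact: measurable_cst. Qed.
Let w10 x : 0 <= w1 x. Proof. exact: ler01. Qed.
Let qM1 : 1 <= qM. Proof. exact: le_trans (ltW qm1) (le_trans (qmpbar 0) (pbarqM 0)). Qed.

Lemma normK_pos u : spaceX_nonzero s p Omega u -> 0 < normK s p u.
Proof. exact: (normK_nonzero adm (fun u => @modK_gt0 _ _ _ _ _ _ _ _ adm u)). Qed.

Lemma normk_pos u : spaceX_nonzero s p Omega u -> 0 < normk p Omega u.
Proof. exact: (normk_nonzero adm). Qed.

Lemma minimizing_sequence : exists u_ : nat -> 'rV[R]_n -> R,
  [/\ forall j, spaceX s p Omega (u_ j), forall j, modk p Omega (u_ j) = 1,
      forall j, 0 < normK s p (u_ j) & forall j, normK s p (u_ j) < Lambda1 + j.+1%:R^-1].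
Proof.
pose E := [set normK s p v / normk p Omega v | v in spaceX_nonzero s p Omega].
have hE : has_inf E.
  split; first by have [v Xv] := exists_spaceX_nonzero adm; exists (normK s p v / normk p Omega v); exists v.
  by exists 0 => _ [v Xv <-]; rewrite divr_ge0// ltW ?normK_pos ?normk_pos.
have h j : exists v, spaceX_nonzero s p Omega v /\
    normK s p v / normk p Omega v < Lambda1 + j.+1%:R^-1.
  have j0 : 0 < j.+1%:R^-1 :> R by rewrite invr_gt0.
  by have [_ [v Xv <-] vj] := inf_adherent j0 hE; exists v.
have [v_ vP] := choice h.
have Xv j : spaceX s p Omega (v_ j) := (vP j).1.1.
have k0 j := normk_pos (vP j).1; have K0 j := normK_pos (vP j).1.
exists (fun j x => (normk p Omega (v_ j))^-1 * v_ j x).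
have Ke j : normK s p (fun x => (normk p Omega (v_ j))^-1 * v_ j x) =
    (normk p Omega (v_ j))^-1 * normK s p (v_ j).
  by apply: (normKZ adm (Xv j)); rewrite invr_gt0.
split=> j.
- exact: (spaceXZ adm).
- exact: (modk_normk adm (Xv j) (k0 j)).
- by rewrite Ke mulr_gt0// invr_gt0.
- by rewrite Ke mulrC; exact: (vP j).2.
Qed.

(** Write u = k v with [modK] v = 1 and scale: the modular of u is at most k if k <= 1, and at most
    k^qM otherwise. *)
Lemma modK_le_normK u c : spaceX s p Omega u -> 0 < normK s p u -> normK s p u <= c -> 1 <= c ->
  modK s p u <= c `^ qM.
Proof.
move=> Xu; set k := normK s p u => K0 Kc c1.
pose v x := k^-1 * u x; have Xv : spaceX s p Omega v by exact: (spaceXZ adm).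
have v1 : modK s p v = 1 by exact: (modK_normK adm Xu K0).
have uE : u = (fun x => k * v x).
  by apply/funext => x; rewrite /v mulrA divff ?mul1r// gt_eqF.
have -> : modK s p u = modular leb2 setT p2 wK (fun z => k * nabla_s s v z).
  by rewrite /modK {1}uE nabla_sZ.
have [k1|k1] := leP k 1.
  have := modularZ_le1 measurableT mp measurable_wK (@wK_ge0 _ _) qm1 qmp2 p2qM
    (spaceX_finite_modularK adm Xv) (introT andP (conj K0 k1)).
  rewrite -/(modK s p v) v1 mulr1 => h; apply: (le_trans h); apply: (le_trans k1).
  by rewrite -(powRr0 c); apply: ler_powR => //; exact: le_trans qM1.
have /andP[_] := modularZ_le measurableT mp measurable_wK (@wK_ge0 _ _) qm1 qmp2 p2qM
  (spaceX_finite_modularK adm Xv) (ltW k1).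
rewrite -/(modK s p v) v1 mulr1 => h; apply: (le_trans h).
have c0 : 0 <= c := le_trans ler01 c1; have k0 := ltW K0.
have qM0 : 0 <= qM := le_trans ler01 qM1.
by apply: ge0_ler_powR; rewrite ?nnegrE.
Qed.

(** Fatou's lemma only gives a modular <= 1, while [normK] is defined with < 1. If K(u) were above
    l, passing from scale l to K(u) would bring the modular strictly below 1, whereas it equals 1
    there. *)
Lemma normK_le_of_modK u l : spaceX s p Omega u -> 0 < l ->
  modK s p (fun x => l^-1 * u x) <= 1 -> normK s p u <= l.
Proof.
move=> Xu l0 m1; rewrite leNgt; apply/negP; set k := normK s p u => lk.
have k0 : 0 < k by exact: lt_trans lk.
have := modK_normK adm Xu k0; rewrite -/k => k1.
have Xlu := spaceXZ adm l^-1 Xu.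
have lk01 : 0 < l / k <= 1 by rewrite divr_gt0//= ler_pdivrMr// mul1r ltW.
have := modularZ_le1 measurableT mp measurable_wK (@wK_ge0 _ _) qm1 qmp2 p2qM
  (spaceX_finite_modularK adm Xlu) lk01.
rewrite -nabla_sZ -/(modK _ _ _) -/(modK s p (fun x => l^-1 * u x)).
rewrite (_ : (fun x => l / k * _) = (fun x => k^-1 * u x)); last first.
  by apply/funext => x; field; rewrite !gt_eqF.
rewrite k1; apply/negP; rewrite -ltNge.
have /andP[lk0 _] := lk01.
apply: (@le_lt_trans _ _ (l / k)); first by rewrite ler_piMr// ltW.
by rewrite ltr_pdivrMr// mul1r.
Qed.

Lemma EFin_modK u : spaceX s p Omega u ->
  (modK s p u)%:E = (\int[leb2]_z (`|nabla_s s u z| `^ p2 z / (p2 z * wK z))%:E)%E.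
Proof.
move=> Xu; exact: (EFin_modular measurableT mp measurable_wK (@wK_ge0 _ _) qm1 qmp2
  (spaceX_finite_modularK adm Xu)).
Qed.

Lemma EFin_modk u : spaceX s p Omega u ->
  (modk p Omega u)%:E = (\int[leb]_(x in Omega) (`|u x| `^ pbar p x / (pbar p x * 1))%:E)%E.
Proof.
move=> Xu; exact: (EFin_modular mO mpbar mw1 w10 qm1 qmpbar (spaceX_finite_modular adm Xu)).
Qed.

Lemma measurable_pmwK : measurable_fun setT (fun z => p2 z * wK z).
Proof. by apply: measurable_funM => //; exact: measurable_wK. Qed.

Lemma pmwK_ge0 z : 0 <= p2 z * wK z.
Proof. by rewrite mulr_ge0 ?wK_ge0// ltW. Qed.

Section limit.
Variables (U : nat -> 'rV[R]_n -> R) (u : 'rV[R]_n -> R) (E0 : R).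
Hypotheses (XU : forall m, spaceX s p Omega (U m)) (mu : measurable_fun setT u).
Hypotheses (UE : forall m, dmodK s p (U m) (U m) <= E0) (Uk : forall m, modk p Omega (U m) = 1).
Hypothesis (Uu : {ae leb, forall x, U m x @[m --> \oo] --> u x}).

Let nablaU : {ae leb2, forall z, setT z -> nabla_s s (U m) z @[m --> \oo] --> nabla_s s u z}.
Proof.
apply: filterS (ae_prod_coordinates Uu) => z [z1 z2] _.
by apply: cvgMl; apply: cvgB.
Qed.

Lemma limit_modK_le l : 0 < l ->
  (\forall m \near \oo, modK s p (fun x => l^-1 * U m x) <= 1) ->
  (\int[leb2]_z (`|nabla_s s (fun x => (l^-1 * u x)%R) z| `^ p2 z / (p2 z * wK z))%:E <= 1%:E)%E.
Proof.
(* The bound holds only from m0 on, so the sequence is shifted by m0 before Fatou's lemma is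
   applied. *)
move=> l0 [m0 _ h].
apply: (modular_fatou measurableT mp p20 measurable_pmwK pmwK_ge0
  (f_ := fun m => nabla_s s (fun x => l^-1 * U (m + m0)%N x))).
- move=> m; apply: measurable_nabla_s; apply: measurable_funM => //.
  exact: (spaceX_measurable adm (XU _)).
- by apply: measurable_nabla_s; exact: measurable_funM.
- apply: filterS nablaU => z h1 zT; have zc := h1 zT; rewrite nabla_sZ.
  under eq_fun do rewrite nabla_sZ.
  apply: cvgMr; move: zc; rewrite -(cvg_shiftn m0); exact.
- move=> m; rewrite -EFin_modK; last exact: (spaceXZ adm).
  by rewrite lee_fin; apply: h => /=; rewrite leq_addl.
Qed.

Lemma limit_spaceX : spaceX s p Omega u.
Proof.
have u0 : {ae leb, forall x, (~` Omega) x -> u x = 0}.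
  have U0 : {ae leb, forall x, forall m, (~` Omega) x -> U m x = 0}.
    by apply/ae_foralln => m; exact: (spaceX_ae0 adm (XU m)).
  apply: filterS2 U0 Uu => x Ux0 cx Ox.
  have e : (fun m => U m x) = fun=> 0 by apply/funext => m; exact: Ux0.
  by rewrite e in cx; apply: (cvg_unique _ cx); [exact: Rhausdorff|exact: cvg_cst].
apply/(spaceXP adm); split => //.
  split=> //.
  (* qM bounds the integral without the weight 1 / pbar because the weighted one, [modk], equals
     1. *)
  apply: (le_lt_trans (_ : _ <= qM%:E)%E); last exact: ltry.
  apply: (modular_fatou measurableT mpbar pb0 mw1 w10 (f_ := U)) => //.
  - by move=> m; exact: (spaceX_measurable adm (XU m)).
  - by apply: filterS Uu.
  move=> m; have mUm := spaceX_measurable adm (XU m).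
  have mUp : measurable_fun setT (fun x => (`|U m x| `^ pbar p x / 1)%:E).
    by apply/measurable_EFinP; exact: measurable_modular_integrand.
  have F0 x : (0 <= (`|U m x| `^ pbar p x / 1)%:E)%E by rewrite lee_fin divr_ge0 ?powR_ge0.
  have -> : (\int[leb]_x (`|U m x| `^ pbar p x / 1)%:E =
      \int[leb]_(x in Omega) (`|U m x| `^ pbar p x / 1)%:E)%E.
    rewrite [RHS]integral_mkcond; apply: ge0_ae_eq_integral => //.
    - by apply/(measurable_restrict _ mO measurableT); exact: measurable_funTS.
    - by move=> x _; rewrite patchE; case: ifP.
    apply: filterS (spaceX_ae0 adm (XU m)) => x Ux _; rewrite patchE; case: ifPn => //.
    by move=> /negP xO; rewrite Ux ?normr0 ?powR0 ?mul0r ?gt_eqF// => Ox; apply: xO; rewrite inE.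
  have fU := spaceX_finite_modular adm (XU m).
  have /andP[_] := modular_le_dmodular mO mpbar mw1 w10 qm1 qmpbar pbarqM fU.
  have := Uk m; rewrite /modk => ->; rewrite mulr1 (dmodular_diag leb Omega w1 qm1 qmpbar).
  have fi := finite_modular_integrable mpbar mw1 w10 fU.
  by rewrite -lee_fin fineK//; exact: integrable_fin_num fi.
split; first exact: measurable_nabla_s.
apply: (le_lt_trans (_ : _ <= E0%:E)%E); last exact: ltry.
apply: (modular_fatou measurableT mp p20 measurable_wK (@wK_ge0 _ _)
  (f_ := fun m => nabla_s s (U m))) => //.
- by move=> m; apply: measurable_nabla_s; exact: (spaceX_measurable adm (XU m)).
- exact: measurable_nabla_s.
- by move=> m; have := energyE adm (XU m); rewrite /energy /gag => ->; rewrite lee_fin.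
Qed.

End limit.
End existence.

(** * The constraint is not lost in the limit *)

Section lower_bound.
Context {R : realType} {n : nat}.
Variables (s : R) (p : 'rV[R]_n -> 'rV[R]_n -> R) (Omega : set 'rV[R]_n).
Variables qm qM L : R.

Local Notation leb := (lebesgue_rV R n).

Hypothesis adm : admissible s p Omega qm qM L.

Let s0 : 0 < s. Proof. by case/andP: (adm_s adm). Qed.
Let n0' : 0 < n%:R :> R. Proof. by rewrite ltr0n (adm_n adm). Qed.
Let mO : measurable Omega := open_measurable_rV (adm_open adm).
Let qm1 := adm_qm1 adm.
Let pb1 x : 1 < pbar p x. Proof. exact: lt_le_trans qm1 (adm_qmp adm x x). Qed.
Let pb0 x : 0 < pbar p x. Proof. exact: lt_trans (pb1 x). Qed.
Let pbarqM x : pbar p x <= qM. Proof. exact: (adm_pqM adm). Qed.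
Let mpbar := measurable_pbar adm.

Variables (U : nat -> 'rV[R]_n -> R) (u : 'rV[R]_n -> R) (E0 : R).
Hypotheses (XU : forall m, spaceX s p Omega (U m)) (Xu : spaceX s p Omega u).
Hypotheses (UE : forall m, dmodK s p (U m) (U m) <= E0) (Uk : forall m, modk p Omega (U m) = 1).
Hypothesis (Uu : {ae leb, forall x, U m x @[m --> \oo] --> u x}).

Let mU m : measurable_fun setT (U m). Proof. exact: (spaceX_measurable adm (XU m)). Qed.
Let mu : measurable_fun setT u. Proof. exact: (spaceX_measurable adm Xu). Qed.

(** The density of [modk] with |v| cut off at M. For M >= 1 it is at most M^qM, and Omega has finite
    measure, so that its integral passes to the limit by dominated convergence. *)
Let trunc (M : R) (v : 'rV[R]_n -> R) x : R := Num.min `|v x| M `^ pbar p x / pbar p x.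

Let measurable_trunc M v : measurable_fun setT v -> measurable_fun setT (trunc M v).
Proof.
move=> mv; apply: measurable_funM.
  apply: measurable_fun_powR2 => //; apply: measurable_minr; last exact: measurable_cst.
  exact: measurableT_comp.
by apply: measurable_funV => // x; exact: ltW.
Qed.

Let mden : measurable_fun setT (fun x => (pbar p x * 1)^-1).
Proof.
under eq_fun do rewrite mulr1.
by apply: measurable_funV => // x; exact: ltW.
Qed.

Let trunc_ge0 M v x : 0 <= trunc M v x.
Proof. by rewrite divr_ge0 ?powR_ge0// ltW. Qed.

Let Omega_fin : (leb Omega <= ((2 * L) ^+ n)%:E)%E.
Proof.
have L20 : 0 <= 2 * L by rewrite mulr_ge0// (le_trans _ (adm_L adm)).
have CE : leb (@bigcube R n L) = ((2 * L) ^+ n)%:E by exact: lebesgue_cube.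
rewrite -CE; apply: le_measure; rewrite ?inE//; first exact: measurable_cube.
exact: (Omega_bigcube adm).
Qed.

Let trunc_cvg M : 1 <= M ->
  (\int[leb]_(x in Omega) (trunc M (U m) x)%:E)%E @[m --> \oo] -->
  (\int[leb]_(x in Omega) (trunc M u x)%:E)%E.
Proof.
move=> M1; have M0 : 0 <= M by exact: le_trans M1.
have mT v : measurable_fun setT v -> measurable_fun Omega (EFin \o trunc M v).
  by move=> mv; apply/measurable_EFinP; apply: measurable_funTS; exact: measurable_trunc.
have cv : {ae leb, forall x, Omega x ->
    (EFin \o trunc M (U m)) x @[m --> \oo] --> (EFin \o trunc M u) x}.
  apply: filterS Uu => x Ux _ /=; apply: cvg_EFin; first exact: nearW.
  apply: cvgMl.
  have e v : Num.min `|v x| M `^ pbar p x = `|Num.min `|v x| M| `^ pbar p x.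
    by rewrite [in RHS]ger0_norm// le_min normr_ge0.
  rewrite e; under eq_fun do rewrite e.
  have cm : {for u x, continuous ((fun r : R => `|r| : R^o) \min (fun=> M : R^o))}.
    by apply: continuous_min; [exact: norm_continuous|exact: cvg_cst].
  have cF : {for u x, continuous (fun r : R => `|Num.min `|r| M| `^ pbar p x)}.
    exact: (continuous_comp cm (@normr_powR_continuous R (pbar p x) (pb0 x) _)).
  exact: (cvg_comp _ _ Ux cF).
have iM : leb.-integrable Omega (EFin \o cst (M `^ qM)).
  apply: integrable_cst_fin => //; apply: (le_lt_trans Omega_fin).
  exact: ltry.
have bd : {ae leb, forall x m, Omega x ->
    (`|(EFin \o trunc M (U m)) x| <= (EFin \o cst (M `^ qM)%R) x)%E}.
  apply: aeW => x m _ /=; rewrite lee_fin ger0_norm//.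
  rewrite ler_pdivrMr//; apply: (@le_trans _ _ (M `^ qM)).
    apply: (@le_trans _ _ (M `^ pbar p x)); last exact: ler_powR.
    by apply: ge0_ler_powR; rewrite ?nnegrE ?(ltW (pb0 _))// ?le_min ?normr_ge0 ?M0// ge_min lexx orbT.
  by rewrite ler_peMr ?powR_ge0// ltW.
by have [_ _] := dominated_convergence mO (fun m => mT _ (mU m)) (mT _ mu) cv iM bd.
Qed.

(** For M >= M0 the part of [modk] (U m) where |U m| > M is at most M^(- del) C' by higher
    integrability, uniformly in m, and the truncated part converges. So 1 <= [modk] u + M^(- del) C'
    for all large M. *)
Lemma limit_modk_ge1 : 1 <= modk p Omega u.
Proof.
have E00 : 0 <= E0.
  by apply: le_trans (UE 0); rewrite -lee_fin -(energyE adm (XU 0)); exact: energy_ge0.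
have [C1 C10 L1] := L1_energy_bound adm.
pose B := C1 * (1 + E0) + 1.
have B0 : 0 < B by rewrite ltr_wpDl// mulr_ge0// addr_ge0.
have UB m : (\int[leb]_x `|U m x|%:E <= B%:E)%E.
  apply: (le_trans (L1 _ (XU m))); rewrite (energyE adm (XU m)) -EFinD -EFinM lee_fin /B.
  by rewrite -[leLHS]addr0 lerD// ler_wpM2l// lerD2l.
have [M0 [C [M01 C0 hp]]] := pointwise_higher_power adm B0.
pose del := s / (2 * n%:R); have del0 : 0 < del by rewrite divr_gt0// mulr_gt0.
pose C' := C * ((2 * L) ^+ n + E0).
have L20 : 0 <= 2 * L by rewrite mulr_ge0// (le_trans _ (adm_L adm)).
have C'0 : 0 <= C' by rewrite mulr_ge0// addr_ge0// exprn_ge0.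
have key M : M0 <= M -> 1 <= modk p Omega u + M `^ (- del) * C'.
  move=> M0M; have M1 : 1 <= M by exact: le_trans M0M.
  have M0' : 0 < M by exact: lt_le_trans M1.
  pose c := M `^ (- del) * C; have c0 : 0 <= c by rewrite mulr_ge0 ?powR_ge0.
  have step m : (1%:E - (M `^ (- del) * C')%:E <=
      \int[leb]_(x in Omega) (trunc M (U m) x)%:E)%E.
    rewrite leeBlDr//.
    pose G x := (\int[leb]_y (gag s p (U m) (x, y))%:E)%E.
    have mg : measurable_fun setT (fun z => (gag s p (U m) z)%:E).
      by apply/measurable_EFinP; exact: (measurable_gag adm).
    have g0 z : (0 <= (gag s p (U m) z)%:E)%E by rewrite lee_fin gag_ge0.
    have G0 x : (0 <= G x)%E by apply: integral_ge0 => y _; exact: g0.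
    have mG : measurable_fun setT G.
      exact: (measurable_fun_section_integral leb measurableT mg g0).
    have G10 x : (0 <= 1 + G x)%E by rewrite adde_ge0.
    have mG1 : measurable_fun Omega (fun x => 1 + G x)%E.
      by apply: emeasurable_funD; [exact: measurable_cst|exact: measurable_funTS].
    have mTr : measurable_fun Omega (fun x => (trunc M (U m) x)%:E).
      by apply/measurable_EFinP; apply: measurable_funTS; exact: measurable_trunc.
    have hc : (\int[leb]_(x in Omega) (c%:E * (1 + G x)) <= (M `^ (- del) * C')%:E)%E.
      rewrite ge0_integralZl//.
      rewrite (_ : M `^ (- del) * C' = c * ((2 * L) ^+ n + E0)) ?mulrA// (EFinM c).
      apply: lee_wpmul2l; first by rewrite lee_fin.
      rewrite ge0_integralD//; last exact: measurable_funTS.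
      rewrite EFinD integral_cst// mul1e; apply: leeD; first exact: Omega_fin.
      rewrite -(fubini_tonelli_rectangle leb leb mO measurableT mg g0).
      apply: (le_trans (energy_rectangle adm (mU m) (measurableX mO measurableT))).
      by rewrite (energyE adm (XU m)) lee_fin.
    apply: (le_trans _ (leeD2l _ hc)).
    have cG0 x : Omega x -> (0 <= c%:E * (1 + G x))%E by move=> _; exact: mule_ge0.
    have Tr0 x : Omega x -> (0 <= (trunc M (U m) x)%:E)%E by rewrite lee_fin.
    have mcG : measurable_fun Omega (fun x => c%:E * (1 + G x))%E.
      exact: measurable_funeM.
    rewrite -(ge0_integralD leb mO Tr0 mTr cG0 mcG).
    apply: (@le_trans _ _ (modk p Omega (U m))%:E); first by rewrite Uk.
    rewrite (EFin_modk adm (XU m)).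
    apply: ge0_le_integral => //.
    - by move=> x _; rewrite lee_fin divr_ge0 ?powR_ge0// mulr1 ltW.
    - apply/measurable_EFinP; apply: measurable_funTS; apply: measurable_funM; last exact: mden.
      exact: measurable_normr_powR.
    - by apply: emeasurable_funD => //; exact: measurable_funeM.
    move=> x Ox; rewrite mulr1.
    have [UM|UM] := leP `|U m x| M.
      rewrite /trunc (min_idPl UM) -[leLHS]adde0; apply: leeD => //.
      by rewrite mule_ge0.
    have hpx := hp _ (XU m) (UB m) x Ox (le_trans M0M (ltW UM)).
    rewrite -[leLHS]add0e; apply: leeD; first by rewrite lee_fin.
    rewrite /c (EFinM _ C) -muleA; apply: (@le_trans _ _ ((M `^ (- del))%:E *
      (`|U m x| `^ (pbar p x + del))%:E)%E); last first.
      by apply: lee_wpmul2l => //; rewrite lee_fin powR_ge0.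
    rewrite -EFinM lee_fin; set t := `|U m x| in UM *.
    have t0 : 0 < t by exact: lt_trans UM.
    apply: (@le_trans _ _ (t `^ pbar p x)).
      by rewrite ler_pdivrMr// ler_peMr ?powR_ge0// ltW.
    rewrite powRD ?(gt_eqF t0) ?implybT// mulrCA ler_peMr ?powR_ge0//.
    rewrite powRN mulrC ler_pdivlMr ?powR_gt0// mul1r.
    by apply: ge0_ler_powR; rewrite ?nnegrE ltW.
  have : (1%:E - (M `^ (- del) * C')%:E <= \int[leb]_(x in Omega) (trunc M u x)%:E)%E.
    rewrite -(cvg_lim _ (trunc_cvg M1))//.
    apply: lime_ge; first exact: cvgP (trunc_cvg M1).
    by apply: nearW => m; exact: step.
  have : (\int[leb]_(x in Omega) (trunc M u x)%:E <= (modk p Omega u)%:E)%E.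
    rewrite (EFin_modk adm Xu); apply: ge0_le_integral => //.
    - by move=> x _; rewrite lee_fin.
    - by apply/measurable_EFinP; apply: measurable_funTS; exact: measurable_trunc.
    - apply/measurable_EFinP; apply: measurable_funTS; apply: measurable_funM; last exact: mden.
      exact: measurable_normr_powR.
    move=> x _; rewrite mulr1 lee_fin ler_wpM2r ?invr_ge0 ?(ltW (pb0 _))//.
    by apply: ge0_ler_powR; rewrite ?nnegrE ?(ltW (pb0 _)) ?le_min ?normr_ge0 ?(ltW M0')// ge_min lexx.
  move=> h1 h2; have := le_trans h2 h1.
  by rewrite -EFinB lee_fin lerBlDr.
rewrite leNgt; apply/negP => k1.
set k := modk p Omega u in k1 key.
pose e := 1 - k; have e0 : 0 < e by rewrite subr_gt0.
(* Chosen so that M >= M0 and M^del > C' / (1 - k), which contradicts [key]. *)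
pose M := M0 + (C' / e) `^ del^-1 + 1.
have M0M : M0 <= M by rewrite /M -addrA lerDl addr_ge0// powR_ge0.
have := key M M0M; apply/negP; rewrite -ltNge.
have M0' : 0 < M by rewrite (lt_le_trans _ M0M)// (lt_le_trans _ M01).
have hM : C' / e < M `^ del.
  have -> : C' / e = ((C' / e) `^ del^-1) `^ del.
    by rewrite -powRrM mulVf ?powRr1 ?gt_eqF// divr_ge0// ltW.
  apply: gt0_ltr_powR => //; rewrite ?nnegrE ?powR_ge0 ?(ltW M0')//.
  by rewrite /M addrAC ltrDr ltr_wpDl// (le_trans ler01 M01).
rewrite addrC -ltrBrDr -/e powRN mulrC ltr_pdivrMr ?powR_gt0//.
by rewrite mulrC -ltr_pdivrMr.
Qed.

End lower_bound.

(** * Passage to the limit in a minimizing sequence *)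

Section minimizer.
Context {R : realType} {n : nat}.
Variables (s : R) (p : 'rV[R]_n -> 'rV[R]_n -> R) (Omega : set 'rV[R]_n).
Variables qm qM L : R.

Local Notation leb := (lebesgue_rV R n).
Local Notation Lambda1 := (Lambda1 s p Omega).

Hypothesis adm : admissible s p Omega qm qM L.

Lemma Lambda1_ge0 : 0 <= Lambda1.
Proof.
apply: lb_le_inf.
  have [v Xv] := exists_spaceX_nonzero adm.
  by exists (normK s p v / normk p Omega v); exists v.
move=> _ [v Xv <-].
by rewrite divr_ge0 ?(ltW (normK_pos adm Xv))// (ltW (normk_pos adm Xv)).
Qed.

Lemma exists_minimizer : exists u, minimizer s p Omega u.
Proof.
have [u_ [Xu_ uk_ uK0_ uKL_]] := minimizing_sequence adm.
have L0 := Lambda1_ge0.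
pose E0 := qM * (Lambda1 + 1) `^ qM.
have qM0 : 0 <= qM.
  exact: le_trans ler01 (le_trans (ltW (adm_qm1 adm)) (le_trans (adm_qmp adm 0 0) (adm_pqM adm 0 0))).
have uE j : dmodK s p (u_ j) (u_ j) <= E0.
  rewrite -lee_fin -(energyE adm (Xu_ j)).
  apply: (le_trans (energy_le_modK adm (Xu_ j))); rewrite lee_fin ler_wpM2l//.
  apply: (modK_le_normK adm (Xu_ j) (uK0_ j)); last by rewrite lerDr.
  apply: (le_trans (ltW (uKL_ j))); rewrite lerD2l.
  by rewrite invf_le1// ler1n.
have [phi phiP ucv] := compact_sequence adm Xu_ uE.
pose U m := u_ (phi m).
(* An upper limit is measurable without any change on null sets, and [fine] gives it a real value
   where it is infinite; almost everywhere it is the limit. *)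
pose u x := fine (limn_esup (fun m => (U m x)%:E)).
have XU m : spaceX s p Omega (U m) by exact: Xu_.
have mu : measurable_fun setT u.
  apply: (measurableT_comp (fine_measurable measurableT)).
  apply: measurable_fun_limn_esup => m; apply/measurable_EFinP.
  exact: (spaceX_measurable adm (XU m)).
have Uu : {ae leb, forall x, U m x @[m --> \oo] --> u x}.
  apply: filterS ucv => x cx.
  have cE : (U m x)%:E @[m --> \oo] --> (limn (fun m => U m x))%:E.
    by apply: cvg_EFin => //; exact: nearW.
  rewrite /u is_cvg_limn_esupE; last exact: cvgP cE.
  by rewrite (cvg_lim _ cE).
have UE m : dmodK s p (U m) (U m) <= E0 by exact: uE.
have Uk m : modk p Omega (U m) = 1 by exact: uk_.
have Xu := limit_spaceX adm XU mu UE Uk Uu.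
have k1 := limit_modk_ge1 adm XU Xu UE Uk Uu.
have Xnu : spaceX_nonzero s p Omega u.
  by split=> // /(modk_eq0 adm Xu) k0; move: k1; rewrite k0 ler10.
have KL : normK s p u <= Lambda1.
  rewrite leNgt; apply/negP => LK.
  (* For l strictly between Lambda1 and K(u), K(U m) < l for large m bounds the modulars of U m / l
     by 1, and Fatou's lemma gives K(u) <= l. *)
  pose l := (Lambda1 + normK s p u) / 2.
  have Ll : 0 < l - Lambda1 by rewrite /l; lra.
  have lK : l < normK s p u by rewrite /l; lra.
  have l0 : 0 < l by apply: (le_lt_trans L0); rewrite -subr_gt0.
  move: lK; rewrite ltNge => /negP; apply.
  apply: (normK_le_of_modK adm Xu l0).
  rewrite -lee_fin (EFin_modK adm (spaceXZ adm l^-1 Xu)).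
  apply: (limit_modK_le adm XU mu Uu l0).
  have [m0 _ m0P] := near_infty_natSinv_lt (PosNum Ll).
  exists m0 => // m /m0P /= mL.
  rewrite leNgt; apply/negP => K1.
  have := normK_ge adm (XU m) l0 (ltW K1); apply/negP; rewrite -ltNge.
  apply: (lt_le_trans (uKL_ _)); rewrite -lerBrDl; apply: (le_trans _ (ltW mL)).
  by rewrite lef_pV2 ?posrE// ler_nat ltnS.
have kk : 1 <= normk p Omega u.
  apply: (normk_ge adm Xu ltr01).
  by rewrite (_ : (fun x => 1^-1 * u x) = u)//; apply/funext => x; rewrite invr1 mul1r.
exists u; split=> //; apply/eqP; rewrite eq_le.
rewrite (Lambda1_le adm Xnu) andbT.
have k0 : 0 < normk p Omega u by exact: lt_le_trans kk.
rewrite ler_pdivrMr//; apply: (le_trans KL).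
by rewrite ler_peMr.
Qed.

End minimizer.

Theorem theorem4p13 (R : realType) (N : nat) (Omega : set 'rV[R]_N) (s : R)
    (p : 'rV[R]_N -> 'rV[R]_N -> R)
    (hN : (2 <= N)%N)
    (hOmega : bounded_lipschitz_domain Omega)
    (hs : 0 < s < 1)
    (p_cont : continuous (fun z : 'rV[R]_N * 'rV[R]_N => p z.1 z.2))
    (p_sym : forall x y, p x y = p y x)
    (p_inf : (1%:E < ereal_inf
      (range (fun z : 'rV[R]_N * 'rV[R]_N => (p z.1 z.2)%:E)))%E)
    (p_sup : (ereal_sup
      (range (fun z : 'rV[R]_N * 'rV[R]_N => (p z.1 z.2)%:E))
      < (N%:R / s)%:E)%E) :
  [/\ eigenvalue_frac s p Omega (Lambda1 s p Omega),
      (forall Lambda : R,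
        eigenvalue_frac s p Omega Lambda -> Lambda1 s p Omega <= Lambda)
    & (forall u : 'rV[R]_N -> R,
        minimizer s p Omega u -> eigenpair s p Omega (Lambda1 s p Omega) u)].
Proof.
have [Ononempty Oopen _ Obounded _] := hOmega.
have [qm qm1 qmp] : exists2 qm, 1 < qm & forall x y, qm <= p x y.
  have inf_le x y : (ereal_inf (range (fun z : 'rV[R]_N * 'rV[R]_N => (p z.1 z.2)%:E))
      <= (p x y)%:E)%E.
    by apply: ereal_inf_lbound; exists (x, y).
  move: p_inf inf_le; case: ereal_inf => [q| |].
  - by rewrite lte_fin => q1 qp; exists q => // x y; rewrite -lee_fin.
  - by move=> _ /(_ 0 0); rewrite leye_eq.
  - by rewrite ltNge leNye.
have pqM x y : p x y <= N%:R / s.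
  rewrite -lee_fin; apply: (le_trans _ (ltW p_sup)).
  by apply: ereal_sup_ubound; exists (x, y).
have [L L1 OL] : exists2 L, 1 <= L & forall x, Omega x -> forall i, `|x ord0 i| < L.
  have [M [_ MO]] := Obounded.
  (* Boundedness gives a bound for every real above M; it is used at |M| + 1, and |M| + 2 makes it
     strict and at least 1. *)
  exists (`|M| + 2); first by have := normr_ge0 M; lra.
  move=> x Ox i; apply: (le_lt_trans (normr_coord_le x i)).
  have MM : M < `|M| + 1 by rewrite (le_lt_trans (ler_norm M))// ltrDl.
  by apply: (le_lt_trans (MO _ MM x Ox)); rewrite ltrD2l; lra.
have adm : admissible s p Omega qm (N%:R / s) L.
  by split => //; exact: ltn_trans hN.
have K0 := fun u => @modK_gt0 _ _ _ _ _ _ _ _ adm u.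
have eigen u := minimizer_eigenpair adm K0 (u := u).
split=> [||//].
- by have [u /eigen] := exists_minimizer adm; exists u.
- by move=> Lambda; exact: (eigenvalue_ge adm K0).
Qed.
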